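(* Let $n\ge1$ and $G=\mathrm{SL}_n$ over $\mathbb{F}_q$. Let $(y_\alpha)_{\alpha\in J}$ be a family of indeterminates, one for each element of the multiset $J$ (counted with multiplicity). Then there exists a polynomial $\mathcal{P}(x,(y_\alpha))\in\mathbb{Z}[x,(y_\alpha)_{\alpha\in J}]$ such that $$\mathcal{L}(\mathrm{SL}_n,m)=\mathcal{P}\big(q^m,(\alpha^m)_{\alpha\in J}\big)$$ for every $m\in\mathbb{Z}_{>0}$ with $\gcd(n,q^m-1)=1$.
   Context: Setting: $q$ is a power of a prime $p$; $X$ is a smooth projective geometrically connected curve over $\mathbb{F}_q$, $\overline{X}=X\otimes\overline{\mathbb{F}}_q$; $S$ is a finite set of closed points of $X$ with $\#S\ge2$. Fix a prime $\ell\neq p$ and $\overline{\mathbb{Q}}_\ell\cong\mathbb{C}$. $J_X$ is the multiset of eigenvalues of the geometric Frobenius $\mathrm{Fr}_q$ on $H^1_{et}(\overline{X},\mathbb{Q}_\ell)$; $J_S$ is the multiset union over $v\in S$ of all $\deg(v)$-th roots of unity (the eigenvalues of $\mathrm{Fr}_q$ on $H^0(\overline{S},\mathbb{Q}_\ell)$). $J$ is $J_X\sqcup J_S$ with two copies of $1$ removed. Motive of a connected reductive group $H$ over $\mathbb{F}_Q$: with $T_0$ the centralizer of a maximal $\mathbb{F}_Q$-split torus, $W$ the Weyl group, $R=(\mathrm{Sym}(X^*(T_0)\otimes\mathbb{Q}))^W$, $R_+$ its positive-degree ideal, $V=R_+/R_+^2=\bigoplus_{d\ge1}V_d$ graded by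 degree with its Galois action, $M_H=\bigoplus_d V_d(1-d)$ and $\det(1-t\mathrm{Fr}_Q\mid M_H)\coloneqq\prod_{d\ge1}\det(1-tQ^{d-1}\mathrm{Fr}_Q\mid V_d)$. For $m\ge1$, $Q=q^m$ and $H$ connected reductive over $\mathbb{F}_{q^m}$: $L_{S_m}(M_H)\coloneqq\frac{\det(1-\mathrm{Fr}_Q\mid M_H)}{\det(1-Q\mathrm{Fr}_Q\mid M_H)}\prod_{\alpha\in J}\det(1-\alpha^m\mathrm{Fr}_Q\mid M_H)$ (the value at $s=0$ of the $S_m$-modified $L$-function of $M_H$ for $X_m=X\otimes\mathbb{F}_{q^m}$ and the points $S_m$ over $S$). Then $\mathcal{L}(G,m)\coloneqq\sum_{[\gamma]}L_{S_m}(M_{G_\gamma})$, summed over conjugacy classes of semisimple $\gamma\in G(\mathbb{F}_{q^m})$, with $G_\gamma$ the centralizer of $\gamma$ over $\mathbb{F}_{q^m}$. *)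

(* Defs.v *)
From HB Require Import structures.
From mathcomp Require Import all_boot all_order all_algebra all_fingroup all_field.
From mathcomp Require Import boolp classical_sets.
From mathcomp Require Import mpoly.

Set Implicit Arguments.
Unset Strict Implicit.
Unset Printing Implicit Defensive.

Import GRing.Theory.
Local Open Scope classical_set_scope.
Local Open Scope ring_scope.

(** * Curves over F_q

   A smooth projective geometrically connected curve X over F_q is given by its
   function field F = F_q(X), sitting inside an algebraic closure [Omega] of F.
   The algebraic closure of F_q inside [Omega] plays the role of the field of
   constants of the curve over the algebraic closure of F_q. *)

Section Curve.
Variables (p q : nat) (Omega : closedFieldType).
Implicit Types (F O : set Omega) (s g : Omega -> Omega).

Definition Fq : set Omega := [set x | x ^+ q = x].

Definition Fqbar : set Omega := [set x | exists2 j, (0 < j)%N & x ^+ (p ^ j) = x].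

Definition subfield F : Prop :=
  [/\ F 1, forall x y, F x -> F y -> F (x - y)
   & forall x y, F x -> F y -> F (x / y)].

Record curve F : Prop := Curve {
  curve_char : p \in [pchar Omega];
  curve_subfield : subfield F;
  (* F_q is contained in F and algebraically closed in F: X is defined over F_q
     and geometrically connected *)
  curve_constants : F `&` Fqbar = Fq;
  (* F is a finite extension of F_q(t), with t transcendental over F_q *)
  curve_trdeg1 : exists t : Omega, [/\ F t, ~ Fqbar t
    & exists (r : nat) (e : 'I_r -> Omega), (forall i, F (e i)) /\
      forall x, F x -> exists (h : {poly Omega}) (c : 'I_r -> {poly Omega}),
        [/\ h != 0, forall j, Fq h`_j, forall i j, Fq (c i)`_j
          & h.[t] * x = \sum_(i < r) (c i).[t] * e i]];
  curve_algebraic : forall x : Omega, exists f : {poly Omega},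
    [/\ f != 0, forall j, F f`_j & root f x] }.

Definition valuation_ring F O : Prop :=
  [/\ O `<=` F /\ O != F, O 1,
      forall x y, O x -> O y -> O (x - y) /\ O (x * y)
    & forall x, F x -> O x \/ O x^-1].

Definition maximal_ideal O : set Omega :=
  [set x | O x /\ (x = 0 \/ ~ O x^-1)].

(* The closed points of X are the valuation rings of F containing F_q. *)
Definition closed_point F O : Prop := valuation_ring F O /\ Fq `<=` O.

(* [e] induces an F_q-basis of the residue field of O. *)
Definition residue_basis O (d : nat) (e : 'I_d -> Omega) : Prop :=
  (forall i, O (e i)) /\
  forall x, O x -> exists! c : 'rV[Omega]_d,
    (forall i, Fq (c 0 i)) /\ maximal_ideal O (x - \sum_(i < d) c 0 i * e i).

Definition point_degree O : nat :=
  xget 0%N [set d | exists e : 'I_d -> Omega, residue_basis O e].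

(** ** First etale cohomology

   H^1_et(Xbar, Q_l) = Hom_cont(pi_1(Xbar), Q_l), where pi_1(Xbar) is the
   quotient of the absolute Galois group of the function field of Xbar (the
   compositum of F and Fqbar) by the closed normal subgroup generated by the
   inertia groups. *)

Definition field_automorphism s : Prop :=
  [/\ bijective s, {morph s : x y / x + y} & {morph s : x y / x * y}].

Definition geometric_galois F : set (Omega -> Omega) :=
  [set s | [/\ field_automorphism s, forall x, F x -> s x = x
             & forall x, Fqbar x -> s x = x]].

Definition inertia F O : set (Omega -> Omega) :=
  [set s | [/\ geometric_galois F s, forall x, O x <-> O (s x)
             & forall x, O x -> maximal_ideal O (s x - x)]].

(* A lift to [Omega] of the arithmetic Frobenius of Xbar / X. *)
Definition arithmetic_frobenius F s : Prop :=
  [/\ field_automorphism s, forall x, F x -> s x = x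
    & forall x, Fqbar x -> s x = x ^+ q].

(* The ring of l-adic integers, as a subring of a field C of characteristic 0
   playing the role of an algebraic closure of Q_l. *)
Record ladic_integers (l : nat) (C : fieldType) (Zl : set C) : Prop :=
  LadicIntegers {
  Zl_1 : Zl 1;
  Zl_sub : forall x y, Zl x -> Zl y -> Zl (x - y);
  Zl_mul : forall x y, Zl x -> Zl y -> Zl (x * y);
  Zl_residue : forall x, Zl x -> exists2 a, (a < l)%N & Zl ((x - a%:R) / l%:R);
  Zl_separated : forall x, (forall j, Zl (x / l%:R ^+ j)) -> x = 0;
  Zl_complete : forall u : nat -> nat, exists x, forall j,
    Zl ((x - \sum_(i < j) (u i)%:R * l%:R ^+ i) / l%:R ^+ j) }.

Variables (l : nat) (C : closedFieldType) (Zl : set C).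

Definition Ql : set C := [set x | exists j, Zl (l%:R ^+ j * x)].

Definition H1_et F : set ((Omega -> Omega) -> C) :=
  [set h | [/\ forall s, geometric_galois F s -> Ql (h s),
      forall s s', geometric_galois F s -> geometric_galois F s' ->
        h (s \o s') = h s + h s',
      (* continuity for the Krull and l-adic topologies *)
      forall j, exists a : seq Omega, forall s, geometric_galois F s ->
        {in a, forall x, s x = x} -> Zl (h s / l%:R ^+ j)
    & forall O, valuation_ring setT O ->
        forall s, inertia F O s -> h s = 0]].

Definition H1_basis F (r : nat) (b : 'I_r -> (Omega -> Omega) -> C) : Prop :=
  (forall i, H1_et F (b i)) /\
  forall h, H1_et F h -> exists! c : 'rV[C]_r, (forall i, Ql (c 0 i)) /\
    forall s, geometric_galois F s -> h s = \sum_(i < r) c 0 i * b i s.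

(* [JX] lists, with multiplicity, the eigenvalues of the geometric Frobenius on
   H^1.  The arithmetic Frobenius [phi] sends h to s |-> h (phi^-1 s phi); the
   geometric Frobenius is its inverse. *)
Definition H1_frobenius_eigenvalues F (JX : seq C) : Prop :=
  exists (phi phi' : Omega -> Omega) (r : nat)
         (b : 'I_r -> (Omega -> Omega) -> C) (A : 'M[C]_r),
  [/\ arithmetic_frobenius F phi, cancel phi phi' /\ cancel phi' phi,
      H1_basis F b,
      (forall i j, Ql (A i j)) /\ forall i s, geometric_galois F s ->
        b i (phi \o s \o phi') = \sum_(j < r) A i j * b j s
    & char_poly A = \prod_(a <- JX) ('X - a%:P)].

End Curve.

Arguments Fq q Omega : clear implicits.
Arguments Fqbar p Omega : clear implicits.

Definition roots_multiset (C : closedFieldType) (f : {poly C}) : seq C :=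
  sval (closed_field_poly_normal f).

Definition H0_eigenvalues (q : nat) (Omega C : closedFieldType)
    (S : seq (set Omega)) : seq C :=
  flatten [seq roots_multiset ('X^(point_degree q v) - 1) | v <- S].

Definition J_multiset (q : nat) (Omega C : closedFieldType) (JX : seq C)
    (S : seq (set Omega)) : seq C :=
  rem 1 (rem 1 (JX ++ H0_eigenvalues q C S)).

(** * The motive of a linear algebraic group over a finite field

   A linear algebraic group over the finite field [k] is given by its set
   [H] of points in GL_N over the algebraic closure [K] of [k]. *)

Section Motive.
Variables (k : finFieldType) (K : closedFieldType) (iota : {rmorphism k -> K}).
Variable N : nat.
Implicit Types (H A T : set 'M[K]_N).

Definition mx_eval (f : {mpoly K[N * N]}) (g : 'M[K]_N) : K :=
  f.@[fun i => mxvec g 0 i].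

Definition zariski_closed A : Prop :=
  exists I : set {mpoly K[N * N]},
    A = [set g | g \in unitmx /\ forall f, I f -> mx_eval f g = 0].

Definition zariski_connected A : Prop :=
  forall B1 B2, zariski_closed B1 -> zariski_closed B2 ->
    A = B1 `|` B2 -> B1 `&` B2 = set0 -> B1 = set0 \/ B2 = set0.

Definition closed_subgroup A : Prop :=
  [/\ zariski_closed A, A 1%:M, forall g h, A g -> A h -> A (g *m h)
    & forall g, A g -> A (invmx g)].

(* A k-split torus: a connected closed subgroup diagonalizable over k. *)
Definition split_torus A : Prop :=
  [/\ closed_subgroup A, zariski_connected A
    & exists2 P : 'M[k]_N, P \in unitmx &
      forall a, A a ->
        is_diag_mx (map_mx iota P *m a *m invmx (map_mx iota P))].

Definition maximal_split_torus H A : Prop :=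
  [/\ split_torus A, A `<=` H
    & forall B, split_torus B -> B `<=` H -> A `<=` B -> B = A].

Definition centralizer H A : set 'M[K]_N :=
  [set h | H h /\ forall a, A a -> h *m a = a *m h].

Definition normalizer H T : set 'M[K]_N :=
  [set h | H h /\ forall t, T t <-> T (invmx h *m t *m h)].

Definition character T (chi : 'M[K]_N -> K) : Prop :=
  [/\ forall t, T t -> chi t != 0,
      forall t u, T t -> T u -> chi (t *m u) = chi t * chi u
    & exists (f : {mpoly K[N * N]}) (j : nat),
        forall t, T t -> chi t = mx_eval f t / (\det t) ^+ j].

Definition character_basis T (r : nat) (chi : 'I_r -> 'M[K]_N -> K) : Prop :=
  (forall i, character T (chi i)) /\
  forall psi, character T psi -> exists! a : 'rV[int]_r,
    forall t, T t -> psi t = \prod_(i < r) chi i t ^ a 0 i.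

Definition frobenius_mx (g : 'M[K]_N) : 'M[K]_N :=
  map_mx (fun x => x ^+ #|k|) g.

Section SymmetricAlgebra.
Variables (H T : set 'M[K]_N) (r : nat) (chi : 'I_r -> 'M[K]_N -> K).

(* Through [chi], Sym(X^*(T) (x) Q) is Q[X_1, ..., X_r], and the endomorphism
   of X^*(T) with matrix M acts on it by X_i |-> \sum_j M_ij X_j. *)
Definition sym_act (M : 'M[int]_r) (f : {mpoly rat[r]}) : {mpoly rat[r]} :=
  f \mPo [tuple \sum_(j < r) (M i j)%:~R *: 'X_j | i < r].

Definition weyl_matrix (w : 'M[K]_N) (M : 'M[int]_r) : Prop :=
  forall i t, T t ->
    chi i (invmx w *m t *m w) = \prod_(j < r) chi j t ^ M i j.

(* The Frobenius x |-> x^Q of K sends chi to the character (Fr chi) with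
   (Fr chi) (t^(Q)) = chi(t)^Q, where t^(Q) is [frobenius_mx t]. *)
Definition frobenius_matrix (M : 'M[int]_r) : Prop :=
  forall i t, T t ->
    chi i t ^+ #|k| = \prod_(j < r) chi j (frobenius_mx t) ^ M i j.

Definition weyl_invariants : set {mpoly rat[r]} :=
  [set f | forall w M, normalizer H T w -> weyl_matrix w M -> sym_act M f = f].

Definition positive_ideal : set {mpoly rat[r]} :=
  [set f | weyl_invariants f /\ f@_0%MM = 0].

Definition positive_ideal_square : set {mpoly rat[r]} :=
  [set f | exists (s : nat) (g h : 'I_s -> {mpoly rat[r]}),
    (forall i, positive_ideal (g i) /\ positive_ideal (h i)) /\
    f = \sum_(i < s) g i * h i].

(* [f] induces a basis of the degree d part V_d of R_+ / R_+^2. *)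
Definition V_basis (d s : nat) (f : 'I_s -> {mpoly rat[r]}) : Prop :=
  (forall i, positive_ideal (f i) /\ f i \is d.-homog) /\
  forall g, positive_ideal g -> g \is d.-homog -> exists! c : 'rV[rat]_s,
    positive_ideal_square (g - \sum_(i < s) c 0 i *: f i).

(* P = det(1 - X Fr | V_d) *)
Definition V_frobenius_det (MF : 'M[int]_r) (d : nat) (P : {poly rat}) : Prop :=
  exists (s : nat) (f : 'I_s -> {mpoly rat[r]}) (B : 'M[rat]_s),
  [/\ V_basis d f,
      forall i,
        positive_ideal_square (sym_act MF (f i) - \sum_(j < s) B i j *: f j)
    & P = \det (1%:M - 'X *: map_mx polyC B)].

End SymmetricAlgebra.

(* [V d] is det(1 - X Fr | V_d) for d >= 1; these polynomials do not depend on
   the choices of the maximal split torus and of the bases. *)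
Definition is_motive_dets H (V : nat -> {poly rat}) : Prop :=
  exists (A : set 'M[K]_N) (r : nat) (chi : 'I_r -> 'M[K]_N -> K)
         (MF : 'M[int]_r),
  let T0 := centralizer H A in
  [/\ maximal_split_torus H A, character_basis T0 chi,
      frobenius_matrix T0 chi MF
    & forall d, (0 < d)%N -> V_frobenius_det H T0 chi MF d (V d)].

Definition motive_dets H : nat -> {poly rat} :=
  xget (fun=> 1) [set V | is_motive_dets H V].

(* A degree beyond which V_d = 0 and det(1 - X Fr | V_d) = 1. *)
Definition motive_bound H : nat :=
  xget 0%N [set D | forall d, (D < d)%N -> motive_dets H d = 1].

(* det(1 - t Fr | M_H) *)
Definition det_motive (C : fieldType) H (t : C) : C :=
  \prod_(1 <= d < (motive_bound H).+1)
    (map_poly ratr (motive_dets H d)).[t * #|k|%:R ^+ (d - 1)].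

(* L_{S_m}(M_H), for k = F_{q^m} *)
Definition L_motive (C : fieldType) (J : seq C) (m : nat) H : C :=
  det_motive H 1 / det_motive H (#|k|%:R : C) *
  \prod_(a <- J) det_motive H (a ^+ m).

End Motive.

(** * The special linear group

   The library's {'GL_n[k]} consists of matrices of size n.-1.+1, which is n
   for n > 0. *)

Definition SL (n : nat) (k : finFieldType) : {set {'GL_n[k]}} :=
  [set g : {'GL_n[k]} | \det (GLval g) == 1].

Section SpecialLinear.
Variables (k : finFieldType) (K : closedFieldType) (iota : {rmorphism k -> K}).
Variable n : nat.

Definition SLbar : set 'M[K]_(n.-1.+1) := [set g | \det g = 1].

Definition semisimple (g : {'GL_n[k]}) : Prop :=
  diagonalizable (map_mx iota (GLval g)).

Definition SL_centralizer (g : {'GL_n[k]}) : set 'M[K]_(n.-1.+1) :=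
  centralizer SLbar [set map_mx iota (GLval g)].

Definition L_SL (C : fieldType) (J : seq C) (m : nat) : C :=
  \sum_(c in classes (SL n k) | `[< semisimple (repr c) >])
    L_motive iota J m (SL_centralizer (repr c)).

End SpecialLinear.

(* Main.v *)
Require Import Defs.
From HB Require Import structures.
From mathcomp Require Import all_boot all_order all_algebra all_fingroup all_solvable all_field.
From mathcomp Require Import boolp classical_sets.
From mathcomp Require Import mpoly zify ring.

(* Let Q = q^m, k = F_Q, and let s be a semisimple element of SL_n(k). Over the
   algebraic closure, the centralizer of s is the determinant-one part of a
   product of general linear groups, one for each eigenvalue, permuted by the
   Frobenius. If the Frobenius has several orbits on the eigenvalues, the
   centralizer has a non-trivial split central torus, so det(1 - Fr | M) = 0 and
   s does not contribute. If all eigenvalues are conjugate, to x of degree d say,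
   the motive depends only on d: det(1 - t Fr | M) is
   D_d(t) = (1 + t + ... + t^(d-1)) prod_(0 < j < n/d) (1 - (t Q^j)^d).
   The corresponding classes are the Frobenius orbits of the x such that
   x^(1 + Q + ... + Q^(n-1)) = 1, so that
   [n]_Q L(SL_n, m) = sum_x prod_(a in J) D_(deg x)(a^m), where
   [n]_Q = 1 + Q + ... + Q^(n-1).
   When n is prime to Q - 1, the number of x of degree d | n is z_d(Q), where
   sum_(d | e) z_d = 1 + X + ... + X^(e-1). It remains to divide by [n]_Q as a
   polynomial: at a root of unity of order r | n, D_d only depends on lcm(d, r),
   and the values of z_d over the d with a given lcm(d, r) sum to 0 if r > 1. *)


Set Implicit Arguments.
Unset Strict Implicit.
Unset Printing Implicit Defensive.

Import GRing.Theory Num.Theory.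
Local Open Scope ring_scope.

(** * Divisibility by 1 + x + ... + x^(n-1) *)

(** Since [motive_dets] is picked by [xget], its values must be found for every maximal split torus
    and every basis of characters. Each such torus is recovered from a frame: a matrix P whose rows
    are eigenvectors of s permuted by the Frobenius, the permutation [sg] having cycles as short as
    possible. The centralizer of the torus is then the full torus of determinant-one matrices
    diagonal in the frame, its Weyl group permutes equal eigenvalues, and [sg] gives the Frobenius.
    V_e has as basis the e-th power sums of the blocks of equal eigenvalues with at least e
    elements; in degree 1 the trace relation removes one block, so that D_d starts with (1 - t^d) /
    (1 - t) instead of 1 - t^d. The factor [n]_Q comes from D_d(1) / D_d(Q) = d / [n]_Q, and d is
    also the number of x that give the same class. Coprimality makes the count of the x uniform in
    Q: for e | n and x in F_(Q^e), the condition on x says that its norm to F_Q has (n/e)-th power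
    1, which then forces this norm to be 1. *)

Lemma sum_prim_root_eq0 (R : idomainType) (r n : nat) (z : R) : (1 < r)%N ->
  r.-primitive_root z -> (r %| n)%N -> \sum_(i < n) z ^+ i = 0.
Proof.
move=> r1 zp rn; have /eqP : (z - 1) * (\sum_(i < n) z ^+ i) = 0.
  by rewrite -subrX1 (eqP (_ : z ^+ n == 1)) ?subrr // -(prim_order_dvd zp).
rewrite mulf_eq0 subr_eq0 => /orP[/eqP z1|/eqP //].
by have := prim_order_dvd zp 1; rewrite expr1 z1 eqxx dvdn1 gtn_eqF.
Qed.

Lemma sum_dvdn_widen (V : nmodType) (z : nat -> V) (m n : nat) :
  (0 < m <= n)%N ->
  \sum_(d < n.+1 | (d %| m)%N) z d = \sum_(d < m.+1 | (d %| m)%N) z d.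
Proof.
move=> /andP[m0 mn].
rewrite [RHS](big_ord_widen_cond n.+1 (fun d => d %| m)%N) //.
by apply: eq_bigl => d; case: (boolP (d %| m)%N) => //= dm; rewrite ltnS dvdn_leq.
Qed.

Lemma divisor_sum_inversion (V : zmodType) (g : nat -> V) :
  exists z : nat -> V, forall e, (0 < e)%N -> \sum_(d < e.+1 | (d %| e)%N) z d = g e.
Proof.
(* [k] is fuel for the recursion over proper divisors; by [zfE] the value at d no longer depends on
   it once it is at least d. *)
pose fix zf (k d : nat) {struct k} : V :=
  if k is k'.+1 then g d - \sum_(i < d | (i %| d)%N) zf k' i else 0.
have zfE k k' d : (0 < d)%N -> (d <= k)%N -> (d <= k')%N -> zf k d = zf k' d.
  elim: k k' d => [|k IH] [|k'] d d0; rewrite ?(leqNgt d) ?d0 //= => dk dk'.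
  congr (_ - _); apply: eq_bigr => i id.
  have i0 : (0 < i)%N by apply: dvdn_gt0 id.
  by apply: IH => //; rewrite -ltnS; [move: dk | move: dk']; rewrite -leqNgt;
    apply: leq_trans.
exists (fun d => zf d d) => e e0; rewrite big_mkcond big_ord_recr /= dvdnn -big_mkcond.
case: e e0 => // e _ /=; rewrite addrC -[RHS](subrK (\sum_(i < e.+1 | (i %| e.+1)%N) zf e i)).
congr (_ + _); apply: eq_bigr => i id; apply: zfE => //.
  by apply: dvdn_gt0 id.
by rewrite -ltnS.
Qed.

(* det(1 - t Fr | M) for the centralizer of an element of SL_n over a field of
   cardinality c, with d conjugate eigenvalues of multiplicity n / d. *)
Definition orbit_factor (R : comNzRingType) (n d : nat) (t c : R) : R :=
  (\sum_(i < d) t ^+ i) * \prod_(j < (n %/ d).-1) (1 - (t * c ^+ j.+1) ^+ d).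

Lemma rmorph_orbit_factor (R S : comNzRingType) (f : {rmorphism R -> S}) n d t c :
  f (orbit_factor n d t c) = orbit_factor n d (f t) (f c).
Proof.
rewrite /orbit_factor rmorphM rmorph_sum rmorph_prod; congr (_ * _).
  by apply: eq_bigr => i _; rewrite rmorphXn.
by apply: eq_bigr => i _; rewrite rmorphB rmorph1 rmorphXn rmorphM rmorphXn.
Qed.

(** The geometric sum times 1 - t is the missing factor j = 0. The full product is the analogous
    determinant for the centralizer in GL_n, and it is easier to compare at roots of unity. *)
Lemma orbit_factorE (R : comNzRingType) n d (t c : R) : (0 < d)%N -> (d %| n)%N ->
  (0 < n)%N ->
  (1 - t) * orbit_factor n d t c = \prod_(j < n %/ d) (1 - (t * c ^+ j) ^+ d).
Proof.
move=> d0 dn n0; have nd : (0 < n %/ d)%N by rewrite divn_gt0 // dvdn_leq.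
rewrite /orbit_factor mulrA -(prednK nd) big_ord_recl expr0 mulr1; congr (_ * _).
by rewrite -opprB mulNr -subrX1 opprB.
Qed.

Lemma prod_one_sub_root_field (F : fieldType) (s : nat) (z t : F) :
  s.-primitive_root z -> \prod_(j < s) (1 - t * z ^+ j) = 1 - t ^+ s.
Proof.
move=> zp; have [->|t0] := eqVneq t 0.
  rewrite expr0n gtn_eqF ?(prim_order_gt0 zp) // subr0.
  by apply: big1 => j _; rewrite mul0r subr0.
have -> : 1 - t ^+ s = t ^+ s * ('X^s - 1).[t^-1].
  by rewrite !hornerE mulrBr mulr1 exprVn divff // expf_neq0.
rewrite -(factor_Xn_sub_1 zp) horner_prod big_mkord.
have -> : t ^+ s = \prod_(j < s) t by rewrite prodr_const card_ord.
rewrite -big_split; apply: eq_bigr => j _ /=.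
by rewrite hornerXsubC mulrBr divff.
Qed.

Lemma prod_one_sub_root (R : idomainType) (s : nat) (z t : R) :
  s.-primitive_root z -> \prod_(j < s) (1 - t * z ^+ j) = 1 - t ^+ s.
Proof.
move=> zp; apply/eqP; rewrite -tofrac_eq; apply/eqP; rewrite rmorph_prod /=.
under eq_bigr => j _ do rewrite rmorphB rmorph1 rmorphM rmorphXn.
rewrite rmorphB rmorph1 rmorphXn prod_one_sub_root_field //.
rewrite /primitive_root_of_unity (prim_order_gt0 zp); apply/forallP => i.
have /andP[_ /forallP/(_ i)] := zp; rewrite !unity_rootE.
by move: (tofrac_eq (z ^+ i.+1) 1); rewrite tofracXn tofrac1 => <-.
Qed.

Lemma prod_periodic (R : comNzRingType) (s e : nat) (f : nat -> R) :
  (forall j, f (s + j)%N = f j) ->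
  \prod_(j < s * e) f j = (\prod_(j < s) f j) ^+ e.
Proof.
move=> fper; elim: e => [|e IH]; first by rewrite muln0 big_ord0.
rewrite mulnS big_split_ord /= exprS -IH; congr (_ * _).
by apply: eq_bigr => j _; rewrite fper.
Qed.

(** After multiplication by 1 - t, the j-th factor only depends on j modulo the order s = r / gcd(d,
    r) of z^d, and the product over one period is 1 - t^l with l = lcm(d, r). Both sides become (1 -
    t^l)^(n/l), and 1 - t can be cancelled. *)
Lemma orbit_factor_lcm (R : idomainType) (n d r : nat) (z t : R) :
  (0 < n)%N -> (d %| n)%N -> r.-primitive_root z -> (r %| n)%N -> t != 1 ->
  orbit_factor n d t z = orbit_factor n (lcmn d r) t z.
Proof.
move=> n0 dn zp rn t1; have r0 := prim_order_gt0 zp.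
have key e : (e %| n)%N -> (1 - t) * orbit_factor n e t z =
    (1 - t ^+ lcmn e r) ^+ (n %/ lcmn e r).
  move=> en; have e0 : (0 < e)%N by apply: dvdn_gt0 en.
  have ln : (lcmn e r %| n)%N by rewrite dvdn_lcm en rn.
  have g0 : (0 < gcdn e r)%N by rewrite gcdn_gt0 e0.
  rewrite orbit_factorE //; pose s := (r %/ gcdn e r)%N.
  have lE : (lcmn e r = e * s)%N by rewrite /s muln_divA ?dvdn_gcdr.
  have ndE : (n %/ e = s * (n %/ lcmn e r))%N.
    by rewrite -{1}(divnK ln) lE mulnCA mulKn // mulnC.
  rewrite ndE (prod_periodic _ (f := fun j => 1 - (t * z ^+ j) ^+ e)).
    have zep : s.-primitive_root (z ^+ e) by apply: exp_prim_root.
    under eq_bigr => j _ do rewrite exprMn exprAC.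
    by rewrite prod_one_sub_root // -exprM -lE.
  move=> j; rewrite !exprMn exprD exprMn; congr (1 - _ * _).
  rewrite -[X in X * _]exprM -[(s * e)%N]mulnC -lE.
  have /dvdnP[q ->] := dvdn_lcmr e r.
  by rewrite mulnC exprM (prim_expr_order zp) expr1n mul1r.
apply: (@mulfI _ (1 - t)); first by rewrite subr_eq0 eq_sym.
rewrite !key //; last by rewrite dvdn_lcm dn rn.
by rewrite (lcmn_idPl (dvdn_lcmr d r)).
Qed.

(** The terms are grouped by m = lcm(d, r), and the total weight [W m] of a group vanishes by strong
    induction on m: if r | m, the d with lcm(d, r) | m are the divisors of m, whose weights sum to 1
    + z + ... + z^(m-1) = 0. *)
Lemma sum_orbit_factor_eq0 (R : idomainType) (n N r : nat) (z : R) (w : nat -> R)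
    (t : 'I_N -> R) : (0 < n)%N -> (1 < r)%N -> (r %| n)%N -> r.-primitive_root z ->
  (forall e, (0 < e)%N -> \sum_(d < e.+1 | (d %| e)%N) w d = \sum_(i < e) z ^+ i) ->
  (forall i, t i != 1) ->
  \sum_(d < n.+1 | (d %| n)%N) w d * \prod_(i < N) orbit_factor n d (t i) z = 0.
Proof.
move=> n0 r1 rn zp wE t1.
pose h m := \prod_(i < N) orbit_factor n m (t i) z.
pose W m := \sum_(d < n.+1 | (d %| n)%N && (lcmn d r == m)) w d.
have lcm_le d : (d %| n)%N -> (lcmn d r < n.+1)%N.
  by move=> dn; rewrite ltnS dvdn_leq // dvdn_lcm dn rn.
transitivity (\sum_(m < n.+1) W m * h m).
  transitivity (\sum_(d < n.+1 | (d %| n)%N) \sum_(m < n.+1 | lcmn d r == m) w d * h m).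
    apply: eq_bigr => d dn; rewrite (big_pred1 (Ordinal (lcm_le d dn))).
      congr (_ * _); apply: eq_bigr => i _.
      exact: (orbit_factor_lcm (r := r)).
    by move=> m; rewrite /= -val_eqE /= eq_sym.
  rewrite (exchange_big_dep predT) //=; apply: eq_bigr => m _.
  by rewrite mulr_suml.
apply: big1 => -[m ltm] _ /=; suff -> : W m = 0 by rewrite mul0r.
move: ltm; elim/ltn_ind: m => m IH ltm.
have [rm|nrm] := boolP (r %| m)%N; last first.
  apply: big1 => d /andP[_ /eqP e]; case/negP: nrm; rewrite -e; exact: dvdn_lcmr.
have [m0|m0] := posnP m.
  apply: big1 => d /andP[dn /eqP e]; have d0 : (0 < d)%N by apply: dvdn_gt0 dn.
  by have := lcmn_gt0 d r; rewrite e m0 ltnn d0 (ltnW r1).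
have [mn|nmn] := boolP (m %| n)%N; last first.
  apply: big1 => d /andP[dn /eqP e]; case/negP: nmn; rewrite -e dvdn_lcm dn //.
have : \sum_(m' < m.+1 | (m' %| m)%N) W m' = 0.
  transitivity (\sum_(d < n.+1 | (d %| m)%N) w d); last first.
    have mle : (0 < m <= n)%N by rewrite m0 dvdn_leq.
    by rewrite (sum_dvdn_widen w mle) (wE m m0) (sum_prim_root_eq0 r1 zp).
  rewrite /W (exchange_big_dep (fun d : 'I_n.+1 => (d %| m)%N)) /=; last first.
    move=> m' d m'm /andP[_ /eqP e]; apply: dvdn_trans m'm; rewrite -e; exact: dvdn_lcml.
  apply: eq_bigr => d dm; have lm : (lcmn d r %| m)%N by rewrite dvdn_lcm dm.
  have ltl : (lcmn d r < m.+1)%N by rewrite ltnS dvdn_leq.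
  rewrite (big_pred1 (Ordinal ltl)) // => m'; rewrite /= -val_eqE /= (dvdn_trans dm mn) /=.
  by rewrite eq_sym; case: eqP => [->|]; rewrite ?andbT ?andbF.
rewrite big_mkcond big_ord_recr /= dvdnn big1 ?add0r // => m' _.
case: ifP => // _; apply: IH => //; exact: ltn_trans (ltn_ord m') ltm.
Qed.

(* The quotient is computed in [Z[y][x]] by the monic polynomial
   [1 + x + ... + x^(n-1)]; the remainder vanishes because it does so at every
   nontrivial [n]-th root of unity. *)
Lemma orbit_polynomial (n N : nat) (z : nat -> {poly int}) : (0 < n)%N ->
  (forall e, (0 < e)%N -> \sum_(d < e.+1 | (d %| e)%N) z d = \sum_(i < e) 'X^i) ->
  exists P : {mpoly int[N.+1]}, forall (C : comNzRingType) (c : C) (y : 'I_N -> C),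
    (\sum_(i < n) c ^+ i) *
      mmap intr (fun i => if unlift ord0 i is Some j then y j else c) P =
    \sum_(d < n.+1 | (d %| n)%N)
      (map_poly intr (z d)).[c] * \prod_(i < N) orbit_factor n d (y i) c.
Proof.
move=> n0 zE; pose R := {mpoly int[N.+1]}; pose E := {mpoly algC[N.+1]}.
pose q : {poly R} := \sum_(i < n) 'X^i.
pose yv (i : 'I_N) : R := 'X_(lift ord0 i).
pose F : {poly R} := \sum_(d < n.+1 | (d %| n)%N)
  map_poly intr (z d) * \prod_(i < N) orbit_factor n d (yv i)%:P 'X.
have qE : q = \poly_(i < n) 1.
  by rewrite poly_def; apply: eq_bigr => i _; rewrite scale1r.
have szq : size q = n by rewrite qE size_poly_eq // oner_eq0.
have q_monic : q \is monic.
  by rewrite monicE lead_coefE szq qE coef_poly prednK // leqnn.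
have divF : F = Pdiv.Ring.rdivp F q * q.
  have FE := Pdiv.RingMonic.rdivp_eq q_monic F.
  rewrite {1}FE -[RHS]addr0; congr (_ + _); set rem := Pdiv.Ring.rmodp F q in FE *.
  have szr : (size rem < n)%N by rewrite -szq Pdiv.Ring.ltn_rmodpN0 // monic_neq0.
  pose f : {rmorphism R -> E} := map_mpoly intr.
  have f_inj : injective f.
    move=> a b ab; apply/mpolyP => m; have := congr1 (mcoeff m) ab.
    by rewrite /f /= !mcoeff_map_mpoly => /intr_inj.
  apply: (map_inj_poly f_inj (rmorph0 _)); rewrite map_poly0 /=.
  have [z0 zp0] := C_prim_root_exists n0.
  pose zE0 : E := z0%:MP.
  have zEp : n.-primitive_root zE0.
    rewrite /primitive_root_of_unity n0; apply/forallP => i.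
    have /andP[_ /forallP/(_ i)] := zp0; rewrite !unity_rootE /zE0 -rmorphXn -mpolyC1.
    by rewrite (inj_eq (can_inj (@mpolyCK _ _))).
  apply: (@roots_geq_poly_eq0 _ _ [seq zE0 ^+ i | i <- iota 1 n.-1]).
  - apply/allP => x /mapP[i]; rewrite mem_iota add1n prednK // => /andP[i0 ltin] ->.
    set x0 := zE0 ^+ i; have xp : (n %/ gcdn i n).-primitive_root x0.
      exact: exp_prim_root.
    have r1 : (1 < n %/ gcdn i n)%N.
      rewrite ltn_divRL ?dvdn_gcdr // mul1n.
      by apply: leq_ltn_trans ltin; rewrite dvdn_leq // dvdn_gcdl.
    have rn : (n %/ gcdn i n %| n)%N by rewrite dvdn_div // dvdn_gcdr.
    have qx : (map_poly f q).[x0] = 0.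
      rewrite /q rmorph_sum horner_sum /=.
      under eq_bigr => j _ do rewrite map_polyXn hornerXn.
      exact: sum_prim_root_eq0 r1 xp rn.
    have Fx : (map_poly f F).[x0] = 0.
      rewrite rmorph_sum horner_sum /=.
      under eq_bigr => d _.
        rewrite rmorphM hornerM rmorph_prod horner_prod /=.
        under eq_bigr => j _ do
          rewrite rmorph_orbit_factor -[_.[x0]]/(horner_eval x0 _)
            rmorph_orbit_factor /= map_polyC map_polyX /horner_eval hornerC hornerX.
        rewrite -map_poly_comp; over.
      apply: (@sum_orbit_factor_eq0 _ n N _ x0
        (fun d => (map_poly (f \o intr) (z d)).[x0]) (fun j => f (yv j)) n0 r1 rn xp).
        move=> e e0; rewrite -horner_sum -rmorph_sum /= zE // rmorph_sum horner_sum.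
        by apply: eq_bigr => j _; rewrite /= map_polyXn hornerXn.
      (* The y_j are indeterminates, hence different from 1, whereas the powers a^m substituted for
         them later may equal 1. This is why the remainder is tested before specialization. *)
      move=> j; rewrite /f /yv /= map_mpolyX; apply/eqP => /(congr1 (mcoeff 0%MM)).
      rewrite mcoeffX mcoeff1 eqxx -mdeg_eq0 mdeg1 => /eqP.
      by rewrite eq_sym oner_eq0.
    have := congr1 (fun p => (map_poly f p).[x0]) FE.
    by rewrite rmorphD rmorphM hornerD hornerM qx mulr0 add0r Fx => /esym/eqP.
  - rewrite map_inj_in_uniq ?iota_uniq // => i j; rewrite !mem_iota add1n prednK //.
    move=> /andP[_ lti] /andP[_ ltj] /eqP; rewrite (eq_prim_root_expr zEp).
    by rewrite !modn_small // => /eqP.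
  rewrite size_map size_iota; apply: leq_trans (size_poly _ _) _.
  by rewrite -ltnS prednK.
(* The division takes place in one more variable, over coefficients that involve only the y_j;
   evaluating at ['X_ord0] turns that variable into variable 0. *)
exists (Pdiv.Ring.rdivp F q).['X_ord0] => C c y.
set val := fun i : 'I_N.+1 => _.
pose g : {rmorphism R -> C} := mmap intr val.
have gX0 : g 'X_ord0 = c by rewrite /g /= mmapX mmap1U /val unlift_none.
have gy i : g (yv i) = y i by rewrite /g /= mmapX mmap1U /val liftK.
have := congr1 (fun p => g p.['X_ord0]) divF; rewrite hornerM rmorphM => FE.
have -> : \sum_(i < n) c ^+ i = g q.['X_ord0].
  rewrite /q horner_sum rmorph_sum; apply: eq_bigr => i _.
  by rewrite hornerXn rmorphXn gX0.
rewrite mulrC -FE /F horner_sum rmorph_sum; apply: eq_bigr => d _.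
rewrite hornerM rmorphM horner_prod rmorph_prod; congr (_ * _).
  by rewrite -horner_map gX0 -map_poly_comp; congr (_.[_]); apply: eq_map_poly => a /=; rewrite rmorph_int.
apply: eq_bigr => i _; rewrite -[_.['X_ord0]]/(horner_eval 'X_ord0 _).
have -> : horner_eval 'X_ord0 (orbit_factor n d (yv i)%:P 'X) =
    orbit_factor n d (yv i) ('X_ord0 : R).
  by rewrite rmorph_orbit_factor /= /horner_eval hornerC hornerX.
by rewrite rmorph_orbit_factor gX0 gy.
Qed.

(** * The Frobenius map on the algebraic closure of a finite field *)

Lemma expr_gcdn_eq1 (F : fieldType) (y : F) (a b : nat) : (0 < a)%N ->
  y ^+ a = 1 -> y ^+ b = 1 -> y ^+ gcdn a b = 1.
Proof.
move=> a0 ya yb; have [m mp ma] := prim_order_exists a0 ya.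
have mb : (m %| b)%N by rewrite (prim_order_dvd mp) yb.
by apply/eqP; rewrite -(prim_order_dvd mp) dvdn_gcd ma.
Qed.

Lemma closed_nonroot_neq0 (K : closedFieldType) (p : {poly K}) : p != 0 ->
  exists2 x, x != 0 & p.[x] != 0.
Proof.
move=> p0; have /closed_nonrootP[x] : p * 'X != 0 by rewrite mulf_neq0 ?polyX_eq0.
by rewrite rootE hornerMX mulf_eq0 negb_or => /andP[px x0]; exists x.
Qed.

Lemma unity_roots_closed (K : closedFieldType) (N : nat) : N%:R != 0 :> K ->
  exists rs : seq K, [/\ uniq rs, size rs = N & forall x, (x \in rs) = (x ^+ N == 1)].
Proof.
move=> NK; have N0 : (0 < N)%N by rewrite lt0n; apply: contraNneq NK => ->.
have [rs] := closed_field_poly_normal ('X^N - 1 : {poly K}).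
rewrite lead_coefXnsubC // scale1r => rsE.
have mem_rs x : (x \in rs) = (x ^+ N == 1).
  by rewrite -root_prod_XsubC -rsE rootE !hornerE subr_eq0.
exists rs; split => //; last first.
  by apply: succn_inj; rewrite -(size_prod_XsubC rs id) -rsE size_XnsubC.
rewrite -separable_prod_XsubC -rsE unlock.
apply/Bezout_coprimepP; exists (- N%:R%:P, 'X); rewrite /= derivB derivC subr0 derivXn.
rewrite mulrnAr -exprS prednK // mulrBr mulr1 mulNr opprK.
rewrite polyC_natr mulr_natl addrC addrA subrr add0r.
by rewrite -polyC_natr polyC_eqp1.
Qed.

Lemma exists_prim_root (K : closedFieldType) (N : nat) : N%:R != 0 :> K ->
  exists z : K, N.-primitive_root z.
Proof.
move=> NK; have N0 : (0 < N)%N by rewrite lt0n; apply: contraNneq NK => ->.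
have [rs [rsU rsN rsE]] := unity_roots_closed NK.
have /hasP[z _ zp] : has N.-primitive_root rs.
  apply: has_prim_root => //; last by rewrite rsN.
  by apply/allP => x; rewrite rsE unity_rootE.
by exists z.
Qed.

Lemma prim_root_neq0 (R : nzRingType) n (z : R) : (0 < n)%N ->
  n.-primitive_root z -> z != 0.
Proof.
move=> n0 zp; apply/eqP => z0; have := prim_expr_order zp.
by rewrite z0 expr0n gtn_eqF // => /eqP; rewrite eq_sym oner_eq0.
Qed.

Lemma pnat_pchar_card (k : finFieldType) (K : fieldType) (iota : {rmorphism k -> K}) :
  [pchar K].-nat #|k|.
Proof.
have [p pp pc] := finPcharP k; have pK := rmorph_pchar iota pc.
rewrite (eq_pnat _ (pcharf_eq pK)) -cardsT.
exact: (pprimeChar_pgroup pc).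
Qed.

(** The argument [iota] ties K to k: it forces the characteristic of K, which makes this power map
    additive and allows the ring morphism structure below. *)
Definition frob (k : finFieldType) (K : fieldType) (iota : {rmorphism k -> K})
  (x : K) : K := x ^+ #|k|.

Section FrobMorphism.
Variables (k : finFieldType) (K : fieldType) (iota : {rmorphism k -> K}).

Fact frob_is_zmod_morphism : zmod_morphism (frob iota).
Proof.
move=> x y; have h := pnat_pchar_card iota.
by rewrite /frob exprDn_pchar // exprNn_pchar.
Qed.

Fact frob_is_monoid_morphism : monoid_morphism (frob iota).
Proof. by split=> [|x y]; rewrite /frob ?expr1n ?exprMn. Qed.

HB.instance Definition _ :=
  GRing.isZmodMorphism.Build K K (frob iota) frob_is_zmod_morphism.
HB.instance Definition _ :=
  GRing.isMonoidMorphism.Build K K (frob iota) frob_is_monoid_morphism.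

End FrobMorphism.

Section FrobeniusField.

Variables (k : finFieldType) (K : closedFieldType) (iota : {rmorphism k -> K}).
Local Notation Q := #|k|.
Local Notation Fr := (frob iota).

Lemma card_field_gt1 : (1 < Q)%N. Proof. exact: finNzRing_gt1. Qed.
Lemma card_field_gt0 : (0 < Q)%N. Proof. exact: ltnW card_field_gt1. Qed.

Lemma iter_frobE j x : iter j Fr x = x ^+ (Q ^ j).
Proof. by elim: j => [|j IH] //=; rewrite IH /frob expnSr exprM. Qed.

Lemma frob_iota a : Fr (iota a) = iota a.
Proof. by rewrite /frob -rmorphXn expf_card. Qed.

Lemma frob_fixed x : Fr x = x -> exists a, iota a = x.
Proof.
move=> xE; have := congr1 (fun p => (map_poly iota p).[x]) (finField_genPoly k).
rewrite rmorphB /= map_polyXn map_polyX !hornerE -[x ^+ _]/(Fr x) xE subrr.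
rewrite rmorph_prod horner_prod => /esym/eqP/prodf_eq0[a _].
rewrite rmorphB /= map_polyX map_polyC !hornerE subr_eq0 => /eqP ->.
by exists a.
Qed.

Lemma frob_inj : injective Fr. Proof. exact: fmorph_inj. Qed.

Lemma iter_frob_inj j : injective (iter j Fr).
Proof. by elim: j => [|j IH] //= x y /frob_inj/IH. Qed.

Lemma card_field_eq0 : Q%:R = 0 :> K.
Proof.
have [p pp pc] := finPcharP k; have pK := rmorph_pchar iota pc.
have := pprimeChar_pgroup pc; rewrite /pgroup cardsT => /p_natP[[|n] e].
  by have := card_field_gt1; rewrite e.
by rewrite e expnS natrM (pcharf0 pK) mul0r.
Qed.

Lemma qint_neq0 n : (0 < n)%N -> (\sum_(i < n) Q ^ i)%N%:R != 0 :> K.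
Proof.
case: n => // n _; rewrite big_ord_recl expn0 natrD natr_sum big1 ?addr0 ?oner_eq0 //.
by move=> i _; rewrite lift0 expnS natrM card_field_eq0 mul0r.
Qed.

Lemma frob_period_exp m x : (0 < m)%N -> x != 0 ->
  (iter m Fr x == x) = (x ^+ (Q ^ m).-1 == 1).
Proof.
move=> m0 x0; rewrite iter_frobE -[in LHS](prednK (n := Q ^ m)) ?expn_gt0 ?card_field_gt0 //.
by rewrite exprS -[X in _ == X]mulr1 (inj_eq (mulfI x0)).
Qed.

Lemma iter_frob_mul a b x : iter a Fr x = x -> iter (a * b) Fr x = x.
Proof. by move=> h; elim: b => [|b IH]; rewrite ?muln0 // mulnS iterD IH. Qed.

Lemma card_ext_pred_gt0 m : (0 < m)%N -> (0 < (Q ^ m).-1)%N.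
Proof.
move=> m0; rewrite -ltnS prednK ?expn_gt0 ?card_field_gt0 //.
by rewrite -{1}(expn0 Q) ltn_exp2l // card_field_gt1.
Qed.

Lemma card_ext_pred_neq0 m : (0 < m)%N -> ((Q ^ m).-1)%:R != 0 :> K.
Proof.
move=> m0; rewrite predn_exp natrM mulf_neq0 // ?qint_neq0 //.
have : (Q.-1)%:R + 1 = 0 :> K by rewrite natr1 prednK ?card_field_gt0 ?card_field_eq0.
by move/eqP; rewrite addr_eq0 => /eqP ->; rewrite oppr_eq0 oner_eq0.
Qed.

Hypothesis K_alg : integralRange iota.

(** Pigeonhole: the i-th iterate of x is the value at x of the remainder of X^(Q^i) modulo a monic p
    over k with root x, and there are finitely many remainders. Injectivity of the Frobenius turns a
    coincidence of iterates into a period. *)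
Lemma frob_periodic x : exists2 m, (0 < m)%N & iter m Fr x = x.
Proof.
have [p p_monic px] := K_alg x; set d := size p.
pose f (i : 'I_#|{ffun 'I_d -> k}|.+1) : {ffun 'I_d -> k} :=
  [ffun j : 'I_d => (('X^(Q ^ i) : {poly k}) %% p)`_j].
have valE i : iter i Fr x = (map_poly iota ('X^(Q ^ i) %% p)).[x].
  rewrite iter_frobE -[LHS]hornerXn -(map_polyXn iota) /=.
  rewrite {1}(divp_eq ('X^(Q ^ i)) p) rmorphD rmorphM hornerD hornerM /=.
  by rewrite (rootP px) mulr0 add0r.
have /injectivePn[i [j ne fij]] : ~~ injectiveb f.
  apply/negP => /injectiveP/leq_card; rewrite card_ord; by rewrite ltnn.
have p0 : p != 0 by exact: monic_neq0.
have eij : iter i Fr x = iter j Fr x.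
  rewrite !valE; congr (_.[x]); congr map_poly; apply/polyP => l.
  have [ld|dl] := ltnP l d.
    by have := congr1 (fun g : {ffun _} => g (Ordinal ld)) fij; rewrite !ffunE.
  by rewrite !nth_default // (leq_trans _ dl) // ltnW // ltn_modp.
wlog lt : i j {ne fij} eij ne / (i < j)%N.
  move=> h; case: (ltngtP i j) => [lt|lt|e]; first exact: (h i j).
    by apply: (h j i) => //; rewrite eq_sym.
  by case/eqP: ne; apply: val_inj.
exists (j - i)%N; first by rewrite subn_gt0.
by apply: (iter_frob_inj (j := i)); rewrite -iterD subnKC ?(ltnW lt).
Qed.

Lemma common_period (s : seq K) :
  exists2 m, (0 < m)%N & {in s, forall x, iter m Fr x = x}.
Proof.
elim: s => [|x s [m m0 IH]]; first by exists 1%N.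
have [m' m'0 xE] := frob_periodic x.
exists (m' * m)%N; first by rewrite muln_gt0 m'0.
move=> y; rewrite inE => /orP[/eqP ->|/IH ys]; first exact: iter_frob_mul.
by rewrite mulnC iter_frob_mul.
Qed.

(** Finitely many nonzero elements lie in one finite field, whose multiplicative group is cyclic.
    This puts a given point of a torus on a one-parameter subgroup. *)
Lemma common_prim_root n (x : 'I_n -> K) : (forall i, x i != 0) ->
  exists N (z : K) (a : 'I_n -> nat),
    [/\ (0 < N)%N, N.-primitive_root z & forall i, x i = z ^+ a i].
Proof.
move=> x0; have [m m0 mP] := common_period (codom x).
have [z zp] := exists_prim_root (card_ext_pred_neq0 m0).
have ex i : exists a : nat, x i = z ^+ a.
  have /eqP := mP (x i) (codom_f x i); rewrite frob_period_exp // => /eqP h.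
  by have [a ->] := prim_rootP zp h; exists a.
by have [a aP] := choice ex; exists (Q ^ m).-1, z, a; rewrite card_ext_pred_gt0.
Qed.

(** The degree of x over k, encoded as the exact period of x under the Frobenius. *)
Definition is_degree (x : K) (d : nat) : Prop :=
  (0 < d)%N /\ forall i, (iter i Fr x == x) = (d %| i)%N.

Definition frob_degree (x : K) : nat := xget 0%N [set d | is_degree x d]%classic.

Lemma is_degree_exists x : exists d, is_degree x d.
Proof.
have [m m0 mP] := frob_periodic x.
have ex : exists m, (0 < m)%N && (iter m Fr x == x) by exists m; rewrite m0 mP eqxx.
case: (ex_minnP ex) => d /andP[d0 /eqP dx] dmin.
exists d; split=> // i; apply/idP/idP => [ix|/dvdnP[c ->]]; last first.
  by rewrite mulnC iter_frob_mul.
rewrite /dvdn; apply/negPn/negP => md; have := ltn_pmod i d0.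
rewrite ltnNge => /negP; apply; apply: dmin; rewrite lt0n md /=.
have h : iter (i %/ d * d) Fr x = x by rewrite mulnC iter_frob_mul.
by move: ix; rewrite {1}(divn_eq i d) addnC iterD h.
Qed.

Lemma frob_degreeP x : is_degree x (frob_degree x).
Proof. by have [d dP] := is_degree_exists x; apply: (xgetPex 0%N); exists d. Qed.

Lemma is_degree_unique x d : is_degree x d -> frob_degree x = d.
Proof.
move=> [d0 dP]; have [e0 eP] := frob_degreeP x.
apply/eqP; rewrite eqn_dvd; apply/andP; split.
  by rewrite -eP dP.
by rewrite -dP eP.
Qed.

Lemma iter_frob_mod x d i : is_degree x d -> iter i Fr x = iter (i %% d) Fr x.
Proof.
move=> [d0 dP]; rewrite {1}(divn_eq i d) addnC iterD.
by congr (iter _ _ _); apply/eqP; rewrite dP dvdn_mull.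
Qed.

Lemma iter_frob_eq x d i j : is_degree x d ->
  (iter i Fr x == iter j Fr x) = (i == j %[mod d]).
Proof.
move=> dx; wlog lij : i j / (i <= j)%N.
  by move=> h; have [/h //|/ltnW/h] := leqP i j; rewrite eq_sym => ->; rewrite eq_sym.
rewrite -{1}(subnKC lij) iterD (inj_eq (iter_frob_inj (j := i))) eq_sym.
by rewrite (proj2 dx) eq_sym eqn_mod_dvd.
Qed.

(* Elements of [F_(Q^n)] of norm 1 over [k]. *)
Definition norm_one (n : nat) (x : K) : bool := x ^+ (\sum_(i < n) Q ^ i) == 1.

Lemma norm_one_neq0 n x : (0 < n)%N -> norm_one n x -> x != 0.
Proof.
move=> n0; rewrite /norm_one; apply: contraTneq => ->.
rewrite expr0n -(prednK n0) big_ord_recl expn0 add1n /=.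
by rewrite eq_sym oner_eq0.
Qed.

Lemma norm_one_period n x : (0 < n)%N -> norm_one n x -> iter n Fr x = x.
Proof.
move=> n0 nx; apply/eqP; rewrite frob_period_exp ?(norm_one_neq0 n0) //.
by rewrite predn_exp mulnC exprM (eqP nx) expr1n.
Qed.

Lemma qint_mul e c : (\sum_(i < e * c) Q ^ i = (\sum_(i < e) Q ^ i) * \sum_(j < c) Q ^ (e * j))%N.
Proof.
elim: c => [|c IH]; first by rewrite muln0 !big_ord0 muln0.
rewrite mulnS addnC big_split_ord /= IH big_ord_recr /= mulnDr; congr (_ + _)%N.
by rewrite big_distrl; apply: eq_bigr => i _; rewrite expnD mulnC.
Qed.

Lemma expr_frob_fixed_sum (y : K) e c : Fr y = y ->
  y ^+ (\sum_(j < c) Q ^ (e * j)) = y ^+ c.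
Proof.
move=> yE; have yi j : y ^+ (Q ^ j) = y.
  by rewrite -iter_frobE; elim: j => //= j ->.
elim: c => [|c IH]; first by rewrite big_ord0.
by rewrite big_ord_recr exprD IH yi exprSr.
Qed.

(** If x is fixed by Fr^e, then y = x^(1 + Q + ... + Q^(e-1)) lies in k and the condition for n
    reads y^(n/e) = 1. Together with y^(Q-1) = 1 and coprimality this gives y = 1. *)
Lemma norm_one_sub n e x : (0 < n)%N -> (e %| n)%N -> coprime n Q.-1 ->
  (norm_one n x && (iter e Fr x == x)) = norm_one e x.
Proof.
move=> n0 /dvdnP[c nE] cop; rewrite nE mulnC.
have e0 : (0 < e)%N by move: n0; rewrite nE muln_gt0 => /andP[].
apply/idP/idP => [/andP[nx /eqP xe]|ex].
  have x0 : x != 0 by apply: norm_one_neq0 nx; rewrite -mulnC -nE.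
  set y := x ^+ (\sum_(i < e) Q ^ i).
  have yQ : y ^+ Q.-1 = 1.
    by rewrite -exprM mulnC -predn_exp; apply/eqP; rewrite -frob_period_exp // xe.
  have yF : Fr y = y by rewrite /frob -(prednK card_field_gt0) exprS yQ mulr1.
  have yc : y ^+ c = 1.
    by rewrite -(expr_frob_fixed_sum e c yF) -exprM -qint_mul; apply/eqP.
  have c0 : (0 < c)%N by move: n0; rewrite nE muln_gt0 => /andP[].
  have := expr_gcdn_eq1 c0 yc yQ; rewrite /norm_one -/y.
  have /eqP -> : coprime c Q.-1.
    by apply: coprime_dvdl cop; rewrite nE dvdn_mulr.
  by rewrite expr1 => ->.
rewrite (norm_one_period e0 ex) eqxx andbT /norm_one qint_mul exprM.
by rewrite (eqP ex) expr1n.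
Qed.

Definition norm_one_seq (n : nat) : seq K :=
  xget [::] [set rs | [/\ uniq rs, size rs = (\sum_(i < n) Q ^ i)%N
    & forall x, (x \in rs) = norm_one n x]]%classic.

Lemma norm_one_seqP n : (0 < n)%N ->
  [/\ uniq (norm_one_seq n), size (norm_one_seq n) = (\sum_(i < n) Q ^ i)%N
    & forall x, (x \in norm_one_seq n) = norm_one n x].
Proof.
move=> n0; have [rs rsP] := unity_roots_closed (qint_neq0 n0).
rewrite /norm_one_seq; set A := [set rs | _]%classic.
by suff : A (xget [::] A) by []; apply: xgetPex; exists rs.
Qed.

Lemma degree_dvdn n x : (0 < n)%N -> norm_one n x -> (frob_degree x %| n)%N.
Proof.
by move=> n0 nx; rewrite -(proj2 (frob_degreeP x)) norm_one_period.
Qed.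

(** The degree of x divides e exactly when Fr^e fixes x, so [norm_one_sub] identifies the elements
    counted with the solutions of the condition for e. *)
Lemma count_degree_dvdn n e : (0 < n)%N -> (e %| n)%N -> coprime n Q.-1 ->
  (\sum_(d < e.+1 | d %| e) count (fun x => frob_degree x == d) (norm_one_seq n) =
   \sum_(i < e) Q ^ i)%N.
Proof.
move=> n0 en cop; have e0 : (0 < e)%N by apply: dvdn_gt0 en.
have [nU _ nE] := norm_one_seqP n0; have [eU eS eE] := norm_one_seqP e0.
rewrite -eS; transitivity (count (fun x => iter e Fr x == x) (norm_one_seq n)).
  rewrite -[RHS]sum1_count; under [LHS]eq_bigr do rewrite -sum1_count.
  rewrite (exchange_big_dep (fun x => iter e Fr x == x)) /=; last first.
    by move=> d x de /eqP dx; rewrite (proj2 (frob_degreeP x)) dx.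
  apply: eq_bigr => x xe; have [d0 dP] := frob_degreeP x.
  have de : (frob_degree x %| e)%N by rewrite -dP.
  have lt : (frob_degree x < e.+1)%N by rewrite ltnS dvdn_leq.
  rewrite (big_pred1 (Ordinal lt)) // => d; rewrite /= -val_eqE /= eq_sym.
  by case: eqP => [->|]; rewrite ?de ?andbF.
rewrite -size_filter; apply: perm_size; apply: uniq_perm => //; first exact: filter_uniq.
by move=> x; rewrite mem_filter nE eE andbC norm_one_sub.
Qed.

(** The values z_d(Q) and the numbers of norm-one elements of degree d satisfy the same recursion
    over the divisors of n, so they coincide. *)
Lemma sum_norm_one (C : fieldType) n (z : nat -> {poly int}) (g : nat -> C) :
  (0 < n)%N -> coprime n Q.-1 ->
  (forall e, (0 < e)%N -> \sum_(d < e.+1 | (d %| e)%N) z d = \sum_(i < e) 'X^i) ->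
  \sum_(x <- norm_one_seq n) g (frob_degree x) =
  \sum_(d < n.+1 | (d %| n)%N) (map_poly intr (z d)).[Q%:R] * g d.
Proof.
move=> n0 cop zE; have [nU _ nE] := norm_one_seqP n0.
pose cnt d := count (fun x => frob_degree x == d) (norm_one_seq n).
have cntE d : (d %| n)%N -> (map_poly intr (z d)).[Q%:R] = (cnt d)%:R :> C.
  elim/ltn_ind: d => d IH dn; have d0 : (0 < d)%N by apply: dvdn_gt0 dn.
  have := congr1 (fun a : nat => a%:R : C) (count_degree_dvdn n0 dn cop).
  have h1 : \sum_(i < d.+1 | (i %| d)%N) (map_poly intr (z i)).[Q%:R] =
      \sum_(i < d) Q%:R ^+ i :> C.
    rewrite -horner_sum -rmorph_sum /= zE // rmorph_sum horner_sum.
    by apply: eq_bigr => i _; rewrite /= map_polyXn hornerXn.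
  rewrite !natr_sum; under [X in _ = X -> _]eq_bigr do rewrite natrX.
  rewrite -h1 big_mkcond big_ord_recr -big_mkcond /= dvdnn.
  rewrite [X in _ = X -> _]big_mkcond big_ord_recr -big_mkcond /= dvdnn.
  rewrite [X in _ = X + _ -> _](eq_bigr (fun i : 'I_d => (cnt i)%:R)).
    by move/addrI/esym.
  by move=> i id; apply: IH => //; apply: dvdn_trans dn.
transitivity (\sum_(d < n.+1 | (d %| n)%N)
    \sum_(x <- norm_one_seq n | frob_degree x == d) g d).
  rewrite (exchange_big_dep predT) //= big_seq [RHS]big_seq; apply: eq_bigr => x.
  rewrite nE => nx; have dn := degree_dvdn n0 nx.
  have lt : (frob_degree x < n.+1)%N by rewrite ltnS dvdn_leq.
  rewrite (big_pred1 (Ordinal lt)) // => d; rewrite /= -val_eqE /= eq_sym.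
  by case: eqP => [->|]; rewrite ?dn ?andbF.
by apply: eq_bigr => d dn; rewrite cntE // big_const_seq iter_addr_0 mulr_natl.
Qed.

End FrobeniusField.

(** * Invariants of a product of symmetric groups on a norm-one torus *)

Lemma mpoly_rmorph_ext (n : nat) (R : comNzRingType) (S : comNzRingType)
    (f g : {rmorphism {mpoly R[n]} -> S}) :
  (forall c, f c%:MP = g c%:MP) -> (forall i, f 'X_i = g 'X_i) -> f =1 g.
Proof.
move=> eqC eqX F; rewrite (mpolyE F) !rmorph_sum; apply: eq_bigr => m _.
rewrite -mul_mpolyC !rmorphM eqC; congr (_ * _).
by rewrite mpolyXE_id !rmorph_prod; apply: eq_bigr => i _; rewrite !rmorphXn eqX.
Qed.

Lemma mpolyX_homog (n : nat) (R : nzRingType) (i : 'I_n) :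
  ('X_i : {mpoly R[n]}) \is 1.-homog.
Proof. by rewrite dhomogX; apply/eqP; exact: mdeg1. Qed.

Lemma homog_coef0 n (R : nzRingType) d (F : {mpoly R[n]}) : (0 < d)%N ->
  F \is d.-homog -> F@_0%MM = 0.
Proof.
move=> d0 hF; have h : mdeg (0%MM : 'X_{1..n}) != d by rewrite mdeg0 eq_sym -lt0n.
exact: (dhomog_nemf_coeff hF h).
Qed.

Lemma comp_linear_homog (n r d : nat) (R : comNzRingType)
    (lq : n.-tuple {mpoly R[r]}) (F : {mpoly R[n]}) :
  (forall i, tnth lq i \is 1.-homog) -> F \is d.-homog -> F \mPo lq \is d.-homog.
Proof.
move=> lq1 /dhomogP homF; rewrite comp_mpolyEX big_seq rpred_sum // => m mF.
have -> : d = (\sum_i m i)%N by rewrite -(homF m mF); exact: mdegE.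
apply: dhomogZ; rewrite comp_mpolyX.
elim/big_rec2: _ => [|i p e _ IH]; first exact: dhomog1.
by apply: dhomogM => //; rewrite -[X in X.-homog]mul1n; apply: dhomogMn.
Qed.

Lemma comp_linear_coef0 (n r : nat) (R : comNzRingType)
    (lq : n.-tuple {mpoly R[r]}) (F : {mpoly R[n]}) :
  (forall i, tnth lq i \is 1.-homog) -> (F \mPo lq)@_0%MM = F@_0%MM.
Proof.
move=> lq1; apply: (@mpoly_rmorph_ext _ _ _ (mcoeff 0%MM \o comp_mpoly lq)
  (mcoeff 0%MM)) => [c|i] /=; first by rewrite comp_mpolyC !mpolyCK.
rewrite comp_mpolyXU -tnth_nth (homog_coef0 _ (lq1 i)) //.
by rewrite (homog_coef0 _ (mpolyX_homog R i)).
Qed.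

Lemma sum_scale_delta (R : pzRingType) (V : lmodType R) n (F : 'I_n -> V) (i : 'I_n) :
  \sum_j (j == i)%:R *: F j = F i.
Proof.
rewrite (bigD1 i) //= eqxx scale1r big1 ?addr0 // => j /negPf ->.
by rewrite scale0r.
Qed.

Lemma linear_form_homog (r : nat) (R : comNzRingType) (a : 'I_r -> R) :
  (\sum_(i < r) a i *: 'X_i : {mpoly R[r]}) \is 1.-homog.
Proof. by rewrite rpred_sum // => i _; apply/dhomogZ/mpolyX_homog. Qed.

Lemma poly_eq0_on_nonzero (p : {poly rat}) :
  (forall t, t != 0 -> p.[t] = 0) -> p = 0.
Proof.
move=> p0; apply/eqP/negPn/negP => pn0.
have := @max_poly_roots _ p [seq i.+1%:R | i <- iota 0 (size p)] pn0.
rewrite size_map size_iota ltnn => h; suff : false by [].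
apply: h.
  by apply/allP => x /mapP[i _ ->]; apply/rootP/p0; rewrite pnatr_eq0.
by rewrite map_inj_in_uniq ?iota_uniq // => i j _ _ /eqP; rewrite eqr_nat => /eqP[].
Qed.

(** det(1 - XB) is the reversed characteristic polynomial of B; the identity is tested at nonzero
    rationals. *)
Lemma det_one_sub_char_poly (s : nat) (B : 'M[rat]_s) (p P : {poly rat}) :
  char_poly B = p -> (forall t, t != 0 -> P.[t] = t ^+ s * p.[t^-1]) ->
  \det (1%:M - 'X *: map_mx polyC B) = P.
Proof.
move=> <- PE; apply/eqP; rewrite -subr_eq0; apply/eqP/poly_eq0_on_nonzero => t t0.
rewrite hornerD hornerN PE // -[_.[t]]/(horner_eval t _) -det_map_mx.
rewrite -[_.[t^-1]]/(horner_eval t^-1 _) -det_map_mx.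
have -> : map_mx (horner_eval t) (1%:M - 'X *: map_mx polyC B) =
          t *: map_mx (horner_eval t^-1) (char_poly_mx B).
  apply/matrixP => i j; rewrite !mxE /horner_eval !hornerE /= mulrDr.
  by rewrite mulrN; congr (_ - _); case: (i == j); rewrite !hornerE ?mulfV ?mulr0.
by rewrite detZ subrr.
Qed.

Lemma primitive_root1 (R : nzRingType) : 1.-primitive_root (1 : R).
Proof.
rewrite /primitive_root_of_unity /=; apply/forallP => i.
by rewrite ord1 unity_rootE expr1 !eqxx.
Qed.

Lemma companion_shift (R : pzRingType) (V : lmodType R) m (F : nat -> V) (i : 'I_m) :
  i != m.-1 :> nat -> \sum_(j < m) (i.+1 == j)%:R *: F j = F i.+1.
Proof.
move=> ne; have lti : (i.+1 < m)%N.
  by move: (nat_of_ord i) (ltn_ord i) ne => a; case: m {F i} => // m; lia.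
rewrite -(sum_scale_delta (fun j : 'I_m => F j) (Ordinal lti)).
by apply: eq_bigr => j _; rewrite -val_eqE eq_sym.
Qed.

Section BlockInvariants.

Variables (K : closedFieldType) (N0 : nat) (H T : set 'M[K]_N0) (r : nat)
  (chi : 'I_r -> 'M[K]_N0 -> K).
Variables (N : nat) (L : eqType) (mu : 'I_N -> L).
Variables (u : 'M[int]_(r, N)) (v : 'M[int]_(N, r)) (c0 : 'I_N -> int).
Hypothesis uv : u *m v = 1%:M.
Hypothesis vsum : forall i, \sum_j v j i = 0.
(** On the torus x_1 ... x_N = 1 the exponents of a monomial are only defined up to a common
    constant: [c0 j] is the constant for the j-th coordinate. *)
Hypothesis vu : forall j l, (v *m u) j l = (j == l)%:R + c0 j.

Definition label_preserving (s : 'S_N) : bool := [forall j, mu (s j) == mu j].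

Definition perm_matrix_action (s : 'S_N) : 'M[int]_r := u *m perm_mx s *m v.

(** The torus and its normalizer enter the section only through this equivalence; what remains is
    the combinatorics of polynomials under permutations. *)
Hypothesis weylE : forall f, weyl_invariants H T chi f <->
  forall s, label_preserving s -> sym_act (perm_matrix_action s) f = f.

Local Notation pos := (positive_ideal H T chi).
Local Notation sq := (positive_ideal_square H T chi).
Local Notation W := [set s | label_preserving s]%SET.

Lemma label_preservingP (s : 'S_N) : reflect (forall j, mu (s j) = mu j) (label_preserving s).
Proof. by apply: (iffP forallP) => h j; apply/eqP. Qed.

(* [u] gives the characters [chi i] of the torus [x_1 ... x_N = 1] as monomials in
   the coordinates, and [v] the coordinates as monomials in the characters: [psi]
   is the restriction of polynomials to the Lie algebra [x_1 + ... + x_N = 0]. *)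
Definition psi (F : {mpoly rat[N]}) : {mpoly rat[r]} :=
  F \mPo [tuple \sum_(i < r) (v j i)%:~R *: 'X_i | j < N].
HB.instance Definition _ := GRing.RMorphism.copy psi
  (comp_mpoly [tuple \sum_(i < r) (v j i)%:~R *: 'X_i | j < N]).

Definition phi (f : {mpoly rat[r]}) : {mpoly rat[N]} :=
  f \mPo [tuple \sum_(j < N) (u i j)%:~R *: 'X_j | i < r].

Lemma psiX j : psi 'X_j = \sum_(i < r) (v j i)%:~R *: 'X_i.
Proof. by rewrite /psi comp_mpolyXU -tnth_nth tnth_mktuple. Qed.

Lemma psiZ a F : psi (a *: F) = a *: psi F.
Proof. exact: comp_mpolyZ. Qed.

Lemma psi_sum (I : Type) (s : seq I) (P : pred I) (F : I -> {mpoly rat[N]}) :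
  psi (\sum_(i <- s | P i) F i) = \sum_(i <- s | P i) psi (F i).
Proof. exact: raddf_sum. Qed.

Lemma sym_actX M i : sym_act M 'X_i = \sum_(j < r) (M i j)%:~R *: 'X_j.
Proof. by rewrite /sym_act comp_mpolyXU -tnth_nth tnth_mktuple. Qed.

Lemma sym_actZ M a f : @sym_act r M (a *: f) = a *: sym_act M f.
Proof. exact: comp_mpolyZ. Qed.

Lemma lin_comb_mul (n1 n2 n3 : nat) (A : 'M[int]_(n1, n2)) (B : 'M[int]_(n2, n3))
    (x : 'I_n3 -> {mpoly rat[r]}) i :
  \sum_l (A i l)%:~R *: (\sum_j (B l j)%:~R *: x j) =
  \sum_j ((A *m B) i j)%:~R *: x j.
Proof.
under eq_bigr do rewrite scaler_sumr.
rewrite exchange_big; apply: eq_bigr => j _; rewrite mxE rmorph_sum scaler_suml.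
by apply: eq_bigr => l _; rewrite scalerA rmorphM.
Qed.

Lemma v_perm_action s j i : (v *m perm_matrix_action s) j i = v (s j) i.
Proof.
have vs l : (perm_mx s *m v) l i = v (s l) i by rewrite -row_permE mxE.
rewrite /perm_matrix_action -mulmxA mulmxA mxE.
under eq_bigr do rewrite vu vs mulrDl.
rewrite big_split /= -mulr_sumr (bigD1 j) //= eqxx mul1r big1 ?addr0; last first.
  by move=> l /negPf; rewrite eq_sym => ->; rewrite mul0r.
have -> : \sum_l v (s l) i = 0 by rewrite -[RHS](vsum i) [RHS](reindex_inj (@perm_inj _ s)).
by rewrite mulr0 addr0.
Qed.

Lemma sym_act_psi s F : sym_act (perm_matrix_action s) (psi F) = psi (msym s F).
Proof.
apply: (@mpoly_rmorph_ext _ _ _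
  (comp_mpoly [tuple \sum_(j < r) (perm_matrix_action s i j)%:~R *: 'X_j | i < r] \o psi)
  (psi \o msym s)) => [c|j] /=.
  by rewrite /psi /msym comp_mpolyC mmapC !comp_mpolyC.
have -> : msym s 'X_j = 'X_(s j) :> {mpoly rat[N]}.
  by rewrite /msym mmapX mmap1U.
rewrite !psiX raddf_sum /=.
under eq_bigr => i _ do rewrite comp_mpolyZ -/(sym_act _ _) sym_actX.
by rewrite lin_comb_mul; apply: eq_bigr => i _; rewrite v_perm_action.
Qed.

Lemma phiK f : psi (phi f) = f.
Proof.
apply: (@mpoly_rmorph_ext _ _ _
  (psi \o comp_mpoly [tuple \sum_(j < N) (u i j)%:~R *: 'X_j | i < r]) idfun)
  => [c|i] /=; first by rewrite /psi !comp_mpolyC.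
rewrite comp_mpolyXU -tnth_nth tnth_mktuple raddf_sum /=.
under eq_bigr => j _ do rewrite psiZ psiX.
rewrite lin_comb_mul uv (bigD1 i) //= mxE eqxx scale1r big1 ?addr0 // => j.
by rewrite mxE eq_sym => /negPf ->; rewrite scale0r.
Qed.

Lemma psi_homog d F : F \is d.-homog -> psi F \is d.-homog.
Proof.
by apply: comp_linear_homog => i; rewrite tnth_mktuple linear_form_homog.
Qed.

Lemma phi_homog d f : f \is d.-homog -> phi f \is d.-homog.
Proof.
by apply: comp_linear_homog => i; rewrite tnth_mktuple linear_form_homog.
Qed.

Lemma psi_coef0 F : (psi F)@_0%MM = F@_0%MM.
Proof.
by apply: comp_linear_coef0 => i; rewrite tnth_mktuple linear_form_homog.
Qed.

Lemma sym_act_coef0 M f : (@sym_act r M f)@_0%MM = f@_0%MM.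
Proof.
by apply: comp_linear_coef0 => i; rewrite tnth_mktuple linear_form_homog.
Qed.

Lemma pos_psi F : (forall s, label_preserving s -> msym s F = F) ->
  F@_0%MM = 0 -> pos (psi F).
Proof.
move=> invF F0; split; last by rewrite psi_coef0.
by apply/weylE => s sW; rewrite sym_act_psi invF.
Qed.

Definition orbit_sum (F : {mpoly rat[N]}) := \sum_(s in W) msym s F.

Lemma orbit_sumB F G : orbit_sum (F - G) = orbit_sum F - orbit_sum G.
Proof. by rewrite /orbit_sum -sumrB; apply: eq_bigr => s _; rewrite raddfB. Qed.

HB.instance Definition _ := GRing.isZmodMorphism.Build _ _ orbit_sum orbit_sumB.

Lemma orbit_sum_sum (I : Type) (s : seq I) (P : pred I) (F : I -> {mpoly rat[N]}) :
  orbit_sum (\sum_(i <- s | P i) F i) = \sum_(i <- s | P i) orbit_sum (F i).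
Proof. exact: raddf_sum. Qed.

Lemma orbit_sumZ a F : orbit_sum (a *: F) = a *: orbit_sum F.
Proof. by rewrite /orbit_sum scaler_sumr; apply: eq_bigr => s _; rewrite msymZ. Qed.

Lemma label_preservingM s t : label_preserving t ->
  label_preserving (s * t)%g = label_preserving s.
Proof.
move=> /label_preservingP tW; apply/label_preservingP/label_preservingP => h j.
  by rewrite -(h j) permM tW.
by rewrite permM tW.
Qed.

Lemma label_preserving_conj (sg s : 'S_N) :
  (forall i j, mu (sg i) = mu (sg j) -> mu i = mu j) ->
  label_preserving s -> label_preserving (sg * s * sg^-1)%g.
Proof.
move=> sgmu /label_preservingP sW; apply/label_preservingP => j.
by apply: sgmu; rewrite !permM permKV sW.
Qed.

Lemma label_preservingV s : label_preserving s -> label_preserving s^-1%g.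
Proof.
by move=> /label_preservingP sW; apply/label_preservingP => j; rewrite -sW permKV.
Qed.

Lemma label_preserving1 : label_preserving 1%g.
Proof. by apply/label_preservingP => j; rewrite perm1. Qed.

Lemma msym_orbit_sum s F : label_preserving s ->
  msym s (orbit_sum F) = orbit_sum F.
Proof.
move=> sW; rewrite /orbit_sum raddf_sum.
rewrite [RHS](reindex_inj (mulIg s)) /=.
apply: eq_big => [t|t _]; first by rewrite !inE label_preservingM.
by rewrite msymMm.
Qed.

Lemma orbit_sum_msym s F : label_preserving s ->
  orbit_sum (msym s F) = orbit_sum F.
Proof.
move=> sW; rewrite /orbit_sum [RHS](reindex_inj (mulgI s)) /=.
apply: eq_big => [t|t _]; last by rewrite msymMm.
rewrite !inE; apply/idP/idP => tW; first by rewrite label_preservingM.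
by rewrite -(mulKg s t) label_preservingM // label_preservingV.
Qed.

Lemma orbit_sum_inv F : (forall s, label_preserving s -> msym s F = F) ->
  orbit_sum F = F *+ #|W|.
Proof.
move=> invF; rewrite -sumr_const; apply: eq_bigr => s; rewrite inE; exact: invF.
Qed.

Lemma orbit_sumM F G : (forall s, label_preserving s -> msym s F = F) ->
  orbit_sum (F * G) = F * orbit_sum G.
Proof.
move=> invF; rewrite /orbit_sum mulr_sumr; apply: eq_bigr => s; rewrite inE => sW.
by rewrite msymM invF.
Qed.

Lemma W_gt0 : (0 < #|W|)%N.
Proof. by apply/card_gt0P; exists 1%g; rewrite inE label_preserving1. Qed.

(** The number of label-preserving permutations is invertible in the rationals, so summing over them
    lifts an invariant on the hyperplane to an invariant polynomial in N variables. *)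
Lemma psi_orbit_sum_phi f : weyl_invariants H T chi f ->
  psi (orbit_sum (phi f)) = f *+ #|W|.
Proof.
move=> /weylE fW; rewrite /orbit_sum raddf_sum -sumr_const /=.
by apply: eq_bigr => s; rewrite inE => sW; rewrite -sym_act_psi phiK fW.
Qed.

Lemma sq0 : sq 0.
Proof. by exists 0%N, (fun=> 0), (fun=> 0); split=> [[]//|]; rewrite big_ord0. Qed.

Lemma sqM g h : pos g -> pos h -> sq (g * h).
Proof.
by move=> pg ph; exists 1%N, (fun=> g), (fun=> h); split => //; rewrite big_ord1.
Qed.

Lemma sqD f g : sq f -> sq g -> sq (f + g).
Proof.
move=> [s1 [g1 [h1 [p1 ->]]]] [s2 [g2 [h2 [p2 ->]]]].
exists (s1 + s2)%N, (fun i => match split i with inl a => g1 a | inr b => g2 b end),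
  (fun i => match split i with inl a => h1 a | inr b => h2 b end); split.
  by move=> i; case: (split i).
rewrite big_split_ord; congr (_ + _); apply: eq_bigr => i _.
  by rewrite (unsplitK (inl i)).
by rewrite (unsplitK (inr i)).
Qed.

Lemma posZ a f : pos f -> pos (a *: f).
Proof.
move=> [/weylE fW f0]; split; last by rewrite mcoeffZ f0 mulr0.
by apply/weylE => s sW; rewrite sym_actZ fW.
Qed.

Lemma sqZ a f : sq f -> sq (a *: f).
Proof.
move=> [s [g [h [p ->]]]]; exists s, (fun i => a *: g i), h; split.
  by move=> i; have [pg ph] := p i; split=> //; apply: posZ.
by rewrite scaler_sumr; apply: eq_bigr => i _; rewrite scalerAl.
Qed.

Lemma sqN f : sq f -> sq (- f).
Proof. by rewrite -scaleN1r; apply: sqZ. Qed.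

Lemma sqB f g : sq f -> sq g -> sq (f - g).
Proof. by move=> hf hg; apply: sqD => //; apply: sqN. Qed.

Lemma sq_sum (I : Type) (s : seq I) (P : pred I) F :
  (forall i, P i -> sq (F i)) -> sq (\sum_(i <- s | P i) F i).
Proof. by move=> h; elim/big_ind: _ => //; [exact: sq0 | exact: sqD]. Qed.

(** * Power sums of the blocks span the invariants modulo decomposables *)

Definition power_sum d j : {mpoly rat[N]} := \sum_(i | mu i == mu j) 'X_i ^+ d.

Lemma power_sum_eq d i j : mu i = mu j -> power_sum d i = power_sum d j.
Proof. by move=> e; rewrite /power_sum e. Qed.

Lemma msym_power_sum (sg : 'S_N) d j :
  (forall i j, mu (sg i) = mu (sg j) <-> mu i = mu j) ->
  msym sg (power_sum d j) = power_sum d (sg j).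
Proof.
move=> sgmu; rewrite /power_sum raddf_sum [RHS](reindex_inj (@perm_inj _ sg)) /=.
apply: eq_big => [i|i _]; first by apply/eqP/eqP => /sgmu.
by rewrite rmorphXn /= /msym mmapX mmap1U.
Qed.

Lemma msym_power_sum_inv s d j : label_preserving s ->
  msym s (power_sum d j) = power_sum d j.
Proof.
move=> /label_preservingP sW.
by rewrite msym_power_sum => [|a b]; rewrite ?(power_sum_eq _ (sW j)) ?sW.
Qed.

Lemma power_sum_homog d j : power_sum d j \is d.-homog.
Proof.
rewrite rpred_sum // => i _.
by have := dhomogMn d (mpolyX_homog rat i); rewrite mul1n.
Qed.

Lemma pos_power_sum d j : (0 < d)%N -> pos (psi (power_sum d j)).
Proof.
move=> d0; apply: pos_psi; first by move=> s sW; rewrite msym_power_sum_inv.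
exact: homog_coef0 d0 (power_sum_homog d j).
Qed.

Definition in_span d f :=
  exists c : 'I_N -> rat, sq (f - \sum_j c j *: psi (power_sum d j)).

Lemma in_spanD d f g : in_span d f -> in_span d g -> in_span d (f + g).
Proof.
move=> [c hc] [c' hc']; exists (fun j => c j + c' j).
under eq_bigr do rewrite scalerDl.
by rewrite big_split opprD addrACA; apply: sqD.
Qed.

Lemma in_spanZ d a f : in_span d f -> in_span d (a *: f).
Proof.
move=> [c hc]; exists (fun j => a * c j).
under eq_bigr do rewrite -scalerA.
by rewrite -scaler_sumr -scalerBr; apply: sqZ.
Qed.

Lemma in_span_sq d f : sq f -> in_span d f.
Proof. by move=> h; exists (fun=> 0); rewrite big1 ?subr0 // => j _; rewrite scale0r. Qed.

Lemma in_span_power_sum d j : in_span d (psi (power_sum d j)).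
Proof.
by exists (fun i => (i == j)%:R); rewrite sum_scale_delta subrr; apply: sq0.
Qed.

Lemma in_span_sum d (I : Type) (s : seq I) (P : pred I) F :
  (forall i, P i -> in_span d (F i)) -> in_span d (\sum_(i <- s | P i) F i).
Proof.
by move=> h; elim/big_ind: _ => //; [apply/in_span_sq/sq0 | exact: in_spanD].
Qed.

(* Multiplying an orbit sum by a power sum of its block produces the orbit sums
   with one more variable, up to orbit sums with the same variables. *)
Lemma in_span_orbit_sum (w : nat) (m : 'X_{1..N}) :
  (#|[set i | m i != 0]%SET| <= w)%N -> (0 < mdeg m)%N ->
  in_span (mdeg m) (psi (orbit_sum 'X_[m])).
Proof.
elim: w m => [|w IH] m.
  rewrite leqn0 cards_eq0 => /eqP m0; rewrite mdegE big1 // => i _.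
  by move/finset.setP/(_ i): m0; rewrite !inE => /negbFE/eqP.
move=> sz dm.
have [i mi] : exists i, m i != 0%N.
  apply/existsP; rewrite -negb_forall; apply: contraL dm => /forallP m0.
  by rewrite -leqNgt mdegE big1 // => i _; apply/eqP.
(* [m'] erases the variable i from m, and [g j] puts its exponent on the variable j instead, so
   [g i] is m. *)
pose m' : 'X_{1..N} := [multinom if j == i then 0%N else m j | j < N].
pose g (j : 'I_N) : 'X_{1..N} := (U_(j) *+ m i + m')%MM.
have m'E l : m' l = if l == i then 0%N else m l by rewrite mnmE.
have gE j l : g j l = ((j == l) * m i + m' l)%N by rewrite mnmDE mulmnE mnm1E.
have gi : g i = m.
  apply/mnmP => l; rewrite gE m'E eq_sym; case: eqVneq => [->|_].
    by rewrite mul1n addn0.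
  by rewrite mul0n.
have dg j : mdeg (g j) = mdeg m.
  by rewrite -gi /g !mdegD !mdegMn !mdeg1.
have XE j : 'X_[g j] = 'X_j ^+ m i * 'X_[m'] :> {mpoly rat[N]}.
  by rewrite /g mpolyXD mpolyXn.
have main : psi (power_sum (m i) i) * psi (orbit_sum 'X_[m']) =
    \sum_(j | mu j == mu i) psi (orbit_sum 'X_[g j]).
  rewrite -rmorphM -orbit_sumM; last by move=> s; apply: msym_power_sum_inv.
  by rewrite mulr_suml orbit_sum_sum raddf_sum; apply: eq_bigr => j _; rewrite XE.
rewrite (bigID (fun j => m' j == 0%N)) /= in main.
(* If the variable j does not occur in [m'], the transposition of i and j exchanges m and [g j].
   These terms, j = i among them, are [cnt] copies of the same orbit sum. *)
have same j : mu j == mu i -> m' j == 0%N ->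
    psi (orbit_sum 'X_[g j]) = psi (orbit_sum 'X_[m]).
  move=> muj /eqP mj; congr psi.
  have tW : label_preserving (tperm i j).
    apply/label_preservingP => l; case: tpermP => [->|->|//]; first exact/eqP.
    exact/esym/eqP.
  rewrite -(orbit_sum_msym 'X_[m] tW) msymX; congr (orbit_sum 'X_[_]).
  have m'i : m' i = 0%N by rewrite m'E eqxx.
  apply/mnmP => l; rewrite tpermV mnmE -{1}gi !gE.
  case: tpermP => [->|->|/eqP li /eqP lj].
  - by rewrite mj m'i !addn0 (eq_sym i).
  - by rewrite mj m'i !eqxx.
  - by rewrite (eq_sym i) (eq_sym j) (negPf li) (negPf lj).
rewrite (eq_bigr (fun=> psi (orbit_sum 'X_[m]))) in main; last first.
  by move=> j /andP[]; apply: same.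
rewrite sumr_const in main.
set cnt := #|_| in main.
have cnt0 : (0 < cnt)%N.
  by apply/card_gt0P; exists i; rewrite unfold_in /= eqxx m'E eqxx.
have eqm : psi (orbit_sum 'X_[m]) = cnt%:R^-1 *: (psi (power_sum (m i) i) *
    psi (orbit_sum 'X_[m']) -
    \sum_(j | (mu j == mu i) && (m' j != 0%N)) psi (orbit_sum 'X_[g j])).
  rewrite main addrK -scaler_nat scalerA mulVf ?scale1r //.
  by rewrite pnatr_eq0 -lt0n.
rewrite eqm; apply: in_spanZ; apply: in_spanD; last first.
  (* In the other terms two variables have merged, so [g j] involves fewer variables than m. *)
  rewrite -scaleN1r; apply: in_spanZ; apply: in_span_sum => j /andP[muj mj].
  rewrite -(dg j); apply: IH; last by rewrite dg.
  rewrite -ltnS; apply: leq_trans sz; apply: proper_card; apply/properP; split.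
    apply/fintype.subsetP => l; rewrite !inE gE m'E; case: (eqVneq l i) => [->//|li].
    case: (eqVneq j l) => [<-|_]; last by rewrite mul0n.
    by move: mj; rewrite m'E; case: (j == i).
  exists i; rewrite !inE // gE m'E eqxx addn0.
  by move: mj; rewrite m'E; case: (eqVneq j i).
(* If m is a power of one variable, the product is a multiple of a power sum; otherwise both of its
   factors are invariants without constant term. *)
have [m'0|m'0] := eqVneq m' 0%MM.
  have d1 : mdeg m = m i by rewrite -(dg i) /g m'0 addm0 mdegMn mdeg1 mul1n.
  rewrite m'0 mpolyX0 orbit_sum_inv; last by move=> s _; rewrite msym1.
  rewrite raddfMn /= rmorph1 mulr_natr d1 -scaler_nat; apply: in_spanZ.
  exact: in_span_power_sum.
apply: in_span_sq; apply: sqM; first by apply: pos_power_sum; rewrite lt0n.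
apply: pos_psi; first by move=> s sW; rewrite msym_orbit_sum.
apply: (@homog_coef0 _ _ (mdeg m')); first by rewrite lt0n mdeg_eq0.
rewrite rpred_sum // => s _; rewrite msymX dhomogX; apply/eqP.
by exact: mdeg_mperm.
Qed.

Lemma in_span_homog d f : (0 < d)%N -> weyl_invariants H T chi f ->
  f \is d.-homog -> in_span d f.
Proof.
move=> d0 fW fd.
have -> : f = (#|W|)%:R^-1 *: psi (orbit_sum (phi f)).
  rewrite psi_orbit_sum_phi // -scaler_nat scalerA mulVf ?scale1r //.
  by rewrite pnatr_eq0 -lt0n W_gt0.
have -> : orbit_sum (phi f) =
    \sum_(m <- msupp (phi f)) (phi f)@_m *: orbit_sum 'X_[m].
  rewrite {1}(mpolyE (phi f)) orbit_sum_sum.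
  by apply: eq_bigr => m _; apply: orbit_sumZ.
apply: in_spanZ; rewrite raddf_sum big_seq /=.
apply: in_span_sum => m mphi; rewrite psiZ; apply: in_spanZ.
have dm : mdeg m = d by move/dhomogP: (phi_homog fd) => /(_ m mphi).
by rewrite -dm; apply: (in_span_orbit_sum (leqnn _)); rewrite dm.
Qed.

(* The variables of the block are the roots of [pol], of degree less than d. *)
Lemma sq_power_sum_small d j : (#|[set i | mu i == mu j]%SET| < d)%N ->
  sq (psi (power_sum d j)).
Proof.
set B := [set i | _]%SET; move=> ltad.
pose pol : {poly {mpoly rat[N]}} := \prod_(i in B) ('X - ('X_i)%:P).
have szp : size pol = #|B|.+1 by rewrite /pol -big_enum /= size_prod_XsubC -cardE.
have pol_lead : pol`_#|B| = 1.
  have := monic_prod_XsubC (enum B) predT (fun i => ('X_i : {mpoly rat[N]})).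
  by rewrite big_enum /= -/pol => /monicP; rewrite lead_coefE szp.
have pol_inv s i : label_preserving s -> msym s pol`_i = pol`_i.
  move=> sW; suff polE : map_poly (msym s) pol = pol by rewrite -{2}polE coef_map.
  rewrite /pol rmorph_prod [RHS](reindex_inj (@perm_inj _ s)) /=.
  apply: eq_big => [l|l _].
    by rewrite !inE; move/label_preservingP: sW => ->.
  by rewrite rmorphB /= map_polyX map_polyC /= /msym mmapX mmap1U.
have pol0 i : (i < #|B|)%N -> (pol`_i)@_0%MM = 0.
  move=> lti; rewrite -[LHS](coef_map (mcoeff 0%MM)) rmorph_prod /=.
  rewrite (eq_bigr (fun=> 'X)) => [|l _].
    by rewrite prodr_const coefXn (ltn_eqF lti).
  rewrite rmorphB /= map_polyX map_polyC /=.
  by rewrite (homog_coef0 _ (mpolyX_homog _ l)) // subr0.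
(* Newton's relation: the equation of X_i times X_i^(d - #|B|), summed over the block, writes the
   d-th power sum through products of a non-leading coefficient of [pol] and a power sum of smaller
   positive degree. Both factors are positive invariants. *)
have rt i : i \in B -> \sum_(l < #|B|.+1) pol`_l * 'X_i ^+ (l + (d - #|B|)) = 0.
  move=> iB; under eq_bigr do rewrite exprD mulrA.
  rewrite -mulr_suml -szp -horner_coef /pol (bigD1 i) //= hornerM hornerXsubC.
  by rewrite subrr !mul0r.
have : \sum_(i in B) \sum_(l < #|B|.+1)
   pol`_l * ('X_i ^+ (l + (d - #|B|)) : {mpoly rat[N]}) = 0.
  by apply: big1 => i; apply: rt.
rewrite exchange_big big_ord_recr /= pol_lead.
under [X in _ + X]eq_bigr => i _ do rewrite mul1r (subnKC (ltnW ltad)).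
have psE e : \sum_(i in B) ('X_i ^+ e : {mpoly rat[N]}) = power_sum e j.
  by apply: eq_bigl => i; rewrite inE.
rewrite psE => /eqP; rewrite addrC addr_eq0 => /eqP ->.
have -> (F : {mpoly rat[N]}) : psi (- F) = - psi F by exact: raddfN.
rewrite psi_sum; apply: sqN; apply: sq_sum => l _.
rewrite -mulr_sumr psE rmorphM; apply: sqM.
  by apply: pos_psi => [s|]; [exact: pol_inv | exact: pol0].
by apply: pos_power_sum; rewrite addn_gt0 subn_gt0 ltad orbT.
Qed.

(* On the line spanned by an eigenvector [w] of a label-preserving permutation, for
   a primitive d-th root of unity, the invariants only have components of degree
   divisible by d, and those of [sq] vanish in degree d: this detects independence
   modulo [sq]. *)
Section Evaluation.

Variables (w : 'I_N -> algC) (d : nat) (z : algC) (s : 'S_N).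
Hypothesis w_sum : \sum_j w j = 0.
Hypothesis z_prim : d.-primitive_root z.
Hypothesis sW : label_preserving s.
Hypothesis w_perm : forall j, w (s j) = z * w j.

Definition eval_at_w (f : {mpoly rat[r]}) : {poly algC} :=
  mmap (polyC \o ratr) (fun i => (\sum_j (u i j)%:~R * w j) *: 'X) f.

Lemma eval_at_wM f g : eval_at_w (f * g) = eval_at_w f * eval_at_w g.
Proof. by rewrite /eval_at_w rmorphM. Qed.

Lemma eval_at_w_sum (I : Type) (l : seq I) (P : pred I) F :
  eval_at_w (\sum_(i <- l | P i) F i) = \sum_(i <- l | P i) eval_at_w (F i).
Proof. by rewrite /eval_at_w raddf_sum. Qed.

Lemma eval_psi F :
  eval_at_w (psi F) = mmap (polyC \o ratr) (fun j => w j *: 'X) F.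
Proof.
apply: (@mpoly_rmorph_ext _ _ _ (mmap (polyC \o ratr)
  (fun i => (\sum_j (u i j)%:~R * w j) *: 'X) \o psi)
  (mmap (polyC \o ratr) (fun j => w j *: 'X))) => [c|j] /=.
  by rewrite /psi comp_mpolyC !mmapC.
rewrite psiX raddf_sum mmapX mmap1U /=.
under eq_bigr => i _ do rewrite mmapZ mmapX mmap1U /= mul_polyC scalerA rmorph_int.
rewrite -scaler_suml; congr (_ *: _).
under eq_bigr => i _ do rewrite mulr_sumr.
rewrite exchange_big /=.
transitivity (\sum_l ((v *m u) j l)%:~R * w l).
  apply: eq_bigr => l _; rewrite mxE rmorph_sum mulr_suml.
  by apply: eq_bigr => i _; rewrite mulrA rmorphM.
under eq_bigr => l _ do rewrite vu rmorphD mulrDl.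
rewrite big_split /= -mulr_sumr w_sum mulr0 addr0 (bigD1 j) //= eqxx mul1r.
by rewrite big1 ?addr0 // => l /negPf; rewrite eq_sym => ->; rewrite mul0r.
Qed.

Lemma eval_msym F :
  eval_at_w (psi (msym s F)) = eval_at_w (psi F) \Po (z *: 'X).
Proof.
rewrite !eval_psi; apply: (@mpoly_rmorph_ext _ _ _
  (mmap (polyC \o ratr) (fun j => w j *: 'X) \o msym s)
  (comp_poly (z *: 'X) \o mmap (polyC \o ratr) (fun j => w j *: 'X))) => [c|j] /=.
  by rewrite /msym !mmapC /= comp_polyC.
rewrite {1}/msym !mmapX !mmap1U mmapX mmap1U w_perm.
by rewrite comp_polyZ comp_polyX scalerA mulrC.
Qed.

Lemma eval_pos g i : pos g -> (i < d)%N -> (eval_at_w g)`_i = 0.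
Proof.
move=> [/weylE gW g0] ltid.
have [->|i0] := posnP i.
  have -> : eval_at_w g = mmap (polyC \o ratr) (fun j => w j *: 'X) (phi g).
    by rewrite -eval_psi phiK.
  rewrite -horner_coef0 -[LHS]/(horner_eval 0 _).
  have h0 : (phi g)@_0%MM = 0 by rewrite -psi_coef0 phiK.
  transitivity (ratr (phi g)@_0%MM : algC); last by rewrite h0 rmorph0.
  apply: (@mpoly_rmorph_ext _ _ _
    (horner_eval 0 \o mmap (polyC \o ratr) (fun j => w j *: 'X))
    (ratr \o mcoeff 0%MM)) => [c|j] /=.
    by rewrite mmapC /horner_eval hornerC mpolyCK.
  rewrite mmapX mmap1U /horner_eval !hornerE.
  by rewrite mcoeffX -mdeg_eq0 mdeg1 rmorph0.
have := eval_msym (phi g); rewrite -sym_act_psi phiK gW //; move: (eval_at_w g) => p.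
move=> /(congr1 (fun p : {poly algC} => p`_i)).
rewrite comp_polyE coef_sum.
under eq_bigr => l _ do rewrite exprZn !coefZ coefXn.
have [lti|lei] := ltnP i (size p); last by move=> _; rewrite nth_default.
rewrite (bigD1 (Ordinal lti)) //= eqxx mulr1 big1 ?addr0; last first.
  by move=> l; rewrite -val_eqE eq_sym /= => /negPf ->; rewrite !mulr0.
move/eqP; rewrite -subr_eq0 -[X in X - _]mulr1 -mulrBr mulf_eq0 => /orP[/eqP //|].
rewrite subr_eq0 eq_sym -(prim_order_dvd z_prim) => /(dvdn_leq i0).
by rewrite leqNgt ltid.
Qed.

Lemma eval_sq f : (0 < d)%N -> sq f -> (eval_at_w f)`_d = 0.
Proof.
move=> d0 [n [g [h [p ->]]]]; rewrite eval_at_w_sum coef_sum.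
apply: big1 => i _; have [pg ph] := p i.
rewrite eval_at_wM coefM big1 // => l _.
have [ltl|lel] := ltnP l d; first by rewrite (eval_pos pg) // mul0r.
rewrite [X in _ * X](eval_pos ph) ?mulr0 // ltn_subLR //; last by rewrite -ltnS.
by rewrite -[X in (X < _)%N]add0n ltn_add2r (leq_trans d0).
Qed.

Lemma eval_power_sum j :
  (eval_at_w (psi (power_sum d j)))`_d = \sum_(i | mu i == mu j) w i ^+ d.
Proof.
rewrite eval_psi /power_sum raddf_sum coef_sum; apply: eq_bigr => i _ /=.
by rewrite rmorphXn /= mmapX mmap1U exprZn coefZ coefXn eqxx mulr1.
Qed.

End Evaluation.

(** * Bases of V_d made of power sums *)

Lemma evalZ w a f : eval_at_w w (a *: f) = ratr a *: eval_at_w w f.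
Proof. by rewrite /eval_at_w mmapZ /= mul_polyC. Qed.

Lemma V_basis_indep d n (f : 'I_n -> {mpoly rat[r]}) (c : 'rV[rat]_n) :
  V_basis H T chi d f -> sq (\sum_i c 0 i *: f i) -> c = 0.
Proof.
move=> [fp fb] h; have pos0 : pos 0.
  by split; [apply/weylE => s _; rewrite /sym_act raddf0 | rewrite mcoeff0].
have [c' [_ c'U]] := fb 0 pos0 (dhomog0 _ _ _).
rewrite -(c'U c) ?sub0r; last exact: sqN.
by apply: c'U; rewrite sub0r big1 ?oppr0; [exact: sq0 | move=> i _; rewrite mxE scale0r].
Qed.

Lemma V_basis_power_sum d n (rep : 'I_n -> 'I_N) : (0 < d)%N ->
  (forall j, exists c : 'I_n -> rat,
     sq (psi (power_sum d j) - \sum_i c i *: psi (power_sum d (rep i)))) ->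
  (forall c : 'I_n -> rat, sq (\sum_i c i *: psi (power_sum d (rep i))) ->
     forall i, c i = 0) ->
  V_basis H T chi d (fun i => psi (power_sum d (rep i))).
Proof.
move=> d0 spanH indepH; split=> [i|g [gW g0] gd].
  by split; [exact: pos_power_sum | apply/psi_homog/power_sum_homog].
have [a ha] := in_span_homog d0 gW gd.
have [b hb] := choice spanH.
pose e := \sum_i (\row_i \sum_j a j * b j i) 0 i *: psi (power_sum d (rep i)).
have he : sq (g - e).
  have -> : g - e = (g - \sum_j a j *: psi (power_sum d j)) + \sum_j a j *:
      (psi (power_sum d j) - \sum_i b j i *: psi (power_sum d (rep i))).
    rewrite -[LHS](subrKA (\sum_j a j *: psi (power_sum d j))); congr (_ + _).
    under [RHS]eq_bigr do rewrite scalerBr; rewrite sumrB; congr (_ - _).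
    under [RHS]eq_bigr do rewrite scaler_sumr; rewrite exchange_big.
    apply: eq_bigr => i _; rewrite mxE scaler_suml.
    by apply: eq_bigr => j _; rewrite scalerA.
  by apply: sqD => //; apply: sq_sum => j _; apply: sqZ.
exists (\row_i \sum_j a j * b j i); split => // c hc.
apply/rowP => i; apply/eqP; rewrite -subr_eq0; apply/eqP.
move: i; apply: (indepH (fun i => _ 0 i - c 0 i)).
under eq_bigr do rewrite scalerBl; rewrite sumrB -/e.
have -> : e - \sum_i c 0 i *: psi (power_sum d (rep i)) =
  (g - \sum_i c 0 i *: psi (power_sum d (rep i))) - (g - e).
  by rewrite opprB [RHS]addrC addrA subrK.
exact: sqB.
Qed.

Lemma psi_sumX : psi (\sum_j 'X_j) = 0.
Proof.
rewrite raddf_sum /=; under eq_bigr do rewrite psiX.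
rewrite exchange_big big1 //= => i _; rewrite -scaler_suml -rmorph_sum vsum.
by rewrite scale0r.
Qed.

(** In degree 1 the sum over all blocks is X_1 + ... + X_N, which [psi] kills; one block, that of
    j0, is therefore redundant. *)
Lemma power_sum1_relation n (rep : 'I_n -> 'I_N) j0 :
  (forall i i', mu (rep i) = mu (rep i') -> i = i') ->
  (forall i, mu (rep i) <> mu j0) ->
  (forall j, mu j = mu j0 \/ exists i, mu j = mu (rep i)) ->
  psi (power_sum 1 j0) = - \sum_i psi (power_sum 1 (rep i)).
Proof.
move=> repI repj0 repS; apply/eqP; rewrite -addr_eq0 -raddf_sum -raddfD /=.
rewrite -[X in _ == X]psi_sumX; apply/eqP; congr psi.
rewrite /power_sum big_mkcond; under [X in _ + X]eq_bigr do rewrite big_mkcond.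
rewrite exchange_big -big_split; apply: eq_bigr => l _ /=; rewrite expr1.
have [e|e] := eqVneq (mu l) (mu j0).
  rewrite big1 ?addr0 // => i _; case: eqP => // e'; case: (repj0 i).
  by rewrite -e' e.
have [|[i ei]] := repS l; first by move/eqP; rewrite (negPf e).
rewrite add0r (bigD1 i) //= ei eqxx big1 ?addr0 // => i' ne.
by case: eqP => // /repI e'; rewrite e' eqxx in ne.
Qed.

(** For each i there is an eigenvector at which only the i-th of the power sums is nonzero;
    evaluating a relation there isolates [c i]. *)
Lemma indep_of_points d n (rep : 'I_n -> 'I_N) (c : 'I_n -> rat) : (0 < d)%N ->
  (forall i, exists (w : 'I_N -> algC) (z : algC) (s : 'S_N),
    [/\ \sum_j w j = 0, d.-primitive_root z, label_preserving s,
        forall j, w (s j) = z * w j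
      & forall i', \sum_(j | mu j == mu (rep i')) w j ^+ d = 0 <-> i' <> i]) ->
  sq (\sum_i c i *: psi (power_sum d (rep i))) -> forall i, c i = 0.
Proof.
move=> d0 pts h i; have [w [z [s [w0 zp sW ws wd]]]] := pts i.
have := eval_sq w0 zp sW ws d0 h.
rewrite eval_at_w_sum coef_sum (bigD1 i) //= evalZ coefZ eval_power_sum //.
rewrite [X in _ + X]big1 => [|i' /eqP ne]; last first.
  by rewrite evalZ coefZ eval_power_sum // (proj2 (wd i') ne) mulr0.
rewrite addr0 => /eqP; rewrite mulf_eq0 fmorph_eq0 => /orP[/eqP //|/eqP].
by move=> /(proj1 (wd i)).
Qed.

(** Blocks with fewer than d elements contribute nothing by [sq_power_sum_small]. For a larger
    block, the values 1, z, ..., z^(d-1) on d of its indices, with z a primitive d-th root of unity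
    and 0 elsewhere, have sum 0 because d >= 2. A d-cycle inside the block multiplies them by z, and
    the d-th power sum of the block is d while those of the other blocks vanish. *)
Lemma V_basis_large d n (rep : 'I_n -> 'I_N) : (2 <= d)%N ->
  (forall i i', mu (rep i) = mu (rep i') -> i = i') ->
  (forall i, (d <= #|[set j | mu j == mu (rep i)]%SET|)%N) ->
  (forall j, (d <= #|[set l | mu l == mu j]%SET|)%N -> exists i, mu j = mu (rep i)) ->
  V_basis H T chi d (fun i => psi (power_sum d (rep i))).
Proof.
move=> d2 repI repL repS; have d0 : (0 < d)%N by exact: ltnW.
apply: V_basis_power_sum => // [j|c].
  have [/repS [i e]|lt] := leqP d #|[set l | mu l == mu j]%SET|.
    exists (fun l => (l == i)%:R); rewrite sum_scale_delta (power_sum_eq d e) subrr.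
    exact: sq0.
  exists (fun=> 0); rewrite big1 ?subr0; last by move=> l _; rewrite scale0r.
  exact: sq_power_sum_small.
apply: indep_of_points => // i.
have [z zp] := C_prim_root_exists d0.
set B := [set j | mu j == mu (rep i)]%SET.
have BE l : (l \in B) = (mu l == mu (rep i)) by rewrite inE.
pose t (a : 'I_d) : 'I_N := enum_val (widen_ord (repL i) a).
have tB a : t a \in B by exact: enum_valP.
have tI : injective t by move=> a b /enum_val_inj /(congr1 val) e; apply/val_inj.
pose w l : algC := \sum_a (t a == l)%:R * z ^+ a.
have wt a : w (t a) = z ^+ a.
  rewrite /w (bigD1 a) //= eqxx mul1r big1 ?addr0 // => b ne.
  by rewrite (inj_eq tI) (negPf ne) mul0r.
have wn l : (forall a, t a != l) -> w l = 0.
  by move=> h; rewrite /w big1 // => a _; rewrite (negPf (h a)) mul0r.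
pose sf l := if [pick a | t a == l] is Some a then t (ordS a) else l.
have sft a : sf (t a) = t (ordS a).
  rewrite /sf; case: pickP => [b /eqP/tI -> //|/(_ a)]; by rewrite eqxx.
have sfn l : (forall a, t a != l) -> sf l = l.
  by move=> h; rewrite /sf; case: pickP => // a; rewrite (negPf (h a)).
have tP l : (exists a, l = t a) \/ (forall a, t a != l).
  case: (pickP (fun a => t a == l)) => [a /eqP <-|h]; first by left; exists a.
  by right => a; rewrite h.
have sfI : injective sf.
  move=> l l'; case: (tP l) (tP l') => [[a ->]|h] [[b ->]|h'].
  - by rewrite !sft => /tI /ordS_inj ->.
  - by rewrite sft sfn // => e; case/eqP: (h' (ordS a)).
  - by rewrite sft sfn // => e; case/eqP: (h (ordS b)).
  - by rewrite !sfn.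
exists w, z, (perm sfI); split => //.
- rewrite /w exchange_big /=.
  under eq_bigr => a _.
    rewrite (bigD1 (t a)) //= eqxx mul1r big1 ?addr0; last first.
      by move=> l /negPf; rewrite eq_sym => ->; rewrite mul0r.
    over.
  exact: sum_prim_root_eq0 d2 zp (dvdnn d).
- apply/label_preservingP => l; rewrite permE; case: (tP l) => [[a ->]|h].
    by rewrite sft; move: (tB a) (tB (ordS a)); rewrite !BE => /eqP -> /eqP ->.
  by rewrite sfn.
- move=> l; rewrite permE; case: (tP l) => [[a ->]|h]; last by rewrite sfn // wn // mulr0.
  by rewrite sft !wt /= prim_expr_mod // exprS.
move=> i'; split.
  move=> e ei; move: e; rewrite ei (eq_bigl (mem B)) => [|l]; last by rewrite inE.
  rewrite (bigID (mem [set t a | a in 'I_d]%SET)) /= [X in _ + X]big1 ?addr0.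
    rewrite (eq_bigl (mem [set t a | a in 'I_d]%SET)); last first.
      move=> l /=; apply: andb_idl => /imsetP[a _ ->]; exact: tB.
    rewrite big_imset /=; last by move=> a b _ _; exact: tI.
    under eq_bigr do rewrite wt exprAC (prim_expr_order zp) expr1n.
    rewrite sumr_const card_ord => /eqP; rewrite pnatr_eq0 => /eqP d00.
    by rewrite d00 in d0.
  move=> l /andP[_ nl]; rewrite wn ?expr0n ?gtn_eqF // => a.
  by apply: contraNneq nl => <-; apply/imsetP; exists a.
move=> ne; apply: big1 => l /eqP el; rewrite wn ?expr0n ?gtn_eqF // => a.
apply/eqP => e; apply: ne; apply: repI; move: (tB a).
by rewrite e BE el => /eqP.
Qed.

(** The cyclic vector used in degrees at least 2 would not have sum 0 here; it is replaced by the
    difference of two unit vectors, one in the block tested and one in the omitted block of j0. *)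
Lemma V_basis_one n (rep : 'I_n -> 'I_N) j0 :
  (forall i i', mu (rep i) = mu (rep i') -> i = i') ->
  (forall i, mu (rep i) <> mu j0) ->
  (forall j, mu j = mu j0 \/ exists i, mu j = mu (rep i)) ->
  V_basis H T chi 1 (fun i => psi (power_sum 1 (rep i))).
Proof.
move=> repI repj0 repS; apply: V_basis_power_sum => // [j|c].
  have [e|[i e]] := repS j.
    exists (fun=> -1); rewrite (power_sum_eq 1 e) (power_sum1_relation repI repj0 repS).
    under [X in _ - X]eq_bigr do rewrite scaleN1r.
    by rewrite sumrN subrr; exact: sq0.
  exists (fun l => (l == i)%:R); rewrite sum_scale_delta (power_sum_eq 1 e) subrr.
  exact: sq0.
apply: indep_of_points => // i.
have nei : rep i != j0 by apply/eqP => e; apply: (repj0 i); rewrite e.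
exists (fun l => (l == rep i)%:R - (l == j0)%:R), 1, 1%g; split.
- rewrite sumrB (bigD1 (rep i)) //= eqxx big1 => [|l /negPf -> //].
  rewrite (bigD1 j0) //= eqxx [X in _ - (_ + X)]big1 => [|l /negPf -> //].
  by rewrite !addr0 subrr.
- exact: primitive_root1.
- exact: label_preserving1.
- by move=> j; rewrite perm1 mul1r.
move=> i'; rewrite (eq_bigr (fun l => (l == rep i)%:R)); last first.
  move=> l /eqP el; rewrite expr1 [X in _ - X](_ : _ = 0) ?subr0 //.
  by case: eqP => // e; case: (repj0 i'); rewrite -el e.
split=> [e ei|ne].
  move: e; rewrite ei (bigD1 (rep i)) //= eqxx big1 => [|l /andP[_ /negPf ->] //].
  by rewrite addr0 => /eqP; rewrite oner_eq0.
apply: big1 => l /eqP el; case: eqP => // e; case: ne; apply: repI.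
by rewrite -el e.
Qed.

Lemma block_representatives (D : pred 'I_N) :
  (forall i j, mu i = mu j -> D i = D j) ->
  exists n (rep : 'I_n -> 'I_N),
    [/\ forall i i', mu (rep i) = mu (rep i') -> i = i', forall i, D (rep i)
      & forall j, D j -> exists i, mu j = mu (rep i)].
Proof.
move=> Dmu.
pose R := [set j | D j && [forall i, (mu i == mu j) ==> (j <= i)%N]]%SET.
exists #|R|, (fun i => enum_val i); split.
- move=> i i' e; apply: enum_val_inj; apply/val_inj/eqP => /=.
  have := enum_valP i; have := enum_valP i'; rewrite !inE.
  move=> /andP[_ /forallP/(_ (enum_val i))]; rewrite e eqxx => le1.
  move=> /andP[_ /forallP/(_ (enum_val i'))]; rewrite eqxx => le2.
  by rewrite eqn_leq; apply/andP; split.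
- by move=> i; have := enum_valP i; rewrite inE => /andP[].
move=> j Dj; case: (@arg_minnP _ j (fun i => mu i == mu j) val (eqxx _)) => i /eqP e h.
have iR : i \in R.
  rewrite inE (Dmu _ _ e) Dj; apply/forallP => l; apply/implyP; rewrite e; exact: h.
by exists (enum_rank_in iR i); rewrite enum_rankK_in // e.
Qed.

(** * The Frobenius action on the graded pieces of R_+ / R_+^2 *)

Section Frobenius.

Variable sg : 'S_N.
Hypothesis sgmu : forall i j, mu (sg i) = mu (sg j) <-> mu i = mu j.
Local Notation MF := (perm_matrix_action sg).

Lemma pos_frob f : pos f -> pos (sym_act MF f).
Proof.
move=> [/weylE fW f0]; split; last by rewrite sym_act_coef0.
apply/weylE => s sW; rewrite -{1}(phiK f) !sym_act_psi -msymMm.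
have tW : label_preserving (sg * s * sg^-1)%g.
  by apply: label_preserving_conj => // i j /sgmu.
rewrite -(mulgKV sg (sg * s)%g) msymMm -sym_act_psi; congr sym_act.
by rewrite -sym_act_psi phiK fW.
Qed.

Lemma sq_frob f : sq f -> sq (sym_act MF f).
Proof.
move=> [n [g [h [p ->]]]]; rewrite /sym_act raddf_sum; apply: sq_sum => i _ /=.
by rewrite rmorphM; apply: sqM; apply: pos_frob; case: (p i).
Qed.

Lemma sym_act_lin_comb n (a : 'I_n -> rat) (f : 'I_n -> {mpoly rat[r]}) M :
  sym_act M (\sum_i a i *: f i) = \sum_i a i *: sym_act M (f i).
Proof.
rewrite /sym_act raddf_sum; apply: eq_bigr => i _; exact: comp_mpolyZ.
Qed.

Lemma sym_act_homog d M f : f \is d.-homog -> @sym_act r M f \is d.-homog.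
Proof.
by apply: comp_linear_homog => i; rewrite tnth_mktuple linear_form_homog.
Qed.

Lemma V_det_of_basis d n (f : 'I_n -> {mpoly rat[r]}) :
  V_basis H T chi d f -> exists P, V_frobenius_det H T chi MF d P.
Proof.
move=> fb; have [fp fs] := fb.
have ex i : exists c : 'rV[rat]_n, sq (sym_act MF (f i) - \sum_j c 0 j *: f j).
  have [fip fih] := fp i.
  by have [c [hc _]] := fs _ (pos_frob fip) (sym_act_homog _ fih); exists c.
have [b hb] := choice ex.
exists (\det (1%:M - 'X *: map_mx polyC (\matrix_(i, j) b i 0 j))).
exists n, f, (\matrix_(i, j) b i 0 j); split => // i.
by under eq_bigr do rewrite mxE.
Qed.

Lemma lin_comb_mulmx (n1 n2 n3 : nat) (A : 'M[rat]_(n1, n2)) (B : 'M[rat]_(n2, n3))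
    (x : 'I_n3 -> {mpoly rat[r]}) i :
  \sum_l A i l *: (\sum_j B l j *: x j) = \sum_j (A *m B) i j *: x j.
Proof.
under eq_bigr do rewrite scaler_sumr.
rewrite exchange_big; apply: eq_bigr => j _; rewrite mxE scaler_suml.
by apply: eq_bigr => l _; rewrite scalerA.
Qed.

Lemma sq_trans f g h : sq (f - g) -> sq (g - h) -> sq (f - h).
Proof. by move=> h1 h2; rewrite -(subrKA g); apply: sqD. Qed.

Lemma sq_sym f g : sq (f - g) -> sq (g - f).
Proof. by move=> h; rewrite -opprB; apply: sqN. Qed.

Lemma sq_comb_trans n1 n2 n3 (A : 'M[rat]_(n1, n2)) (B : 'M[rat]_(n2, n3))
    (y : 'I_n2 -> {mpoly rat[r]}) (x : 'I_n3 -> {mpoly rat[r]}) f i :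
  sq (f - \sum_l A i l *: y l) -> (forall l, sq (y l - \sum_j B l j *: x j)) ->
  sq (f - \sum_j (A *m B) i j *: x j).
Proof.
move=> h1 h2; rewrite -lin_comb_mulmx; apply: sq_trans h1 _.
by rewrite -sumrB; apply: sq_sum => l _; rewrite -scalerBr; apply: sqZ.
Qed.

Lemma V_basis_coord_eq d n n1 (f : 'I_n -> {mpoly rat[r]}) (A B : 'M[rat]_(n1, n))
    (y : 'I_n1 -> {mpoly rat[r]}) :
  V_basis H T chi d f -> (forall i, sq (y i - \sum_j A i j *: f j)) ->
  (forall i, sq (y i - \sum_j B i j *: f j)) -> A = B.
Proof.
move=> fb hA hB; apply/row_matrixP => i; apply/eqP; rewrite -subr_eq0; apply/eqP.
apply: (V_basis_indep fb); under eq_bigr do rewrite !mxE scalerBl.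
by rewrite sumrB; apply: sq_trans (hB i); apply: sq_sym.
Qed.

(** The two bases may a priori have different sizes. The transition matrices in both directions are
    inverse to each other by uniqueness of coordinates, so the sizes agree and the matrices of the
    Frobenius are conjugate. *)
Lemma V_det_unique d P P' : V_frobenius_det H T chi MF d P ->
  V_frobenius_det H T chi MF d P' -> P = P'.
Proof.
move=> [n [f [B [fb fB ->]]]] [n' [f' [B' [fb' fB' ->]]]].
have [fp fs] := fb; have [fp' fs'] := fb'.
have exC i : exists c : 'rV[rat]_n', sq (f i - \sum_j c 0 j *: f' j).
  by have [fip fih] := fp i; have [c [hc _]] := fs' _ fip fih; exists c.
have exD i : exists c : 'rV[rat]_n, sq (f' i - \sum_j c 0 j *: f j).
  by have [fip fih] := fp' i; have [c [hc _]] := fs _ fip fih; exists c.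
have [cC hC0] := choice exC; have [cD hD0] := choice exD.
pose Cm := \matrix_(i, j) cC i 0 j; pose Dm := \matrix_(i, j) cD i 0 j.
have hC i : sq (f i - \sum_j Cm i j *: f' j).
  by under eq_bigr do rewrite mxE; exact: hC0.
have hD i : sq (f' i - \sum_j Dm i j *: f j).
  by under eq_bigr do rewrite mxE; exact: hD0.
have one n0 (g : 'I_n0 -> {mpoly rat[r]}) i : sq (g i - \sum_j (1%:M : 'M[rat]_n0) i j *: g j).
  rewrite (bigD1 i) //= mxE eqxx scale1r big1 ?addr0 ?subrr; first exact: sq0.
  by move=> j; rewrite mxE eq_sym => /negPf ->; rewrite scale0r.
have CD : Cm *m Dm = 1%:M.
  by apply: (V_basis_coord_eq fb) => i; [apply: sq_comb_trans (hC i) hD | exact: one].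
have DC : Dm *m Cm = 1%:M.
  by apply: (V_basis_coord_eq fb') => i; [apply: sq_comb_trans (hD i) hC | exact: one].
have BC : B *m Cm = Cm *m B'.
  apply: (V_basis_coord_eq (y := fun i => sym_act MF (f i)) fb') => i.
    exact: sq_comb_trans (fB i) hC.
  apply: sq_comb_trans _ fB'.
  by have := sq_frob (hC i); rewrite {1}/sym_act raddfB /= -!/(sym_act _ _) sym_act_lin_comb.
have e : n = n' by apply/eqP; rewrite eqn_leq (mulmx1_min CD) (mulmx1_min DC).
subst n'.
have BE : B = Cm *m B' *m Dm by rewrite -BC -mulmxA CD mulmx1.
have -> : 1%:M - 'X *: map_mx polyC B =
  map_mx polyC Cm *m (1%:M - 'X *: map_mx polyC B') *m map_mx polyC Dm.
  rewrite mulmxBr mulmxBl mulmx1 -!map_mxM CD map_mx1 -scalemxAr -scalemxAl.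
  by rewrite -!map_mxM -BE.
rewrite !det_mulmx mulrAC -det_mulmx -map_mxM CD map_mx1 det1 mul1r //.
Qed.

Lemma V_det_exists (j0 : 'I_N) d : (0 < d)%N -> exists P, V_frobenius_det H T chi MF d P.
Proof.
case: d => [//|[_|d _]].
  have [|n [rep [repI repD repS]]] := @block_representatives (fun j => mu j != mu j0).
    by move=> i j ->.
  apply: V_det_of_basis; apply: (@V_basis_one _ rep j0) => // [i|j]; first exact/eqP.
  by have [->|/repS] := eqVneq (mu j) (mu j0); [left | right].
have [|n [rep [repI repD repS]]] :=
    @block_representatives (fun j => d.+2 <= #|[set l | mu l == mu j]%SET|)%N.
  by move=> i j ->.
by apply: V_det_of_basis; apply: (@V_basis_large _ _ rep).
Qed.

Lemma V_det_above d a P : (0 < a < d)%N ->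
  (forall j, #|[set l | mu l == mu j]%SET| <= a)%N ->
  V_frobenius_det H T chi MF d P -> P = 1.
Proof.
move=> /andP[a0 ad] small VP; apply: V_det_unique VP _.
(* No block has d elements, so the family of representatives, and with it the basis of V_d, is
   empty. *)
pose rep (i : 'I_0) : 'I_N := False_rect _ (notF (valP i)).
exists 0%N, (fun i => psi (power_sum d (rep i))), 0; split.
- apply: V_basis_large => [|[]|[]|j] //; first exact: leq_ltn_trans ad.
  by move=> le; have := leq_trans le (small j); rewrite leqNgt ad.
- by case.
by rewrite det_mx00.
Qed.

(** The sum of the variables in Z is invariant and fixed by the Frobenius. Its class in V_1 is
    nonzero, since it takes the value 1 at the difference of the unit vectors of j1 and j2. So 1 is
    an eigenvalue of the Frobenius on V_1. *)
Lemma V_det_multi (Z : {set 'I_N}) j1 j2 P : j1 \in Z -> j2 \notin Z ->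
  (forall i j, mu i = mu j -> i \in Z -> j \in Z) ->
  (forall i, (sg i \in Z) = (i \in Z)) ->
  V_frobenius_det H T chi MF 1 P -> P.[1] = 0.
Proof.
move=> j1Z j2Z Zmu Zsg [n [f [B [fb fB ->]]]].
pose Y : {mpoly rat[N]} := \sum_(j in Z) 'X_j.
have msymY (s : 'S_N) : (forall j, (s j \in Z) = (j \in Z)) -> msym s Y = Y.
  move=> sZ; rewrite /Y raddf_sum [RHS](reindex_inj (@perm_inj _ s)) /=.
  by apply: eq_big => [j|j _]; rewrite ?sZ // /msym mmapX mmap1U.
have Yp : pos (psi Y).
  apply: pos_psi => [s /label_preservingP sW|].
    apply: msymY => j; apply/idP/idP; apply: Zmu; first exact: sW.
    exact/esym/sW.
  by rewrite raddf_sum big1 // => j _; exact: homog_coef0 (mpolyX_homog _ j).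
have Yh : psi Y \is 1.-homog.
  by apply: psi_homog; rewrite rpred_sum // => j _; exact: mpolyX_homog.
have [c [hc _]] := (proj2 fb) _ Yp Yh.
have cB : c *m B = c.
  apply: (V_basis_coord_eq (y := fun=> psi Y) fb) => i; rewrite (ord1 i) //.
  apply: sq_comb_trans _ fB; have := sq_frob hc.
  rewrite {1}/sym_act raddfB /= -!/(sym_act _ _) sym_act_lin_comb sym_act_psi.
  by rewrite msymY.
have c_neq0 : c != 0.
  apply/eqP => cz; move: hc; rewrite big1 ?subr0; last first.
    by move=> i _; rewrite cz mxE scale0r.
  pose w l : algC := (l == j1)%:R - (l == j2)%:R.
  have j12 : j1 != j2 by apply: contraNneq j2Z => <-.
  move=> h; have := @eval_sq w 1 1 1%g _ (primitive_root1 _) label_preserving1 _ _ (ltn0Sn _) h.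
  have w0 : \sum_j w j = 0.
    rewrite sumrB (bigD1 j1) //= eqxx big1 => [|l /negPf -> //].
    rewrite (bigD1 j2) //= eqxx [X in _ - (_ + X)]big1 => [|l /negPf -> //].
    by rewrite !addr0 subrr.
  rewrite w0 eval_psi // => /(_ erefl); rewrite /Y raddf_sum coef_sum /=.
  under eq_bigr do rewrite mmapX mmap1U coefZ coefX eqxx mulr1.
  rewrite sumrB (bigD1 j1) //= eqxx big1 => [|l /andP[_ /negPf -> //]].
  rewrite big1 => [|l lZ]; last by case: eqP => // e; rewrite e (negPf j2Z) in lZ.
  rewrite addr0 subr0 => e; have /eqP := oner_neq0 algC.
  by rewrite -e => //; move=> j; rewrite perm1 mul1r.
rewrite -[_.[1]]/(horner_eval 1 _) -det_map_mx.
have -> : map_mx (horner_eval 1) (1%:M - 'X *: map_mx polyC B) = 1%:M - B.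
  apply/matrixP => i j; rewrite !mxE /horner_eval !hornerE /=.
  by case: (i == j); rewrite !hornerE.
by apply/eqP/det0P; exists c => //; rewrite mulmxBr mulmx1 cB subrr.
Qed.

Section SingleOrbit.

Variables (j0 : 'I_N) (d : nat).
Hypothesis d_gt0 : (0 < d)%N.
Local Notation rp i := (iter i sg j0).
Hypothesis rp_inj : forall i i', (i < d)%N -> (i' < d)%N ->
  mu (rp i) = mu (rp i') -> i = i'.
Hypothesis rp_period : mu (rp d) = mu j0.
Hypothesis rp_cover : forall j, exists2 i, (i < d)%N & mu j = mu (rp i).

Lemma frob_power_sum e j :
  sym_act MF (psi (power_sum e j)) = psi (power_sum e (sg j)).
Proof. by rewrite sym_act_psi msym_power_sum. Qed.

(** The Frobenius shifts the blocks, and the last one is minus the sum of the others: its matrix on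
    the first d - 1 blocks is the companion matrix of 1 + X + ... + X^(d-1), a palindromic
    polynomial. *)
Lemma V_det_single_one P : V_frobenius_det H T chi MF 1 P ->
  P = \sum_(i < d) 'X^i.
Proof.
move=> VP; apply: V_det_unique VP _.
(* The dimension d - 1 is written [(size p).-1] throughout, to match the type of [companionmx p]. *)
pose p : {poly rat} := \poly_(i < d) 1.
have sz : size p = d by rewrite size_poly_eq // oner_eq0.
have rpS (i : 'I_(size p).-1) : (i < d)%N.
  by rewrite (leq_trans (ltn_ord i)) // sz leq_pred.
have nl (i : 'I_(size p).-1) : i <> d.-1 :> nat.
  by move=> e; have := ltn_ord i; rewrite [X in (X < _)%N]e sz ltnn.
have repI (i i' : 'I_(size p).-1) : mu (rp i) = mu (rp i') -> i = i'.
  by move=> e; apply/val_inj/(rp_inj (rpS i) (rpS i') e).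
have repj (i : 'I_(size p).-1) : mu (rp i) <> mu (rp d.-1).
  by move=> /rp_inj h; apply: (nl i); apply: h; rewrite ?prednK.
have repS j : mu j = mu (rp d.-1) \/ exists i : 'I_(size p).-1, mu j = mu (rp i).
  have [i ltid e] := rp_cover j; have [ei|ne] := eqVneq i d.-1.
    by left; rewrite e ei.
  have lti : (i < (size p).-1)%N.
    by rewrite sz ltn_neqAle ne -ltnS prednK ?ltn_ord.
  by right; exists (Ordinal lti).
have relE := power_sum1_relation repI repj repS.
exists (size p).-1, (fun i => psi (power_sum 1 (rp i))), (companionmx p); split.
- exact: V_basis_one repI repj repS.
- move=> i; rewrite frob_power_sum; under eq_bigr do rewrite mxE.
  have [ei|ne] := eqVneq (i : nat) (size p).-2.
    have p0 := leq_ltn_trans (leq0n i) (ltn_ord i).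
    have i1 : i.+1 = d.-1 by rewrite ei prednK // sz.
    have di : sg (rp i) = rp d.-1 by rewrite -[LHS]/(rp i.+1) i1.
    rewrite di relE.
    under [X in _ - X]eq_bigr => l _ do rewrite coef_poly rpS scaleN1r.
    by rewrite sumrN subrr; exact: sq0.
  by rewrite (companion_shift (fun j => psi (power_sum 1 (rp j))) ne) subrr; apply: sq0.
apply/esym/(@det_one_sub_char_poly _ _ p).
  by apply: companionmxK; rewrite monicE lead_coefE sz coef_poly prednK // leqnn.
move=> t t0; rewrite horner_poly sz horner_sum mulr_sumr.
rewrite (reindex_inj rev_ord_inj); apply: eq_bigr => i _ /=.
rewrite hornerXn mul1r subnS exprVn -expfB_cond ?(negPf t0) ?add0n //.
  by rewrite -subn1 subnAC subn1.
by rewrite -ltnS prednK.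
Qed.

(** In these degrees all d blocks give basis elements, and the Frobenius permutes them in one cycle:
    its matrix is the companion matrix of X^d - 1. *)
Lemma V_det_single e a P : (2 <= e <= a)%N ->
  (forall j, #|[set l | mu l == mu j]%SET| = a) ->
  V_frobenius_det H T chi MF e P -> P = 1 - 'X^d.
Proof.
move=> /andP[e2 ea] blk VP; apply: V_det_unique VP _.
pose p : {poly rat} := 'X^d - 1.
have sz : size p = d.+1 by rewrite size_XnsubC.
have rpS (i : 'I_(size p).-1) : (i < d)%N.
  by apply: leq_trans (ltn_ord i) _; rewrite sz.
exists (size p).-1, (fun i => psi (power_sum e (rp i))), (companionmx p); split.
- apply: (@V_basis_large e (size p).-1 (fun i => rp i)) => // [i i' h|i|j _].
  + exact/val_inj/(rp_inj (rpS i) (rpS i') h).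
  + by rewrite blk.
  have [i ltid ei] := rp_cover j.
  have lti : (i < (size p).-1)%N by rewrite sz.
  by exists (Ordinal lti).
- move=> i; rewrite frob_power_sum; under eq_bigr do rewrite mxE.
  have [ei|ne] := eqVneq (i : nat) (size p).-2.
    have di : psi (power_sum e (sg (rp i))) = psi (power_sum e j0).
      have p0 := leq_ltn_trans (leq0n i) (ltn_ord i).
      have i1 : i.+1 = d by rewrite ei prednK // sz.
      by congr psi; apply: power_sum_eq; rewrite -[sg _]/(rp i.+1) i1.
    have lt0 : (0 < (size p).-1)%N by rewrite sz.
    rewrite di (bigD1 (Ordinal lt0)) //= big1 => [|l].
      rewrite addr0 coefB coefXn coef1 eqxx (_ : (0 == d)%N = false) ?sub0r ?opprK.
        by rewrite scale1r subrr; exact: sq0.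
      by rewrite eq_sym gtn_eqF.
    rewrite -val_eqE /= => /negPf l0; rewrite coefB coefXn coef1 l0.
    by rewrite (ltn_eqF (rpS l)) subrr oppr0 scale0r.
  by rewrite (companion_shift (fun j => psi (power_sum e (rp j))) ne) subrr; apply: sq0.
apply/esym/(@det_one_sub_char_poly _ _ p).
  by apply: companionmxK; apply: monicXnsubC.
move=> t t0; by rewrite sz /= !hornerE mulrBr mulr1 exprVn divff // expf_neq0.
Qed.

End SingleOrbit.

End Frobenius.

End BlockInvariants.

(** * Diagonal tori and their characters *)

Lemma unitmx_row_neq0 (F : fieldType) N (W : 'M[F]_N) (j : 'I_N) : W \in unitmx ->
  exists i, W j i != 0.
Proof.
move=> Wu; apply: contrapT => h; have : row j W = 0.
  by apply/rowP => i; rewrite mxE [RHS]mxE; apply/eqP/negPn/negP => ?; apply: h; exists i.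
move=> /(congr1 (fun r => r *m invmx W)); rewrite -row_mul mulmxV // mul0mx.
by move=> /rowP/(_ j)/eqP; rewrite !mxE eqxx oner_eq0.
Qed.

Lemma diag_mx_intertwine (F : fieldType) N (W : 'M[F]_N) (a b : 'rV_N) :
  W *m diag_mx a = diag_mx b *m W -> forall i j, W i j != 0 -> a 0 j = b 0 i.
Proof.
move=> E i j Wij; have /matrixP/(_ i j) := E; rewrite mul_diag_mx mul_mx_diag.
by rewrite [X in X = _ -> _]mxE [X in _ = X -> _]mxE mulrC => /(mulIf Wij).
Qed.

Lemma diag_rows_eigenvalue (F : fieldType) N (s P W : 'M[F]_N) (a b : 'rV_N) :
  P \in unitmx -> P *m s = diag_mx a *m P -> W \in unitmx -> W *m s = diag_mx b *m W ->
  forall j, exists i, b 0 j = a 0 i.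
Proof.
move=> Pu Ps Wu Ws j.
have [|i] := @unitmx_row_neq0 _ _ (W *m invmx P) j; first by rewrite unitmx_mul Wu unitmx_inv.
set M := W *m invmx P => Mji; exists i; symmetry; apply: diag_mx_intertwine Mji.
apply: (can_inj (mulmxK Pu)); rewrite -!mulmxA -Ps /M !mulmxA mulmxKV // -Ws.
by rewrite -(mulmxA _ (invmx P) P) mulVmx // mulmx1.
Qed.

Lemma perm_mx_diag (R : pzSemiRingType) N (sg : 'S_N) (a b : 'rV[R]_N) :
  (forall j, a 0 (sg j) = b 0 j) -> perm_mx sg *m diag_mx a = diag_mx b *m perm_mx sg.
Proof.
move=> ab; apply/matrixP => i j; rewrite mul_mx_diag mul_diag_mx !mxE.
by case: eqP => [<-|]; rewrite ?ab ?mulr1 ?mul1r ?mulr0 ?mul0r.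
Qed.

(** Some term of the Leibniz expansion is nonzero. This is how a permutation of eigenvalues is read
    off an invertible intertwining matrix. *)
Lemma unitmx_perm_neq0 (F : fieldType) N (W : 'M[F]_N) : W \in unitmx ->
  exists p : 'S_N, forall i, W i (p i) != 0.
Proof.
rewrite unitmxE unitfE => /eqP Wd; apply: contrapT => h; apply: Wd.
rewrite /determinant big1 // => p _.
have [->|/prodf_neq0 ne] := eqVneq (\prod_i W i (p i)) 0; first by rewrite mulr0.
by case: h; exists p => i; apply: ne.
Qed.

Section IntegerPowers.
Variable F : fieldType.

Lemma prodf_expz (I : Type) (s : seq I) (P : pred I) (f : I -> F) (a : int) :
  (\prod_(i <- s | P i) f i) ^ a = \prod_(i <- s | P i) f i ^ a.
Proof.
apply: (big_morph (fun y => y ^ a)) => [x y|]; first exact: expfzMl.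
exact: exp1rz.
Qed.

Lemma expfz_sum (I : Type) (s : seq I) (P : pred I) (x : F) (a : I -> int) :
  x != 0 -> x ^ (\sum_(i <- s | P i) a i) = \prod_(i <- s | P i) x ^ a i.
Proof.
move=> x0; apply: (big_morph (fun b => x ^ b)) => [b c|]; first exact: expfzDr.
exact: expr0z.
Qed.

Lemma prod_expz_comp (I J : finType) (x : J -> F) (A : I -> J -> int) (b : I -> int) :
  (forall j, x j != 0) ->
  \prod_i (\prod_j x j ^ A i j) ^ b i = \prod_j x j ^ (\sum_i b i * A i j).
Proof.
move=> x0; under eq_bigr do rewrite prodf_expz.
rewrite exchange_big; apply: eq_bigr => j _; rewrite expfz_sum //.
by apply: eq_bigr => i _; rewrite exprz_exp mulrC.
Qed.

Lemma prod_expz_neq0 (I : finType) (x : I -> F) (a : I -> int) :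
  (forall i, x i != 0) -> \prod_i x i ^ a i != 0.
Proof. by move=> x0; apply/prodf_neq0 => i _; rewrite expfz_neq0. Qed.

Lemma prod_expz_delta (I : finType) (x : I -> F) (i : I) :
  \prod_j x j ^ ((i == j)%:R : int) = x i.
Proof.
rewrite (bigD1 i) //= eqxx expr1z big1 ?mulr1 // => j /negPf.
by rewrite eq_sym => ->; rewrite expr0z.
Qed.

End IntegerPowers.

Lemma exists_expz_neq1 (K : closedFieldType) (a : int) : a != 0 ->
  exists2 z : K, z != 0 & z ^ a != 1.
Proof.
move=> a0; have n0 : (0 < `|a|)%N by rewrite absz_gt0.
have p0 : 'X^(`|a|) - 1 != 0 :> {poly K} by rewrite monic_neq0 // monicXnsubC.
have [z z0 pz] := closed_nonroot_neq0 p0; exists z => //.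
move: pz; rewrite !hornerE subr_eq0; apply: contraNneq.
case: a {a0 n0 p0} => n h; first by apply/eqP.
by rewrite -[_ ^+ _]invrK (_ : (z ^+ _)^-1 = 1) ?invr1.
Qed.

Lemma big_fun_closed (X R I : Type) (cl : (X -> R) -> Prop) (op : R -> R -> R) (idx : R)
    (s : seq I) (P : pred I) (F : I -> X -> R) : cl (fun=> idx) ->
  (forall f g, cl f -> cl g -> cl (fun t => op (f t) (g t))) ->
  (forall i, cl (F i)) -> cl (fun t => \big[op/idx]_(i <- s | P i) F i t).
Proof.
move=> cl0 clop clF; elim: s => [|i s IH].
  by rewrite (_ : (fun t => _) = fun=> idx) //; apply/funext => t; rewrite big_nil.
rewrite (_ : (fun t => _) = if P i then fun t => op (F i t) (\big[op/idx]_(i <- s | P i) F i t)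
  else fun t => \big[op/idx]_(i <- s | P i) F i t); last first.
  by apply/funext => t; rewrite big_cons; case: (P i).
by case: (P i) => //; apply: clop.
Qed.

(** * Polynomial functions, cocharacters, connectedness and characters of a diagonal torus *)

Section PolynomialFunctions.
Variables (K : closedFieldType) (N : nat).

Definition polyfun (F : 'M[K]_N -> K) : Prop :=
  exists f : {mpoly K[N * N]}, forall t, mx_eval f t = F t.

Lemma polyfun_cst c : polyfun (fun=> c).
Proof. by exists c%:MP => t; rewrite /mx_eval mevalC. Qed.

Lemma polyfun_entry i j : polyfun (fun t => t i j).
Proof. by exists 'X_(mxvec_index i j) => t; rewrite /mx_eval mevalXU mxvecE. Qed.

Lemma polyfunD F G : polyfun F -> polyfun G -> polyfun (fun t => F t + G t).
Proof. by move=> [f fE] [g gE]; exists (f + g) => t; rewrite /mx_eval mevalD -fE -gE. Qed.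

Lemma polyfunM F G : polyfun F -> polyfun G -> polyfun (fun t => F t * G t).
Proof. by move=> [f fE] [g gE]; exists (f * g) => t; rewrite /mx_eval mevalM -fE -gE. Qed.

Lemma polyfunB F G : polyfun F -> polyfun G -> polyfun (fun t => F t - G t).
Proof. by move=> [f fE] [g gE]; exists (f - g) => t; rewrite /mx_eval mevalB -fE -gE. Qed.

Lemma polyfun_sum (I : Type) (s : seq I) (P : pred I) F :
  (forall i, polyfun (F i)) -> polyfun (fun t => \sum_(i <- s | P i) F i t).
Proof. exact: big_fun_closed (polyfun_cst 0) polyfunD. Qed.

Lemma polyfun_prod (I : Type) (s : seq I) (P : pred I) F :
  (forall i, polyfun (F i)) -> polyfun (fun t => \prod_(i <- s | P i) F i t).
Proof. exact: big_fun_closed (polyfun_cst 1) polyfunM. Qed.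

Lemma polyfunX F n : polyfun F -> polyfun (fun t => F t ^+ n).
Proof. by move=> [f fE]; exists (f ^+ n) => t; rewrite /mx_eval rmorphXn /= -fE. Qed.

Lemma polyfun_conj (A B : 'M[K]_N) i j : polyfun (fun t => (A *m t *m B) i j).
Proof.
have h : polyfun (fun t => \sum_l (\sum_l' A i l' * t l' l) * B l j).
  apply: polyfun_sum => l; apply: polyfunM (polyfun_cst _).
  by apply: polyfun_sum => l'; apply: polyfunM (polyfun_cst _) (polyfun_entry _ _).
have [f fE] := h; exists f => t; rewrite fE mxE; apply: eq_bigr => l _.
by rewrite mxE.
Qed.

Lemma zariski_closed_polyfuns (I : Type) (F : I -> 'M[K]_N -> K) :
  (forall i, polyfun (F i)) ->
  zariski_closed [set g | g \in unitmx /\ forall i, F i g = 0]%classic.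
Proof.
move=> /choice[f fE]; exists [set f i | i in setT]%classic.
apply/seteqP; split => g /= [gu h]; split => //.
  by move=> _ [i _ <-]; rewrite fE.
by move=> i; rewrite -fE; apply: h; exists i.
Qed.

Lemma zariski_closed_cut A F : zariski_closed A -> polyfun F ->
  zariski_closed (A `&` [set g | F g = 0])%classic.
Proof.
move=> [I ->] [f fE]; exists (I `|` [set f])%classic.
apply/seteqP; split => g /=.
  by move=> [[gu h] Fg]; split => // f' [/h //|->]; rewrite fE.
move=> [gu h]; split; first by split => // f' f'I; apply: h; left.
by rewrite -fE; apply: h; right.
Qed.

Definition laurent (F : K -> K) : Prop :=
  exists (p : {poly K}) (M : nat), forall z, z != 0 -> F z * z ^+ M = p.[z].

Lemma laurent_cst c : laurent (fun=> c).
Proof. by exists c%:P, 0%N => z _; rewrite mulr1 hornerC. Qed.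

Lemma laurent_expz (a : int) : laurent (fun z => z ^ a).
Proof.
case: a => n; first by exists 'X^n, 0%N => z _; rewrite mulr1 hornerXn.
by exists 1, n.+1 => z z0; rewrite NegzE -exprnN mulVf ?hornerC // expf_neq0.
Qed.

Lemma laurentD F G : laurent F -> laurent G -> laurent (fun z => F z + G z).
Proof.
move=> [p [M pE]] [q [M' qE]]; exists (p * 'X^M' + q * 'X^M), (M + M')%N => z z0.
rewrite !hornerE -pE // -qE // mulrDl exprD -!mulrA; congr (_ + _ * _).
by rewrite mulrC.
Qed.

Lemma laurentM F G : laurent F -> laurent G -> laurent (fun z => F z * G z).
Proof.
move=> [p [M pE]] [q [M' qE]]; exists (p * q), (M + M')%N => z z0.
by rewrite hornerM -pE // -qE // exprD mulrACA.
Qed.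

Lemma laurent_sum (I : Type) (s : seq I) F :
  (forall i, laurent (F i)) -> laurent (fun z => \sum_(i <- s) F i z).
Proof. exact: big_fun_closed (laurent_cst 0) laurentD. Qed.

Lemma laurent_prod (I : Type) (s : seq I) F :
  (forall i, laurent (F i)) -> laurent (fun z => \prod_(i <- s) F i z).
Proof. exact: big_fun_closed (laurent_cst 1) laurentM. Qed.

Lemma laurentX F n : laurent F -> laurent (fun z => F z ^+ n).
Proof.
move=> [p [M pE]]; exists (p ^+ n), (M * n)%N => z z0.
by rewrite horner_exp -pE // exprMn exprM.
Qed.

Lemma laurent_mx_eval (f : {mpoly K[N * N]}) (g : K -> 'M[K]_N) :
  (forall i j, laurent (fun z => g z i j)) -> laurent (fun z => mx_eval f (g z)).
Proof.
move=> h; have h' i : laurent (fun z => mxvec (g z) 0 i).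
  have [a b] := mxvec_indexP i; have [p [M E]] := h a b.
  by exists p, M => z z0; rewrite mxvecE E.
have [p [M E]] : laurent (fun z =>
    \sum_(m <- msupp f) f@_m * \prod_(i <- index_enum 'I_(N * N)) mxvec (g z) 0 i ^+ m i).
  apply: laurent_sum => m; apply: laurentM (laurent_cst _) _.
  by apply: laurent_prod => i; apply: laurentX.
by exists p, M => z z0; rewrite /mx_eval mevalE -E.
Qed.

(** The convention throughout: the rows of P are left eigenvectors, with eigenvalues the entries of
    x. *)
Definition conj_diag (P : 'M[K]_N) (x : 'rV[K]_N) : 'M[K]_N :=
  invmx P *m diag_mx x *m P.

Definition coordinate (P t : 'M[K]_N) (j : 'I_N) : K := (P *m t *m invmx P) j j.

Definition diag_torus (P : 'M[K]_N) : set 'M[K]_N :=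
  [set t | exists2 x : 'rV[K]_N, \prod_j x 0 j = 1 & t = conj_diag P x]%classic.

Section Basis.
Variable P : 'M[K]_N.
Hypothesis Pu : P \in unitmx.

Lemma conj_diagK x : P *m conj_diag P x = diag_mx x *m P.
Proof. by rewrite /conj_diag !mulmxA mulmxV // mul1mx. Qed.

Lemma conj_diagP t x : P *m t = diag_mx x *m P -> t = conj_diag P x.
Proof. by move=> h; rewrite /conj_diag -mulmxA -h mulmxA mulVmx // mul1mx. Qed.

Lemma coordinate_conj_diag x j : coordinate P (conj_diag P x) j = x 0 j.
Proof. by rewrite /coordinate conj_diagK -mulmxA mulmxV // mulmx1 mxE eqxx. Qed.

Lemma conj_diagM x y :
  conj_diag P x *m conj_diag P y = conj_diag P (\row_j (x 0 j * y 0 j)).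
Proof.
apply: conj_diagP; rewrite mulmxA conj_diagK -mulmxA conj_diagK mulmxA.
by rewrite mulmx_diag.
Qed.

Lemma conj_diag1 : conj_diag P (const_mx 1) = 1%:M.
Proof. by apply/esym/conj_diagP; rewrite diag_const_mx mulmx1 mul1mx. Qed.

Lemma det_conj_diag x : \det (conj_diag P x) = \prod_j x 0 j.
Proof.
rewrite /conj_diag !det_mulmx det_diag mulrAC -det_mulmx mulVmx // det1.
by rewrite mul1r.
Qed.

Lemma conj_diag_unit x : (conj_diag P x \in unitmx) = (\prod_j x 0 j != 0).
Proof. by rewrite unitmxE det_conj_diag unitfE. Qed.

Lemma conj_diagV (x : 'rV[K]_N) : (forall j, x 0 j != 0) ->
  invmx (conj_diag P x) = conj_diag P (\row_j (x 0 j)^-1).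
Proof.
move=> x0; have u : conj_diag P x \in unitmx.
  by rewrite conj_diag_unit; apply/prodf_neq0.
apply: (can_inj (mulKmx u)); rewrite mulmxV // conj_diagM -conj_diag1.
by congr conj_diag; apply/rowP => j; rewrite !mxE divff.
Qed.

Lemma conj_diag_comm s mu x : P *m s = diag_mx mu *m P ->
  conj_diag P x *m s = s *m conj_diag P x.
Proof.
move=> /conj_diagP ->; rewrite !conj_diagM; congr conj_diag.
by apply/rowP => j; rewrite !mxE mulrC.
Qed.

Definition cocharacter (a : 'I_N -> int) (z : K) : 'M[K]_N :=
  conj_diag P (\row_j z ^ a j).

Lemma cocharacter1 a : cocharacter a 1 = 1%:M.
Proof.
rewrite /cocharacter (_ : \row_j _ = const_mx 1) ?conj_diag1 //.
by apply/rowP => j; rewrite !mxE exp1rz.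
Qed.

Lemma laurent_cocharacter a i j : laurent (fun z => cocharacter a z i j).
Proof.
have [p [M E]] : laurent (fun z => \sum_(l <- index_enum 'I_N)
    (invmx P i l * z ^ a l) * P l j).
  apply: laurent_sum => l; apply: laurentM (laurent_cst _).
  exact: laurentM (laurent_cst _) (laurent_expz _).
exists p, M => z z0; rewrite -E // /cocharacter /conj_diag mxE; congr (_ * _).
by apply: eq_bigr => l _; rewrite mul_mx_diag !mxE.
Qed.

(** Every t is joined to 1 by a one-parameter subgroup inside A. If t and 1 were in different closed
    pieces, an equation of the piece of t that fails at 1 and an equation of the other piece that
    fails at t would pull back to nonzero Laurent polynomials in z. At a parameter where neither
    vanishes, the point of A would be in neither piece. *)
Lemma zariski_connected_cocharacters (A : set 'M[K]_N) :
  (forall t, A t -> exists (a : 'I_N -> int) (z : K),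
    [/\ z != 0, t = cocharacter a z & forall z', z' != 0 -> A (cocharacter a z')]) ->
  zariski_connected A.
Proof.
move=> coA B1 B2 B1c B2c AB B12.
have same B B' : zariski_closed B -> zariski_closed B' -> A = (B `|` B')%classic ->
    (B `&` B')%classic = set0 -> forall t, B t -> B 1%:M.
  move=> [I BE] [I' B'E] ABB BB' t Bt.
  have At : A t by rewrite ABB; left.
  have [a [z [z0 tE coz]]] := coA t At.
  have A1 : A 1%:M by rewrite -(cocharacter1 a); apply: coz (oner_neq0 _).
  move: (A1); rewrite ABB => -[//|B'1]; exfalso.
  have nB1 : ~ B 1%:M by move=> B1'; suff : (B `&` B')%classic 1%:M by rewrite BB'.
  have nB't : ~ B' t by move=> B't; suff : (B `&` B')%classic t by rewrite BB'.
  have ex g (J : set {mpoly K[N * N]}) (D : set 'M[K]_N) : g \in unitmx ->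
      D = [set g | g \in unitmx /\ forall f, J f -> mx_eval f g = 0]%classic ->
      ~ D g -> exists2 f, J f & mx_eval f g != 0.
    move=> gu -> /= nD; apply: contrapT => h; apply: nD; split => // f Jf.
    by apply/eqP/negPn/negP => fg; apply: h; exists f.
  have tu : t \in unitmx by move: Bt; rewrite BE => -[].
  have [f1 J1 f1n] := ex _ _ _ (unitmx1 _ _) BE nB1.
  have [f2 J2 f2n] := ex _ _ _ tu B'E nB't.
  have [p1 [M1 E1]] := laurent_mx_eval f1 (laurent_cocharacter a).
  have [p2 [M2 E2]] := laurent_mx_eval f2 (laurent_cocharacter a).
  have p10 : p1 != 0.
    apply: contraNneq f1n => p1z; have := E1 1 (oner_neq0 _).
    by rewrite p1z horner0 expr1n mulr1 cocharacter1 => ->.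
  have p20 : p2 != 0.
    apply: contraNneq f2n => p2z; have /eqP := E2 z z0.
    by rewrite p2z horner0 -tE mulf_eq0 expf_eq0 (negPf z0) andbF orbF.
  have [z' z'0] := closed_nonroot_neq0 (mulf_neq0 p10 p20).
  rewrite hornerM mulf_eq0 negb_or => /andP[n1 n2].
  have := coz z' z'0; rewrite ABB => -[]; rewrite ?BE ?B'E => -[_ h].
    by move/eqP: n1; apply; rewrite -E1 // h // mul0r.
  by move/eqP: n2; apply; rewrite -E2 // h // mul0r.
have [->|/set0P[t1 B1t]] := eqVneq B1 set0; first by left.
have [->|/set0P[t2 B2t]] := eqVneq B2 set0; first by right.
exfalso; suff : (B1 `&` B2)%classic 1%:M by rewrite B12.
split; first exact: (same _ _ B1c B2c AB B12 _ B1t).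
by apply: (same _ _ B2c B1c _ _ _ B2t); rewrite 1?setUC 1?setIC.
Qed.

Lemma diag_torus_neq0 (x : 'rV[K]_N) j : \prod_j x 0 j = 1 -> x 0 j != 0 :> K.
Proof.
by move=> x1; have /prodf_neq0/(_ j isT) : \prod_j x 0 j != 0 by rewrite x1 oner_neq0.
Qed.

Lemma polyfun_coordinate j : polyfun (fun t => coordinate P t j).
Proof. exact: polyfun_conj. Qed.

(** Dedekind's independence of characters, by induction on the number of monomials. If [psi] differs
    from the first monomial at some u, translating the relation by u and subtracting [psi u] times
    the relation eliminates that monomial. *)
Lemma dedekind_monomial (psi : 'rV[K]_N -> K) (s : seq 'X_{1..N}) (c : 'X_{1..N} -> K) :
  (forall x : 'rV[K]_N, \prod_j x 0 j = 1 -> psi x != 0) ->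
  (forall x y : 'rV[K]_N, \prod_j x 0 j = 1 -> \prod_j y 0 j = 1 ->
     psi (\row_j (x 0 j * y 0 j)) = psi x * psi y) ->
  (forall x : 'rV[K]_N, \prod_j x 0 j = 1 ->
     psi x = \sum_(m <- s) c m * \prod_j x 0 j ^+ m j) ->
  exists m : 'X_{1..N}, forall x : 'rV[K]_N, \prod_j x 0 j = 1 -> psi x = \prod_j x 0 j ^+ m j.
Proof.
move=> psi0 psiM; elim: s c => [|m0 s IH] c psiE.
  have one1 : \prod_(j < N) (const_mx 1 : 'rV[K]_N) 0 j = 1.
    by apply: big1 => j _; rewrite mxE.
  by have := psi0 _ one1; rewrite psiE // big_nil eqxx.
have [[u [u1 um]]|h] := pselect (exists u : 'rV[K]_N, \prod_j u 0 j = 1 /\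
    \prod_j u 0 j ^+ m0 j != psi u); last first.
  exists m0 => x x1; apply/eqP; rewrite eq_sym.
  by apply/negPn/negP => xm; apply: h; exists x.
pose mono (m : 'X_{1..N}) (x : 'rV[K]_N) := \prod_j x 0 j ^+ m j.
pose e := mono m0 u - psi u.
have e0 : e != 0 by rewrite subr_eq0.
apply: (IH (fun m => c m - c m * (mono m u - psi u) / e)) => x x1.
have monoM m : mono m (\row_j (u 0 j * x 0 j)) = mono m u * mono m x.
  by rewrite /mono -big_split; apply: eq_bigr => j _; rewrite mxE exprMn.
have ux1 : \prod_j (\row_j (u 0 j * x 0 j)) 0 j = 1.
  by under eq_bigr do rewrite mxE; rewrite big_split /= u1 x1 mulr1.
have rel : \sum_(m <- m0 :: s) c m * (mono m u - psi u) * mono m x = 0.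
  under eq_bigr do rewrite mulrBr mulrBl.
  rewrite sumrB; apply/eqP; rewrite subr_eq0; apply/eqP.
  transitivity (psi u * psi x).
    rewrite -psiM // psiE //; apply: eq_bigr => m _; rewrite -/(mono _ _) monoM.
    by rewrite mulrA.
  by rewrite (psiE x x1) mulr_sumr; apply: eq_bigr => m _; rewrite mulrCA mulrA.
move: rel; rewrite big_cons => /eqP; rewrite addr_eq0 => /eqP rel.
rewrite psiE // big_cons.
have -> : c m0 * \prod_j x 0 j ^+ m0 j =
    - (\sum_(m <- s) c m * (mono m u - psi u) * mono m x) / e.
  by rewrite -rel -/(mono m0 x) -/e mulrAC mulfK.
rewrite mulNr mulr_suml -sumrN -big_split; apply: eq_bigr => m _ /=.
by rewrite -/(mono m x) mulrBl addrC mulrAC.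
Qed.

(** The determinant is 1 on the torus, so the denominator in [character] disappears and [psi] is a
    combination of monomials in the coordinates. *)
Lemma character_monomial psi : character (diag_torus P) psi ->
  exists a : 'I_N -> int, forall x : 'rV[K]_N, \prod_j x 0 j = 1 ->
    psi (conj_diag P x) = \prod_j x 0 j ^ a j.
Proof.
move=> [psi0 psiM [f [n psiE]]].
have inT (x : 'rV[K]_N) : \prod_j x 0 j = 1 -> diag_torus P (conj_diag P x) by exists x.
have ex i : exists G : {mpoly K[N]}, forall x : 'rV[K]_N,
    G.@[fun j => x 0 j] = mxvec (conj_diag P x) 0 i.
  have [a b] := mxvec_indexP i.
  exists (\sum_l (invmx P a l * P l b) *: 'X_l) => x.
  rewrite mxvecE /conj_diag raddf_sum mxE; apply: eq_bigr => l _ /=.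
  by rewrite mevalZ mevalXU mul_mx_diag mxE mulrAC.
have [G GE] := choice ex.
pose F := f \mPo [tuple G i | i < N * N].
have FE (x : 'rV[K]_N) : F.@[fun j => x 0 j] = mx_eval f (conj_diag P x).
  rewrite /F comp_mpoly_meval; apply: meval_eq => i.
  by rewrite tnth_mktuple GE.
have [|||m mE] := @dedekind_monomial (fun x => psi (conj_diag P x)) (msupp F) (fun m => F@_m).
- by move=> x x1; apply: psi0; apply: inT.
- by move=> x y x1 y1; rewrite -psiM ?conj_diagM //; apply: inT.
- move=> x x1; rewrite psiE; last exact: inT.
  by rewrite det_conj_diag x1 expr1n divr1 -FE mevalE.
by exists (fun j => (m j)%:Z).
Qed.

Lemma monomial_character (a : 'I_N -> int) :
  character (diag_torus P) (fun t => \prod_j coordinate P t j ^ a j).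
Proof.
split=> [t [x x1 ->]|t t' [x x1 ->] [y y1 ->]|].
- by apply: prod_expz_neq0 => j; rewrite coordinate_conj_diag diag_torus_neq0.
- rewrite conj_diagM -big_split; apply: eq_bigr => j _ /=.
  by rewrite !coordinate_conj_diag mxE expfzMl.
(* Negative exponents disappear after multiplication by the M-th power of the product of the
   coordinates, which is 1; this M is large enough for every [a j + M] to be nonnegative. *)
pose M : nat := \sum_j `|a j|%N.
have aM j : exists n : nat, a j + M%:Z = n%:Z.
  have le : (`|a j|%N <= M)%N by rewrite /M (bigD1 j) //= leq_addr.
  exists `|(a j + M%:Z)%R|%N; lia.
have [b bE] := choice aM.
have [f fE] : polyfun (fun t => \prod_j coordinate P t j ^+ b j).
  by apply: polyfun_prod => j; apply: polyfunX; exact: polyfun_coordinate.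
exists f, 0%N => t [x x1 ->]; rewrite expr0 divr1 fE.
have powE j : x 0 j ^+ b j = x 0 j ^ a j * x 0 j ^ M%:Z.
  by rewrite -expfzDr ?diag_torus_neq0 // bE.
under [RHS]eq_bigr do rewrite coordinate_conj_diag powE.
rewrite big_split /= [X in _ * X](_ : _ = 1) ?mulr1.
  by under eq_bigr do rewrite coordinate_conj_diag.
by rewrite -prodf_expz x1 exp1rz.
Qed.

Lemma monomial_eq (a b : 'I_N -> int) :
  (forall x : 'rV[K]_N, \prod_j x 0 j = 1 ->
     \prod_j x 0 j ^ a j = \prod_j x 0 j ^ b j) ->
  forall i j, a i - b i = a j - b j.
Proof.
move=> h i j; apply/eqP/negPn/negP => ne.
have ij : i != j by apply: contraNneq ne => ->.
have ne' : a i - b i - (a j - b j) != 0 by rewrite subr_eq0.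
have [z z0 zne] := exists_expz_neq1 K ne'.
(* A point of the torus with coordinates z at i, its inverse at j and 1 elsewhere: it only sees the
   difference of the exponents at i and j. *)
pose x : 'rV[K]_N := \row_l (if l == i then z else if l == j then z^-1 else 1).
have xE (c : 'I_N -> int) : \prod_l x 0 l ^ c l = z ^ (c i - c j).
  rewrite (bigD1 i) //= (bigD1 j) /=; last by rewrite eq_sym.
  rewrite big1 => [|l /andP[/negPf li /negPf lj]]; last by rewrite mxE li lj exp1rz.
  rewrite !mxE !eqxx eq_sym (negPf ij) mulr1 expfzDr //.
  by rewrite exprz_inv.
have x1 : \prod_l x 0 l = 1.
  by under eq_bigr do rewrite -[x 0 _]expr1z; rewrite (xE (fun=> 1)) subrr expr0z.
have := h x x1; rewrite !xE => e; case/eqP: zne.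
rewrite (_ : a i - b i - (a j - b j) = (a i - a j) - (b i - b j)).
  by rewrite expfzDr // e -expfzDr // subrr expr0z.
by rewrite !opprB addrACA [- b i - _]addrC addrACA; congr (_ + _); rewrite addrC.
Qed.

End Basis.
End PolynomialFunctions.

(** * Weyl group and Frobenius of a torus diagonal in a frame permuted by the Frobenius *)

Section TorusCharacters.

Variables (k : finFieldType) (K : closedFieldType) (iota : {rmorphism k -> K}).
Hypothesis K_alg : integralRange iota.
Variable n : nat.
Local Notation N := n.+1.
Local Notation Fr := (frob iota).
Variables (P s : 'M[K]_N) (mu : 'rV[K]_N) (sg : 'S_N).
Hypothesis Pu : P \in unitmx.
Hypothesis Ps : P *m s = diag_mx mu *m P.
(** The Frobenius sends the row j of P to its row [sg j]. *)
Hypothesis PF : map_mx Fr P = perm_mx sg *m P.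
Hypothesis sF : map_mx Fr s = s.

Local Notation T := (diag_torus P).
Local Notation H := (centralizer (@SLbar K N) [set s]%classic : set 'M[K]_N).

Lemma frob_surj (y : K) : exists x, Fr x = y.
Proof.
have [m m0 mP] := frob_periodic K_alg y.
by exists (iter m.-1 Fr y); rewrite -iterS prednK.
Qed.

Lemma frob_mu j : mu 0 (sg j) = Fr (mu 0 j).
Proof.
have h : perm_mx sg *m P *m s = diag_mx (map_mx Fr mu) *m (perm_mx sg *m P).
  by rewrite -PF -{1}sF -map_mxM Ps map_mxM map_diag_mx.
have : perm_mx sg *m diag_mx mu = diag_mx (map_mx Fr mu) *m perm_mx sg.
  by apply: (can_inj (mulmxK Pu)); rewrite -mulmxA -Ps !mulmxA h mulmxA.
move=> /matrixP/(_ j (sg j)); rewrite mul_mx_diag mul_diag_mx !mxE eqxx mul1r mulr1.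
by [].
Qed.

Lemma frob_conj_diag x :
  map_mx Fr (conj_diag P x) = conj_diag P (\row_j Fr (x 0 (sg^-1 j)%g)).
Proof.
apply: (conj_diagP Pu); set y := \row_j _.
have Py : perm_mx sg *m diag_mx y = diag_mx (map_mx Fr x) *m perm_mx sg.
  by apply: perm_mx_diag => j; rewrite !mxE permK.
apply: (can_inj (mulKmx (unitmx_perm _ sg))).
rewrite mulmxA -PF -map_mxM conj_diagK // map_mxM map_diag_mx PF.
by rewrite !mulmxA Py.
Qed.

Lemma character_ext psi psi' : (forall t, T t -> psi t = psi' t) ->
  character T psi -> character T psi'.
Proof.
move=> e [p0 pM [f [j pE]]]; split.
- by move=> t Tt; rewrite -e // p0.
- move=> t t' Tt Tt'; rewrite -!e // ?pM //.
  case: Tt Tt' => [x x1 ->] [y y1 ->]; rewrite conj_diagM //.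
  exists (\row_l (x 0 l * y 0 l)) => //.
  by under eq_bigr do rewrite mxE; rewrite big_split /= x1 y1 mulr1.
by exists f, j => t Tt; rewrite -e // pE.
Qed.

Section WithBasis.

Variables (r : nat) (chi : 'I_r -> 'M[K]_N -> K).
Hypothesis chiB : character_basis T chi.

Lemma basis_exponents : exists u : 'M[int]_(r, N),
  forall i (x : 'rV[K]_N), \prod_j x 0 j = 1 ->
    chi i (conj_diag P x) = \prod_j x 0 j ^ u i j.
Proof.
have [u uE] := choice (fun i => character_monomial Pu (proj1 chiB i)).
exists (\matrix_(i, j) u i j) => i x x1; rewrite uE //.
by apply: eq_bigr => j _; rewrite mxE.
Qed.

Lemma basis_neq0 i (x : 'rV[K]_N) : \prod_j x 0 j = 1 -> chi i (conj_diag P x) != 0.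
Proof. by move=> x1; have [h _ _] := proj1 chiB i; apply: h; exists x. Qed.

Lemma basis_exp_unique (a b : 'rV[int]_r) :
  (forall x : 'rV[K]_N, \prod_j x 0 j = 1 ->
     \prod_i chi i (conj_diag P x) ^ a 0 i = \prod_i chi i (conj_diag P x) ^ b 0 i) ->
  a = b.
Proof.
move=> ab; have [u uE] := basis_exponents.
pose psi t := \prod_i chi i t ^ a 0 i.
have psiC : character T psi.
  apply: character_ext (monomial_character Pu (fun j => \sum_i a 0 i * u i j)).
  move=> t [x x1 ->]; rewrite /psi.
  under [RHS]eq_bigr do rewrite uE //.
  rewrite prod_expz_comp => [|j]; last exact: diag_torus_neq0.
  by apply: eq_bigr => j _; rewrite coordinate_conj_diag.
have [c [_ cU]] := proj2 chiB psi psiC.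
by rewrite -(cU a) // -(cU b) // => t [x x1 ->]; rewrite /psi ab.
Qed.

Lemma basis_coordinates : exists v : 'M[int]_(N, r),
  forall j (x : 'rV[K]_N), \prod_j x 0 j = 1 ->
    x 0 j = \prod_i chi i (conj_diag P x) ^ v j i.
Proof.
have ex (j : 'I_N) : exists a : 'rV[int]_r, forall t, T t ->
    coordinate P t j = \prod_i chi i t ^ a 0 i.
  have h : character T (fun t => coordinate P t j).
    apply: character_ext (monomial_character Pu (fun l => (j == l)%:R)) => t _.
    exact: prod_expz_delta.
  by have [a [aE _]] := proj2 chiB _ h; exists a.
have [v vE] := choice ex; exists (\matrix_(j, i) v j 0 i) => j x x1.
rewrite -{1}(coordinate_conj_diag Pu x j) vE; last by exists x.
by apply: eq_bigr => i _; rewrite mxE.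
Qed.

Variables (u : 'M[int]_(r, N)) (v : 'M[int]_(N, r)).
Hypothesis uE : forall i (x : 'rV[K]_N), \prod_j x 0 j = 1 ->
  chi i (conj_diag P x) = \prod_j x 0 j ^ u i j.
Hypothesis vE : forall j (x : 'rV[K]_N), \prod_j x 0 j = 1 ->
  x 0 j = \prod_i chi i (conj_diag P x) ^ v j i.

Lemma basis_uv : u *m v = 1%:M.
Proof.
apply/row_matrixP => i; apply: basis_exp_unique => x x1.
transitivity (chi i (conj_diag P x)); last first.
  rewrite -[LHS](prod_expz_delta (fun i => chi i (conj_diag P x))).
  by apply: eq_bigr => l _; rewrite !mxE.
rewrite uE //.
under [RHS]eq_bigr => j _ do rewrite (vE j x1).
rewrite prod_expz_comp => [|l]; last exact: basis_neq0.
by apply: eq_bigr => l _; rewrite !mxE.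
Qed.

Lemma basis_v_sum i : \sum_j v j i = 0.
Proof.
suff : \row_i \sum_j v j i = 0 by move=> /rowP/(_ i); rewrite !mxE.
apply: basis_exp_unique => x x1.
rewrite [RHS]big1 => [|l _]; last by rewrite mxE expr0z.
rewrite -[RHS]x1.
transitivity (\prod_j (\prod_l chi l (conj_diag P x) ^ v j l) ^ (1 : int)); last first.
  by apply: eq_bigr => j _; rewrite expr1z -(vE j x1).
rewrite prod_expz_comp => [|l]; last exact: basis_neq0.
by apply: eq_bigr => l _; rewrite !mxE; congr (_ ^ _); apply: eq_bigr => j _; rewrite mul1r.
Qed.

Lemma basis_vu j l : (v *m u) j l = (j == l)%:R + ((v *m u) j j - 1).
Proof.
have h := @monomial_eq K N (fun l => (v *m u) j l) (fun l => (j == l)%:R) _ l j.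
have := h; rewrite eqxx => {}h.
apply/eqP; rewrite addrC -subr_eq; apply/eqP; apply: h => x x1.
rewrite prod_expz_delta [RHS](vE j x1).
under [RHS]eq_bigr => i _ do rewrite (uE i x1).
rewrite prod_expz_comp => [|i]; last exact: diag_torus_neq0.
by apply: eq_bigr => i _; rewrite mxE.
Qed.

Lemma chi_perm (p : 'S_N) i (x : 'rV[K]_N) : \prod_j x 0 j = 1 ->
  chi i (conj_diag P (\row_j x 0 (p j))) =
  \prod_l chi l (conj_diag P x) ^ (perm_matrix_action u v p) i l.
Proof.
move=> x1; rewrite uE; last first.
  by under eq_bigr do rewrite mxE; rewrite -[RHS]x1 [RHS](reindex_inj (@perm_inj _ p)).
under eq_bigr => j _ do rewrite mxE (vE (p j) x1).
rewrite prod_expz_comp => [|l]; last exact: basis_neq0.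
apply: eq_bigr => l _; congr (_ ^ _); rewrite /perm_matrix_action -mulmxA mxE.
by apply: eq_bigr => j _; rewrite -row_permE mxE.
Qed.

Lemma frobenius_matrix_perm : frobenius_matrix k T chi (perm_matrix_action u v sg).
Proof.
move=> i t [x x1 ->]; rewrite -[frobenius_mx _ _]/(map_mx Fr _) frob_conj_diag.
set y := \row_j _; have y1 : \prod_j y 0 j = 1.
  rewrite (reindex_inj (@perm_inj _ sg)) /=.
  under eq_bigr do rewrite mxE permK.
  by rewrite -rmorph_prod x1 rmorph1.
rewrite -chi_perm // !uE //; last first.
  by under eq_bigr do rewrite mxE; rewrite -[RHS]y1 [RHS](reindex_inj (@perm_inj _ sg)).
rewrite -prodrXl; apply: eq_bigr => j _; rewrite !mxE permK /frob.
by rewrite !exprnP !exprz_exp mulrC.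
Qed.

(** The Frobenius is surjective on the torus since K is algebraic over k, so the equations in
    [frobenius_matrix] prescribe the characters at all points. *)
Lemma frobenius_matrix_unique M : frobenius_matrix k T chi M -> M = perm_matrix_action u v sg.
Proof.
move=> hM; apply/row_matrixP => i; apply: basis_exp_unique => y y1.
have [x0 x0E] := choice (fun j => frob_surj (y 0 (sg j))).
pose x : 'rV[K]_N := \row_j x0 j.
have x1 : \prod_j x 0 j = 1.
  apply: (@frob_inj _ _ iota); rewrite rmorph1 rmorph_prod -[RHS]y1.
  rewrite [RHS](reindex_inj (@perm_inj _ sg)) /=.
  by apply: eq_bigr => j _; rewrite mxE x0E.
have Tx : T (conj_diag P x) by exists x.
have yE : frobenius_mx k (conj_diag P x) = conj_diag P y.
  rewrite -[frobenius_mx _ _]/(map_mx Fr _) frob_conj_diag; congr conj_diag.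
  by apply/rowP => j; rewrite !mxE x0E permKV.
have := hM i _ Tx; rewrite (frobenius_matrix_perm i Tx) yE => e.
under eq_bigr do rewrite mxE; rewrite -e.
by apply: eq_bigr => l _; rewrite [in RHS]mxE.
Qed.

(** Written in the frame, w is an invertible matrix [m], which has a permutation p in its support.
    As [m] commutes with diag(mu) and intertwines the diagonal matrices of t and of its conjugate,
    each nonzero entry equates two of their entries. *)
Lemma normalizer_perm (w : 'M[K]_N) : normalizer H T w ->
  exists p : 'S_N, (forall i, mu 0 (p i) = mu 0 i) /\
    forall x : 'rV[K]_N, \prod_j x 0 j = 1 ->
      invmx w *m conj_diag P x *m w = conj_diag P (\row_j x 0 (p^-1 j)%g).
Proof.
move=> [[w1 ws0] wT]; have ws : w *m s = s *m w := ws0 s erefl.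
have {}w1 : \det w = 1 := w1; pose m := P *m w *m invmx P.
have wu : w \in unitmx by rewrite unitmxE w1 unitr1.
have mP : m *m P = P *m w by rewrite /m mulmxKV.
have md : \det m != 0.
  by rewrite /m !det_mulmx w1 mulr1 -det_mulmx mulmxV // det1 oner_neq0.
clearbody m.
have [p mp] : exists p : 'S_N, forall i, m i (p i) != 0.
  by apply: unitmx_perm_neq0; rewrite unitmxE unitfE.
exists p; split.
  have e : m *m diag_mx mu = diag_mx mu *m m.
    apply: (can_inj (mulmxK Pu)); rewrite -mulmxA -Ps mulmxA mP -mulmxA.
    by rewrite ws (mulmxA P s w) Ps -(mulmxA _ P w) -mP mulmxA.
  by move=> i; apply: (diag_mx_intertwine e (mp i)).
move=> x x1; have Tx : T (conj_diag P x) by exists x.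
have [y y1 yE] := proj1 (wT _) Tx; rewrite yE; congr conj_diag.
have e : diag_mx x *m m = m *m diag_mx y.
  have tw : conj_diag P x *m w = w *m conj_diag P y by rewrite -yE -mulmxA mulKVmx.
  apply: (can_inj (mulmxK Pu)); rewrite -(mulmxA _ m P) mP mulmxA -conj_diagK //.
  by rewrite -(mulmxA P) tw (mulmxA P) -mP -(mulmxA m P) conj_diagK // mulmxA.
apply/rowP => j; rewrite mxE; have := mp (p^-1 j)%g; rewrite permKV.
exact: (diag_mx_intertwine (esym e)).
Qed.

Lemma perm_normalizer (p : 'S_N) : (forall i, mu 0 (p i) = mu 0 i) ->
  exists2 w : 'M[K]_N, normalizer H T w &
    forall x : 'rV[K]_N, invmx w *m conj_diag P x *m w = conj_diag P (\row_j x 0 (p^-1 j)%g).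
Proof.
(* The sign of p, put on a single row, gives the monomial matrix determinant 1. *)
move=> pmu; pose ep : 'rV[K]_N := \row_j (if j == ord0 then (-1) ^+ p else 1).
have epn j : ep 0 j != 0 by rewrite mxE; case: ifP; rewrite ?signr_eq0 ?oner_neq0.
have epu : diag_mx ep \in unitmx.
  by rewrite unitmxE det_diag unitfE; apply/prodf_neq0.
pose m := diag_mx ep *m perm_mx p; pose w := invmx P *m m *m P.
have mu_ : m \in unitmx by rewrite unitmx_mul epu unitmx_perm.
have wu : w \in unitmx by rewrite 2!unitmx_mul unitmx_inv Pu mu_.
have Pw : P *m w = m *m P by rewrite /w !mulmxA mulmxV // mul1mx.
have me x : diag_mx x *m m = m *m diag_mx (\row_j x 0 (p^-1 j)%g).
  rewrite /m mulmxA; apply/matrixP => i j.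
  rewrite mul_mx_diag mxE; rewrite [in LHS](_ : diag_mx x *m diag_mx ep = diag_mx (\row_l (x 0 l * ep 0 l))).
    rewrite -[in LHS]/((diag_mx _ *m perm_mx p) i j) !mul_diag_mx !mxE.
    by case: (p i =P j) => [<-|]; rewrite ?permK ?mulr1 ?mulr0 ?mul0r // mulrC.
  by rewrite mulmx_diag.
have wconj x : invmx w *m conj_diag P x *m w = conj_diag P (\row_j x 0 (p^-1 j)%g).
  apply: (can_inj (mulKmx wu)); rewrite -mulmxA mulKVmx //.
  apply: (can_inj (mulKmx Pu)).
  rewrite (mulmxA P (conj_diag P x)) conj_diagK // -(mulmxA _ P w) Pw.
  by rewrite (mulmxA P w) Pw -(mulmxA m P) conj_diagK // !(mulmxA _ _ P) me.
exists w => //; split; first split.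
- have dm : \det m = 1.
    rewrite /m det_mulmx det_diag det_perm (bigD1 ord0) //= mxE eqxx big1 ?mulr1.
      by rewrite -signr_addb addbb.
    by move=> j /negPf jn; rewrite mxE jn.
  change (\det w = 1); rewrite /w det_mulmx det_mulmx dm mulr1.
  by rewrite -det_mulmx mulVmx // det1.
- move=> _ ->; apply: (can_inj (mulKmx Pu)).
  rewrite (mulmxA P w s) Pw -(mulmxA m P s) Ps (mulmxA P s w) Ps -(mulmxA _ P w) Pw.
  rewrite !(mulmxA _ _ P); congr (_ *m _).
  rewrite me; congr (_ *m diag_mx _); apply/rowP => j; rewrite mxE.
  by rewrite -(pmu (p^-1 j)%g) permKV.
move=> t; split=> [[x x1 ->]|[x x1 xE]].
  rewrite wconj; exists (\row_j x 0 (p^-1 j)%g) => //.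
  by under eq_bigr do rewrite mxE; rewrite -[RHS]x1 [RHS](reindex_inj (@perm_inj _ p^-1%g)).
exists (\row_j x 0 (p j)).
  by under eq_bigr do rewrite mxE; rewrite -[RHS]x1 [RHS](reindex_inj (@perm_inj _ p)).
have : invmx w *m t *m w = invmx w *m conj_diag P (\row_j x 0 (p j)) *m w.
  by rewrite xE wconj; congr conj_diag; apply/rowP => j; rewrite !mxE permKV.
move/(can_inj (mulmxK wu)); apply: can_inj; apply: mulKmx.
by rewrite unitmx_inv.
Qed.

Lemma weyl_invariants_perm f : weyl_invariants H T chi f <->
  forall p, label_preserving (fun j => mu 0 j) p -> sym_act (perm_matrix_action u v p) f = f.
Proof.
split=> [fW p /label_preservingP pmu|fp w M wN wM].
  have pmu' i : mu 0 ((p^-1)%g i) = mu 0 i by rewrite -pmu permKV.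
  have [w wN wconj] := perm_normalizer pmu'.
  apply: fW wN _ => i t [x x1 ->]; rewrite wconj.
  rewrite -chi_perm //; congr (chi _ (conj_diag _ _)).
  by apply/rowP => j; rewrite !mxE invgK.
have [p [pmu wconj]] := normalizer_perm wN.
rewrite (_ : M = perm_matrix_action u v p^-1%g).
  by apply/fp/label_preservingV/label_preservingP.
apply/row_matrixP => i; apply: basis_exp_unique => x x1.
have Tx : T (conj_diag P x) by exists x.
transitivity (chi i (conj_diag P (\row_j x 0 (p^-1%g j)))).
  rewrite -wconj // (wM i _ Tx).
  by apply: eq_bigr => l _; rewrite mxE.
by rewrite chi_perm //; apply: eq_bigr => l _; rewrite [in RHS]mxE.
Qed.

End WithBasis.

(** The relation x_1 ... x_N = 1 makes the exponent of the last coordinate 0, and the other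
    exponents are then unique by [monomial_eq]. *)
Lemma character_basis_exists :
  character_basis T (fun (i : 'I_n) t => coordinate P t (lift ord_max i)).
Proof.
split=> [i|psi psiC].
  apply: character_ext (monomial_character Pu (fun l => (lift ord_max i == l)%:R)) => t _.
  exact: prod_expz_delta.
have prodE (F : 'I_N -> K) : \prod_j F j = (\prod_i F (lift ord_max i)) * F ord_max.
  rewrite big_ord_recr /=; congr (_ * _); apply: eq_bigr => i _; congr F.
  by apply: val_inj; rewrite /= /bump leqNgt ltn_ord.
pose ext (b : 'rV[int]_n) (j : 'I_N) : int := if unlift ord_max j is Some i then b 0 i else 0.
have extE (b : 'rV[int]_n) (x : 'rV[K]_N) :
    \prod_j x 0 j ^ ext b j = \prod_i x 0 (lift ord_max i) ^ b 0 i.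
  rewrite prodE /ext unlift_none expr0z mulr1.
  by apply: eq_bigr => i _; rewrite liftK.
have [a aE] := character_monomial Pu psiC.
have main (x : 'rV[K]_N) : \prod_j x 0 j = 1 -> psi (conj_diag P x) =
    \prod_i x 0 (lift ord_max i) ^ (\row_i (a (lift ord_max i) - a ord_max)) 0 i.
  move=> x1; rewrite aE // -[LHS]mulr1.
  have x1' : \prod_j x 0 j ^ (- a ord_max) = 1 by rewrite -prodf_expz x1 exp1rz.
  rewrite -[X in _ * X = _]x1' -big_split prodE /= -expfzDr ?diag_torus_neq0 // subrr expr0z mulr1.
  by apply: eq_bigr => i _; rewrite mxE -expfzDr ?diag_torus_neq0.
exists (\row_i (a (lift ord_max i) - a ord_max)); split.
  move=> t [x x1 ->]; rewrite main //.
  by apply: eq_bigr => i _; rewrite coordinate_conj_diag.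
move=> b bE; apply/rowP => i.
have := @monomial_eq K N (ext (\row_i (a (lift ord_max i) - a ord_max))) (ext b) _
  (lift ord_max i) ord_max.
rewrite /ext liftK unlift_none subrr => h; apply/eqP; rewrite -subr_eq0; apply/eqP.
apply: h => x x1; rewrite -!/(ext _ _) !extE -main // bE; last by exists x.
by apply: eq_bigr => l _; rewrite coordinate_conj_diag.
Qed.

End TorusCharacters.

(** * Maximal split tori of centralizers *)

Lemma iter_perm_eq (T : finType) (s : {perm T}) (x : T) (a b : nat) :
  (iter a s x == iter b s x) = (a == b %[mod #|porbit s x|]).
Proof.
set d := #|porbit s x|; have d0 : (0 < d)%N.
  by apply/card_gt0P; exists x; rewrite porbit_id.
have per c : iter (c * d) s x = x.
  by elim: c => // c IH; rewrite mulSn addnC iterD iter_porbit.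
have modE c : iter c s x = iter (c %% d) s x.
  by rewrite {1}(divn_eq c d) addnC iterD per.
rewrite (modE a) (modE b).
have nthE c : (c < d)%N -> iter c s x = nth x (traject s x d) c.
  by move=> cd; rewrite nth_traject.
by rewrite !nthE ?ltn_pmod // nth_uniq ?size_traject ?ltn_pmod // uniq_traject_porbit.
Qed.

Lemma porbit_iter (T : finType) (s : {perm T}) (x y : T) :
  porbit s x = porbit s y -> exists m, y = iter m s x.
Proof.
move=> e; have : y \in porbit s x by rewrite e porbit_id.
by move=> /porbitP[m ->]; exists m; rewrite permX.
Qed.

Lemma porbit_iterE (T : finType) (s : {perm T}) (m : nat) (x : T) :
  porbit s (iter m s x) = porbit s x.
Proof. by rewrite -permX; apply/eqP; rewrite eq_porbit_mem mem_porbit. Qed.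

Lemma perm_invariant_porbit (T : finType) (Y : Type) (s : {perm T}) (f : T -> Y) x y :
  (forall z, f (s z) = f z) -> porbit s x = porbit s y -> f x = f y.
Proof. by move=> fs /porbit_iter[m ->]; elim: m => //= m ->. Qed.

Lemma big_bezout (n : nat) (f : 'I_n -> nat) :
  exists e : 'I_n -> int, \sum_i e i * (f i)%:Z = (\big[gcdn/0%N]_i f i)%:Z.
Proof.
elim: n f => [|n IH] f; first by exists (fun=> 0); rewrite !big_ord0.
have [e eE] := IH (fun i => f (lift ord0 i)).
have [a [b ab]] := Bezoutz (f ord0) (\big[gcdn/0%N]_(i < n) f (lift ord0 i))%:Z.
exists (fun i => if unlift ord0 i is Some j then b * e j else a).
rewrite !big_ord_recl unlift_none /=; under eq_bigr do rewrite liftK -mulrA.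
by rewrite -mulr_sumr eE ab.
Qed.

Section SplitTori.

Variables (k : finFieldType) (K : closedFieldType) (iota : {rmorphism k -> K}).
Hypothesis K_alg : integralRange iota.
Variable n : nat.
Local Notation N := n.+1.
Local Notation Fr := (frob iota).
Local Notation Q := #|k|.

(** A primitive root of unity w of order Q^d - 1 works: its degree e divides d, and Q^d - 1 divides
    Q^e - 1, so d <= e. *)
Lemma exists_degree d : (0 < d)%N -> exists w : K, is_degree iota w d.
Proof.
move=> d0; pose M := (Q ^ d).-1.
have [w wp] := exists_prim_root (card_ext_pred_neq0 iota d0); exists w.
have w0 : w != 0 := prim_root_neq0 (card_ext_pred_gt0 k d0) wp.
have perE j : (0 < j)%N -> (iter j Fr w == w) = (M %| (Q ^ j).-1)%N.
  by move=> j0; rewrite frob_period_exp // (prim_order_dvd wp).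
have [e0 eP] := frob_degreeP K_alg w; set e := frob_degree iota w in e0 eP.
have ed : (e %| d)%N by rewrite -eP perE.
have de : (d <= e)%N.
  have : (M %| (Q ^ e).-1)%N by rewrite -perE // eP.
  move=> /dvdn_leq -/(_ (card_ext_pred_gt0 k e0)); rewrite /M -ltnS !prednK ?expn_gt0 ?card_field_gt0 //.
  by rewrite leq_exp2l // card_field_gt1.
have -> : d = e by apply/eqP; rewrite eqn_leq de dvdn_leq.
by split.
Qed.

(* Vandermonde matrices along the orbits, for a generator of the extension of
   degree the size of the orbit. *)
Lemma vandermonde_perm (sg : 'S_N) : exists V : 'M[K]_N,
  [/\ V \in unitmx, map_mx Fr V = perm_mx sg *m V
    & forall i j, V i j != 0 -> porbit sg i = porbit sg j].
Proof.
have [w wE] : exists w : nat -> K, forall d, (0 < d)%N -> is_degree iota (w d) d.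
  have ex d : exists w : K, (0 < d)%N -> is_degree iota w d.
    have [->|d0] := posnP d; first by exists 0.
    by have [w wd] := exists_degree d0; exists w.
  by have [w wE] := choice ex; exists w.
(* [rt i] is a point chosen in the orbit of i, and [ind i] a number of steps from it to i,
   meaningful modulo the size [d i] of the orbit. *)
pose rt i : 'I_N := odflt ord0 [pick l in porbit sg i].
have rtE i j : porbit sg i = porbit sg j -> rt i = rt j by rewrite /rt => ->.
have rtP i : porbit sg (rt i) = porbit sg i.
  rewrite /rt; case: pickP => [l|/(_ i)]; last by rewrite porbit_id.
  by rewrite -eq_porbit_mem => /eqP.
have [ind indE] := choice (fun i => porbit_iter (rtP i)).
pose d i := #|porbit sg i|.
have d0 i : (0 < d i)%N by apply/card_gt0P; exists i; rewrite porbit_id.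
have indEq i j : porbit sg i = porbit sg j -> (ind i == ind j %[mod d i]) = (i == j).
  move=> e; rewrite [in RHS](indE i) [in RHS](indE j) -(rtE _ _ e) iter_perm_eq.
  by rewrite rtP.
pose y i := iter (ind i) Fr (w (d i)).
pose V : 'M[K]_N := \matrix_(i, j)
  if porbit sg i == porbit sg j then y i ^+ (ind j %% d i) else 0.
exists V; split; last first.
- by move=> i j; rewrite mxE; case: (porbit sg i =P porbit sg j) => // _; rewrite eqxx.
- apply/matrixP => i j; rewrite -row_permE !mxE.
  have e1 : porbit sg (sg i) = porbit sg i by apply: (porbit_iterE sg 1).
  rewrite e1 /d e1 -/(d i); case: eqP => e; last exact: rmorph0.
  rewrite rmorphXn; congr (_ ^+ _); rewrite /y /d e1 -/(d i) -iterS.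
  apply/eqP; rewrite (iter_frob_eq _ _ (wE _ (d0 i))).
  have := iter_perm_eq sg (rt i) (ind i).+1 (ind (sg i)).
  rewrite rtP -/(d i) => <-; by rewrite iterS -indE -(rtE _ _ e1) -indE eqxx.
(* A relation between the columns gives on each orbit a polynomial of degree less than the size of
   the orbit that vanishes at the distinct conjugates [y i]. *)
rewrite -unitmx_tr -row_free_unit; apply: inj_row_free => c cV.
apply/rowP => j0; rewrite [RHS]mxE.
pose O := porbit sg j0.
have mO j : (j \in O) = (porbit sg j == porbit sg j0) by rewrite eq_porbit_mem.
pose p : {poly K} := \sum_(j in O) c 0 j *: 'X^(ind j %% d j0).
have dO j : j \in O -> d j = d j0 by rewrite mO /d => /eqP ->.
have p_root i : i \in O -> p.[y i] = 0.
  move=> iO; have := congr1 (fun r : 'rV_N => r 0 i) cV; rewrite !mxE => <-.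
  rewrite /p horner_sum [RHS](bigID (mem O)) /= [X in _ = _ + X]big1 ?addr0.
    apply: eq_bigr => j jO; rewrite hornerZ hornerXn !mxE -(dO i iO).
    by move: iO jO; rewrite !mO => /eqP -> /eqP ->; rewrite eqxx.
  move=> j jO; rewrite !mxE (_ : (porbit sg i == _) = false) ?mulr0 //.
  by move: iO jO; rewrite !mO => /eqP ->; rewrite eq_sym => /negPf.
have p0 : p = 0.
  apply: (@roots_geq_poly_eq0 _ _ [seq y i | i <- enum O]).
  - by apply/allP => x /mapP[i]; rewrite mem_enum => iO ->; apply/rootP/p_root.
  - rewrite map_inj_in_uniq ?enum_uniq // => i j; rewrite !mem_enum => iO jO.
    rewrite /y (dO i iO) (dO j jO) => /eqP.
    rewrite (iter_frob_eq _ _ (wE _ (d0 j0))) -(dO i iO) indEq => [/eqP //|].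
    by move: iO jO; rewrite !mO => /eqP -> /eqP ->.
  rewrite size_map -cardE; apply: (leq_trans (size_sum _ _ _)).
  apply/bigmax_leqP => j jO; apply: (leq_trans (size_scale_leq _ _)).
  by rewrite size_polyXn; apply: ltn_pmod.
have := congr1 (fun q : {poly K} => q`_(ind j0 %% d j0)) p0.
rewrite coef0 coef_sum (bigD1 j0) ?porbit_id //= coefZ coefXn eqxx mulr1.
rewrite big1 ?addr0 // => j /andP[jO ne]; rewrite coefZ coefXn.
rewrite (_ : (_ == _ :> nat) = false) ?mulr0 //; apply/negbTE.
rewrite -(dO j jO); have := indEq j0 j; rewrite (eq_sym j0) (negPf ne).
move: jO; rewrite mO => /eqP e; rewrite e => /(_ erefl).
by rewrite /d e => ->.
Qed.

Section OrbitTorus.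

Variables (sg : 'S_N) (nr : nat) (rep : 'I_nr -> 'I_N) (c : 'I_nr -> nat) (g : nat).
Variable e : 'I_nr -> int.
Hypothesis repI : forall i i', porbit sg (rep i) = porbit sg (rep i') -> i = i'.
Hypothesis repS : forall j, exists i, porbit sg j = porbit sg (rep i).
Hypothesis cE : forall i, #|porbit sg (rep i)| = (g * c i)%N.
Hypothesis g_gt0 : (0 < g)%N.
Hypothesis eE : \sum_i e i * (c i)%:Z = 1.

Lemma big_porbit (R : Type) (idx : R) (op : Monoid.com_law idx) (F : 'I_N -> R) :
  \big[op/idx]_j F j =
  \big[op/idx]_i \big[op/idx]_(j | porbit sg j == porbit sg (rep i)) F j.
Proof.
rewrite (exchange_big_dep predT) //=; apply: eq_bigr => j _.
have [i ei] := repS j; rewrite (big_pred1 i) // => i' /=.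
rewrite ei; apply/eqP/eqP => [/repI //|-> //].
Qed.

Lemma card_porbit_rep i :
  #|[pred j | porbit sg j == porbit sg (rep i)]| = (g * c i)%N.
Proof. by rewrite -cE; apply: eq_card => j; rewrite inE eq_porbit_mem. Qed.

Lemma prod_porbit (x : 'I_N -> K) : (forall j, x (sg j) = x j) ->
  \prod_j x j = (\prod_i x (rep i) ^+ c i) ^+ g.
Proof.
move=> xs; rewrite big_porbit -prodrXl; apply: eq_bigr => i _.
rewrite (eq_bigr (fun=> x (rep i))).
  by rewrite prodr_const card_porbit_rep mulnC exprM.
by move=> j /eqP; apply: perm_invariant_porbit.
Qed.

Lemma sum_porbit (a : 'I_N -> int) : (forall j, a (sg j) = a j) ->
  \sum_j a j = (\sum_i a (rep i) * (c i)%:Z) * g%:Z.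
Proof.
move=> asg; rewrite big_porbit mulr_suml; apply: eq_bigr => i _.
rewrite (eq_bigr (fun=> a (rep i))).
  by rewrite sumr_const card_porbit_rep -mulrA -PoszM mulnC pmulrn mulrzz.
by move=> j /eqP; apply: perm_invariant_porbit.
Qed.

(* [c i] is the size of the i-th orbit divided by the gcd [g] of all the sizes:
   [\prod_j x_j = 1] has [g] components on the [sg]-invariant [x], of which this is
   the neutral one. *)
Definition orbit_torus (P : 'M[K]_N) : set 'M[K]_N :=
  [set t | exists x : 'rV[K]_N, [/\ forall j, x 0 (sg j) = x 0 j,
     \prod_i x 0 (rep i) ^+ c i = 1 & t = conj_diag P x]]%classic.

Lemma orbit_torus_prod (x : 'rV[K]_N) : (forall j, x 0 (sg j) = x 0 j) ->
  \prod_i x 0 (rep i) ^+ c i = 1 -> \prod_j x 0 j = 1.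
Proof. by move=> xs x1; rewrite (prod_porbit xs) x1 expr1n. Qed.

(** The coordinates at [rep i] are powers z^(b_i) of one root of unity of order M, and the sum of
    the b_i c_i is a multiple qM of M. Replacing b_i by b_i - qM e_i, with the Bezout coefficients
    of [eE], keeps the powers of z and makes the weighted sum 0. *)
Lemma orbit_torus_cocharacter (x : 'rV[K]_N) : (forall j, x 0 (sg j) = x 0 j) ->
  \prod_i x 0 (rep i) ^+ c i = 1 ->
  exists (a : 'I_N -> int) (z : K), [/\ z != 0, forall j, a (sg j) = a j,
    \sum_i a (rep i) * (c i)%:Z = 0 & x = \row_j z ^ a j].
Proof.
move=> xs x1; have xp := orbit_torus_prod xs x1.
have [M [z [b [M0 zp bE]]]] := common_prim_root K_alg (fun i => diag_torus_neq0 (rep i) xp).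
have z0 : z != 0 := prim_root_neq0 M0 zp.
have [q qE] : exists q : nat, (\sum_i b i * c i = q * M)%N.
  apply/dvdnP; rewrite (prim_order_dvd zp).
  rewrite (_ : z ^+ _ = 1) // -x1.
  rewrite (big_morph (fun m : nat => z ^+ m) (exprD z) (expr0 z)).
  by apply: eq_bigr => i _; rewrite bE exprM.
have [it itE] := choice repS.
have itsg j : it (sg j) = it j.
  by apply: repI; rewrite -!itE; apply: (porbit_iterE sg 1).
have itrep i : it (rep i) = i by apply: repI; rewrite -itE.
pose a i : int := (b i)%:Z - q%:Z * M%:Z * e i.
exists (fun j => a (it j)), z; split => //.
- by move=> j; rewrite itsg.
- under eq_bigr => i _ do rewrite itrep /a mulrBl -(mulrA _ (e i)).
  rewrite sumrB -mulr_sumr eE mulr1 -PoszM -qE (big_morph Posz PoszD (erefl _)).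
  by rewrite -sumrB big1 // => i _; rewrite PoszM subrr.
apply/rowP => j; rewrite mxE /a expfzDr // -exprnP -bE.
rewrite (_ : z ^ (- _) = 1) ?mulr1.
  by apply: (@perm_invariant_porbit _ _ sg (fun j => x 0 j)).
have -> : - (q%:Z * M%:Z * e (it j)) = M%:Z * - (q%:Z * e (it j)).
  by rewrite mulrN mulrCA mulrA.
by rewrite -exprz_exp -exprnP (prim_expr_order zp) exp1rz.
Qed.

Variable P : 'M[K]_N.
Hypothesis Pu : P \in unitmx.

Lemma cocharacter_orbit_torus (a : 'I_N -> int) (z : K) : z != 0 ->
  (forall j, a (sg j) = a j) -> \sum_j a j = 0 -> orbit_torus P (cocharacter P a z).
Proof.
move=> z0 asg a0; exists (\row_j z ^ a j); split => //.
  by move=> j; rewrite !mxE asg.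
move: a0; rewrite sum_porbit // => /eqP; rewrite mulf_eq0.
rewrite [X in _ || X](_ : _ = false) ?orbF; last by apply/negbTE; rewrite eqz_nat -lt0n.
move=> /eqP a0; rewrite -[RHS](expr0z z) -[in RHS]a0 expfz_sum //.
by apply: eq_bigr => i _; rewrite mxE exprnP exprz_exp.
Qed.

Lemma orbit_torus_closed_subgroup : closed_subgroup (orbit_torus P).
Proof.
split.
- pose cond (i : 'I_N * 'I_N + 'I_N + unit) (t : 'M[K]_N) : K := match i with
    | inl (inl (i, j)) => (P *m t *m invmx P) i j * (i != j)%:R
    | inl (inr j) => coordinate P t (sg j) - coordinate P t j
    | inr _ => \prod_i coordinate P t (rep i) ^+ c i - 1 end.
  have condP i : polyfun (cond i).
    case: i => [[[i j]|j]|[]] /=.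
    + exact: polyfunM (polyfun_conj _ _ _ _) (polyfun_cst _ _).
    + exact: polyfunB (polyfun_conj _ _ _ _) (polyfun_conj _ _ _ _).
    + apply: polyfunB (polyfun_cst _ _); apply: polyfun_prod => i.
      by apply: polyfunX; exact: polyfun_conj.
  suff -> : orbit_torus P = [set t | t \in unitmx /\ forall i, cond i t = 0]%classic.
    exact: zariski_closed_polyfuns.
  apply/seteqP; split => t /=.
    move=> [x [xs x1 ->]]; have xp := orbit_torus_prod xs x1.
    split; first by rewrite conj_diag_unit // xp oner_neq0.
    case=> [[[i j]|j]|[]] /=.
    + rewrite conj_diagK // -mulmxA mulmxV // mulmx1 mxE.
      by case: (i == j); rewrite ?mulr0 // mul0r.
    + by rewrite !coordinate_conj_diag // xs subrr.
    + by under eq_bigr do rewrite coordinate_conj_diag //; rewrite x1 subrr.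
  move=> [tu h]; pose x : 'rV[K]_N := \row_j coordinate P t j.
  have tE : t = conj_diag P x.
    apply: conj_diagP => //; apply: (can_inj (mulmxK (_ : invmx P \in unitmx))).
      by rewrite unitmx_inv.
    rewrite -(mulmxA (diag_mx x)) (mulmxV Pu) mulmx1.
    apply/matrixP => i j; rewrite [RHS]mxE.
    have := h (inl (inl (i, j))); rewrite /cond.
    have [->|_] := eqVneq i j => hij; last by rewrite mulr1 in hij.
    by rewrite mulr1n [RHS]mxE.
  exists x; split => //.
    by move=> j; rewrite !mxE; apply/eqP; rewrite -subr_eq0; apply/eqP/(h (inl (inr j))).
  apply/eqP; rewrite -subr_eq0 -[X in _ == X](h (inr tt)) /cond; apply/eqP.
  by congr (_ - 1); apply: eq_bigr => i _; rewrite mxE.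
- exists (const_mx 1); split => [j||]; rewrite ?mxE // ?conj_diag1 //.
  by apply: big1 => i _; rewrite mxE expr1n.
- move=> _ _ [x [xs x1 ->]] [y [ys y1 ->]]; rewrite conj_diagM //.
  eexists; split; last reflexivity; first by move=> j; rewrite !mxE xs ys.
  by under eq_bigr do rewrite mxE exprMn; rewrite big_split /= x1 y1 mulr1.
move=> _ [x [xs x1 ->]]; have xp := orbit_torus_prod xs x1.
rewrite conj_diagV //; last by move=> j; apply: diag_torus_neq0.
eexists; split; last reflexivity; first by move=> j; rewrite !mxE xs.
under eq_bigr do rewrite mxE exprVn.
by rewrite prodfV x1 invr1.
Qed.

Lemma orbit_torus_connected : zariski_connected (orbit_torus P).
Proof.
apply: (zariski_connected_cocharacters Pu) => t [x [xs x1 ->]].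
have [a [z [z0 asg a0 ->]]] := orbit_torus_cocharacter xs x1.
exists a, z; split => // z' z'0; apply: cocharacter_orbit_torus => //.
by rewrite sum_porbit // a0 mul0r.
Qed.

Lemma frob_fixed_mx m1 m2 (A : 'M[K]_(m1, m2)) : map_mx Fr A = A ->
  exists B : 'M[k]_(m1, m2), map_mx iota B = A.
Proof.
move=> AF; have ex ij : exists b, iota b = A ij.1 ij.2.
  by apply: frob_fixed; have /matrixP/(_ ij.1 ij.2) := AF; rewrite mxE.
have [b bE] := choice ex; exists (\matrix_(i, j) b (i, j)).
by apply/matrixP => i j; rewrite !mxE bE.
Qed.

Lemma frob_map_iota m1 m2 (B : 'M[k]_(m1, m2)) :
  map_mx Fr (map_mx iota B) = map_mx iota B.
Proof. by apply/matrixP => i j; rewrite !mxE frob_iota. Qed.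

(** Descent: two frames that the Frobenius permutes in the same way differ by a matrix with entries
    in k. *)
Lemma perm_frob_quotient (A B : 'M[K]_N) : A \in unitmx ->
  map_mx Fr A = perm_mx sg *m A -> map_mx Fr B = perm_mx sg *m B ->
  map_mx Fr (invmx A *m B) = invmx A *m B.
Proof.
move=> Au AF BF; rewrite map_mxM map_invmx AF BF.
have pu : perm_mx sg *m A \in unitmx by rewrite unitmx_mul unitmx_perm.
apply: (can_inj (mulKmx pu)); rewrite mulKVmx // -mulmxA mulKVmx //.
Qed.

(** The matrix V of [vandermonde_perm] obeys the same Frobenius rule as P, so R = V^-1 P is defined
    over k. As V only links indices of one orbit, it commutes with the diagonal matrices constant on
    orbits, and R diagonalizes the torus. *)
Lemma orbit_torus_split : map_mx Fr P = perm_mx sg *m P ->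
  split_torus iota (orbit_torus P).
Proof.
move=> PF; split; [exact: orbit_torus_closed_subgroup | exact: orbit_torus_connected |].
have [V [Vu VF Vorb]] := vandermonde_perm sg.
have [R RE] := frob_fixed_mx (perm_frob_quotient Vu VF PF).
have Ru : map_mx iota R \in unitmx by rewrite RE unitmx_mul unitmx_inv Vu.
exists R; first by rewrite -(map_unitmx iota).
move=> _ [x [xs x1 ->]]; have VR : P = V *m map_mx iota R by rewrite RE mulKVmx.
suff -> : map_mx iota R *m conj_diag P x *m invmx (map_mx iota R) = diag_mx x.
  exact: diag_mx_is_diag.
apply: (can_inj (mulmxK Ru)); rewrite mulmxKV //.
apply: (can_inj (mulKmx Vu)); rewrite (mulmxA V) -VR conj_diagK // {1}VR.
rewrite !mulmxA; congr (_ *m _); apply/matrixP => i j.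
rewrite mul_diag_mx mul_mx_diag !mxE mulrC.
have [->|/Vorb eij] := eqVneq (V i j) 0; first by rewrite !mul0r.
by congr (_ * _); apply: (@perm_invariant_porbit _ _ sg (fun j => x 0 j)).
Qed.

(** On B the function [u] takes values in the g-th roots of unity. The parts where u = 1 and where u
    is another root are closed and disjoint, and the first one contains the identity. *)
Lemma connected_sub_orbit_torus (B : set 'M[K]_N) : split_torus iota B ->
  (forall b, B b -> exists x : 'rV[K]_N, [/\ forall j, x 0 (sg j) = x 0 j,
     \prod_j x 0 j = 1 & b = conj_diag P x]) -> (B `<=` orbit_torus P)%classic.
Proof.
move=> [[Bc B1 _ _] Bconn _] Bx.
pose u (t : 'M[K]_N) := \prod_i coordinate P t (rep i) ^+ c i.
have uP : polyfun u.
  by apply: polyfun_prod => i; apply: polyfunX; exact: polyfun_conj.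
have [rs rsE] := closed_field_poly_normal ('X^g - 1 : {poly K}).
rewrite lead_coefXnsubC // scale1r in rsE.
have mem_rs z : (z \in rs) = (z ^+ g == 1).
  by rewrite -root_prod_XsubC -rsE rootE !hornerE subr_eq0.
pose h (t : 'M[K]_N) := \prod_(z <- rs | z != 1) (u t - z).
have hP : polyfun h by apply: polyfun_prod => z; apply: polyfunB uP (polyfun_cst _ _).
pose B' := (B `&` [set t | u t - 1 = 0])%classic.
pose B'' := (B `&` [set t | h t = 0])%classic.
have u1 : u 1%:M = 1.
  rewrite /u big1 // => i _; rewrite -(conj_diag1 Pu) coordinate_conj_diag // mxE.
  by rewrite expr1n.
have [||||B0|B0] := Bconn B' B''.
- by apply: zariski_closed_cut => //; apply: polyfunB uP (polyfun_cst _ _).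
- exact: zariski_closed_cut.
- apply/seteqP; split => [b Bb|b [[]|[]]] //.
  have [ub|ub] := eqVneq (u b) 1; first by left; split=> //=; rewrite ub subrr.
  right; split => //=; rewrite /h; have urs : u b \in rs.
    have [x [xs xp ->]] := Bx b Bb; rewrite mem_rs /u.
    by under eq_bigr do rewrite coordinate_conj_diag //; rewrite -prod_porbit // xp.
  by apply/eqP; rewrite big_seq_cond prodf_seq_eq0; apply/hasP; exists (u b) => //; rewrite urs ub subrr eqxx.
- apply/seteqP; split => // b [[_ /eqP]] /=; rewrite subr_eq0 => /eqP ub [_ /= /eqP].
  rewrite /h ub prodf_seq_eq0 => /hasP[z _ /andP[z1]].
  by rewrite subr_eq0 eq_sym (negPf z1).
- by have : B' 1%:M; [split => //=; rewrite u1 subrr | rewrite B0].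
move=> b Bb; have [x [xs xp bE]] := Bx b Bb; exists x; split => //.
have [ub|ub] := eqVneq (u b) 1.
  by rewrite -[RHS]ub /u bE; apply: eq_bigr => i _; rewrite coordinate_conj_diag.
have urs : u b \in rs.
  rewrite mem_rs /u bE.
  by under eq_bigr do rewrite coordinate_conj_diag //; rewrite -prod_porbit // xp.
have : B'' b.
  split => //=; apply/eqP; rewrite /h prodf_seq_eq0; apply/hasP; exists (u b) => //.
  by rewrite ub subrr eqxx.
by rewrite B0.
Qed.

Section Maximality.

Variables (s : 'M[K]_N) (mu : 'rV[K]_N).
Local Notation H := (centralizer (@SLbar K N) [set s]%classic : set 'M[K]_N).
Hypothesis Ps : P *m s = diag_mx mu *m P.
Hypothesis PF : map_mx Fr P = perm_mx sg *m P.
(** Equal eigenvalues at different indices belong to different cycles of [sg], so that weights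
    constant on cycles can separate them. *)
Hypothesis mu_orbit : forall m j, mu 0 (iter m sg j) = mu 0 j -> iter m sg j = j.

Lemma orbit_torus_sub : (orbit_torus P `<=` H)%classic.
Proof.
move=> _ [x [xs x1 ->]]; split.
  by change (\det (conj_diag P x) = 1); rewrite det_conj_diag // orbit_torus_prod.
by move=> _ ->; apply: conj_diag_comm Ps.
Qed.

(** A nonzero off-diagonal entry (i, j) of an element of the centralizer forces mu_i = mu_j, hence
    different cycles. The cocharacter with weight the size of the cycle of j on the cycle of i, and
    minus the size of the cycle of i on the cycle of j, then excludes it. *)
Lemma centralizer_orbit_torus : centralizer H (orbit_torus P) = diag_torus P.
Proof.
apply/seteqP; split => [t [[t1 ts] tA]|_ [x x1 ->]]; last first.
  split; last by move=> _ [y [_ _ ->]]; rewrite !conj_diagM //; congr conj_diag; apply/rowP => j; rewrite !mxE mulrC.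
  split; last by move=> _ ->; apply: conj_diag_comm Ps.
  by change (\det (conj_diag P x) = 1); rewrite det_conj_diag.
pose m := P *m t *m invmx P; have mP : m *m P = P *m t by rewrite /m mulmxKV.
have comm (y : 'rV[K]_N) a : P *m a = diag_mx y *m P -> t *m a = a *m t ->
    forall i j, m i j != 0 -> y 0 i = y 0 j.
  move=> Pa ta i j mij; symmetry; apply: diag_mx_intertwine mij.
  apply: (can_inj (mulmxK Pu)).
  rewrite -(mulmxA m) -Pa (mulmxA m) mP -(mulmxA P) ta (mulmxA P) Pa.
  by rewrite -(mulmxA _ P) -mP mulmxA.
have offdiag i j : i != j -> m i j = 0.
  move=> ij; apply/eqP/negPn/negP => mij.
  have muij : mu 0 i = mu 0 j by apply: (comm mu s Ps (ts s erefl) i j mij).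
  have orb : porbit sg i != porbit sg j.
    apply: contraNneq ij => /porbit_iter[l jE].
    by rewrite jE eq_sym; apply/eqP/mu_orbit; rewrite -jE.
  pose a l : int := if porbit sg l == porbit sg i then #|porbit sg j|%:Z
    else if porbit sg l == porbit sg j then - #|porbit sg i|%:Z else 0.
  have asg l : a (sg l) = a l by rewrite /a (porbit_iterE sg 1).
  have a0 : \sum_l a l = 0.
    rewrite (bigID (fun l => porbit sg l == porbit sg i)) /=.
    rewrite [X in _ + X](bigID (fun l => porbit sg l == porbit sg j)) /=.
    rewrite (eq_bigr (fun=> #|porbit sg j|%:Z)) => [|l e']; last by rewrite /a e'.
    rewrite [X in _ + (X + _)](eq_big (fun l => porbit sg l == porbit sg j) (fun=> - #|porbit sg i|%:Z)).
    - rewrite [X in _ + (_ + X)]big1 ?addr0; last first.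
        by move=> l /andP[/negPf h1 /negPf h2]; rewrite /a h1 h2.
      rewrite !sumr_const.
      rewrite (_ : #|[pred l | porbit sg l == porbit sg i]| = #|porbit sg i|); last first.
        by apply: eq_card => l; rewrite !inE -eq_porbit_mem.
      rewrite (_ : #|[pred l | porbit sg l == porbit sg j]| = #|porbit sg j|); last first.
        by apply: eq_card => l; rewrite !inE -eq_porbit_mem.
      by rewrite mulNrn !pmulrn !mulrzz mulrC subrr.
    - move=> l; apply: andb_idl => /eqP ->; by rewrite eq_sym.
    by move=> l /andP[/negPf h1 h2]; rewrite /a h1 h2.
  have d0 l : (0 < #|porbit sg l|)%N by apply/card_gt0P; exists l; rewrite porbit_id.
  have nz : (#|porbit sg j| + #|porbit sg i|)%N%:Z != 0.
    by rewrite eqz_nat -lt0n addn_gt0 d0.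
  have [z z0 zne] := exists_expz_neq1 K nz.
  have Az := cocharacter_orbit_torus z0 asg a0.
  have := comm (\row_l z ^ a l) _ (conj_diagK Pu _) (tA _ Az) i j mij.
  rewrite !mxE /a !eqxx eq_sym (negPf orb) => e1; case/eqP: zne.
  by rewrite PoszD expfzDr // e1 -expfzDr // addrC subrr expr0z.
have tE : t = conj_diag P (\row_i m i i).
  apply: conj_diagP => //; rewrite -mP; congr (_ *m _); apply/matrixP => i j.
  rewrite [RHS]mxE; have [->|ij] := eqVneq i j; first by rewrite mulr1n [RHS]mxE.
  exact: offdiag.
exists (\row_i m i i) => //; rewrite -(det_conj_diag Pu) -tE.
exact: t1.
Qed.

(** Let R over k diagonalize B. Then W = P R^-1 obeys the Frobenius rule of P, so its entries (j, i)
    and ([sg j], i) are nonzero together; such an i gives x_j and x_(sg j) the same value y_i. *)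
Lemma split_torus_weights (B : set 'M[K]_N) : split_torus iota B ->
  forall (x : 'rV[K]_N), B (conj_diag P x) -> forall j, x 0 (sg j) = x 0 j.
Proof.
move=> [_ _ [R Ru Bdiag]] x Bx j; have /diag_mxP[y yE] := Bdiag _ Bx.
set R' := map_mx iota R in yE; have R'u : R' \in unitmx by rewrite map_unitmx.
pose Wm := P *m invmx R'.
have WF : map_mx Fr Wm = perm_mx sg *m Wm.
  by rewrite map_mxM map_invmx frob_map_iota PF -mulmxA.
have Wu : Wm \in unitmx by rewrite unitmx_mul unitmx_inv Pu.
have WE : Wm *m diag_mx y = diag_mx x *m Wm.
  rewrite /Wm -yE (mulmxA (diag_mx x)) -(conj_diagK Pu).
  by rewrite (mulmxA (P *m _)) (mulmxA (P *m invmx R')) mulmxKV.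
have [i Wji] := unitmx_row_neq0 j Wu.
have Wsg : Wm (sg j) i = Fr (Wm j i).
  by have /matrixP/(_ j i) := WF; rewrite -row_permE [X in X = _ -> _]mxE [X in _ = X -> _]mxE.
have xE l : Wm l i != 0 -> x 0 l = y 0 i.
  by move=> Wl; rewrite (diag_mx_intertwine WE Wl).
by rewrite !xE // Wsg fmorph_eq0.
Qed.

(** A split torus B containing this one commutes with it, so it is diagonal in the frame. Its
    weights are constant on cycles by rationality, and connectedness puts it in the neutral
    component. *)
Lemma orbit_torus_maximal : maximal_split_torus iota H (orbit_torus P).
Proof.
split; [exact: orbit_torus_split | exact: orbit_torus_sub |].
move=> B Bsplit BH AB; apply/seteqP; split => // b Bb.
have BT b' : B b' -> diag_torus P b'.
  move=> Bb'; rewrite -centralizer_orbit_torus; split; first exact: BH.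
  move=> a Aa; have [_ _ [R Ru Rd]] := Bsplit.
  have /diag_mxP[y yE] := Rd _ Bb'; have /diag_mxP[y' y'E] := Rd _ (AB _ Aa).
  set R' := map_mx iota R in yE y'E; have R'u : R' \in unitmx by rewrite map_unitmx.
  have e1 : R' *m b' = diag_mx y *m R' by rewrite -yE mulmxKV.
  have e2 : R' *m a = diag_mx y' *m R' by rewrite -y'E mulmxKV.
  rewrite (conj_diagP R'u e1) (conj_diagP R'u e2) !conj_diagM //.
  by congr conj_diag; apply/rowP => j; rewrite !mxE mulrC.
apply: (connected_sub_orbit_torus Bsplit) Bb => b' Bb'.
have [x x1 b'E] := BT b' Bb'; exists x; split => //.
by apply: (split_torus_weights Bsplit); rewrite -b'E.
Qed.

End Maximality.

End OrbitTorus.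

Lemma orbit_data_exists (sg : 'S_N) :
  exists (nr : nat) (rep : 'I_nr -> 'I_N) (c : 'I_nr -> nat) (g : nat) (e : 'I_nr -> int),
  [/\ forall i i', porbit sg (rep i) = porbit sg (rep i') -> i = i',
      forall j, exists i, porbit sg j = porbit sg (rep i),
      forall i, #|porbit sg (rep i)| = (g * c i)%N,
      (0 < g)%N & \sum_i e i * (c i)%:Z = 1].
Proof.
have [|nr [rep [repI _ repS]]] := @block_representatives N _ (fun j => porbit sg j) predT.
  by [].
pose f i := #|porbit sg (rep i)|; pose g := \big[gcdn/0%N]_i f i.
have d0 i : (0 < f i)%N by apply/card_gt0P; exists (rep i); rewrite porbit_id.
have gf i : (g %| f i)%N by rewrite /g (bigD1 i) //= dvdn_gcdl.
have [i0 _] := repS ord0 isT.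
have g0 : (0 < g)%N by apply: dvdn_gt0 (gf i0).
have [e eE] := big_bezout f.
exists nr, rep, (fun i => f i %/ g)%N, g, e; split => //.
- by move=> j; apply: repS.
- by move=> i; rewrite mulnC divnK.
have gz : g%:Z != 0 by rewrite eqz_nat -lt0n.
apply: (mulIf gz); rewrite mul1r mulr_suml -[RHS]eE; apply: eq_bigr => i _.
by rewrite -mulrA -PoszM divnK.
Qed.

End SplitTori.

(** * Frames of eigenvectors permuted by the Frobenius map *)

Lemma similar_diag_rows (F : fieldType) N (P A : 'M[F]_N) : P \in unitmx ->
  similar_diag P A -> exists d : 'rV_N, P *m A = diag_mx d *m P.
Proof.
move=> Pu /similar_diagPex[d]; rewrite /similar_to /= conjumx // => /eqP dE.
by exists d; rewrite -dE mulmxKV.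
Qed.

Lemma rows_similar_diag (F : fieldType) N (P A : 'M[F]_N) (d : 'rV_N) : P \in unitmx ->
  P *m A = diag_mx d *m P -> similar_diag P A.
Proof.
move=> Pu PA; apply/similar_diagPex; exists d; rewrite /similar_to /= conjumx //.
by rewrite PA mulmxK.
Qed.

Lemma row_pid_mx_mul (F : pzRingType) m n r (A : 'M[F]_(m, n)) (i : 'I_m) : (i < r)%N ->
  row i (pid_mx r *m A) = row i A.
Proof.
move=> ir; apply/rowP => j; rewrite !mxE (bigD1 i) //= !mxE eqxx ir mul1r.
by rewrite big1 ?addr0 // => i' ne; rewrite !mxE eq_sym val_eqE (negPf ne) mul0r.
Qed.

Lemma row_diag_mx_mul (F : pzRingType) m n (d : 'rV[F]_m) (A : 'M_(m, n)) (i : 'I_m) :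
  row i (diag_mx d *m A) = d 0 i *: row i A.
Proof. by rewrite row_mul row_diag_mx -scalemxAl -rowE. Qed.

Section CodiagonalFrame.

Variables (k : finFieldType) (K : closedFieldType) (iota : {rmorphism k -> K}).
Variable n : nat.
Local Notation N := n.+1.
Local Notation Fr := (frob iota).

(* The projectors on the common eigenspaces are permuted by the Frobenius map,
   and so are the canonical bases of their row spaces. *)
Lemma codiagonal_frame (m : nat) (A : 'I_m -> 'M[K]_N) (P0 : 'M[K]_N) (w : 'I_m -> 'rV[K]_N) :
  P0 \in unitmx -> (forall t, map_mx Fr (A t) = A t) ->
  (forall t, P0 *m A t = diag_mx (w t) *m P0) ->
  exists (P : 'M[K]_N) (sg : 'S_N),
  [/\ P \in unitmx, map_mx Fr P = perm_mx sg *m P,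
      forall t, P *m A t = diag_mx (w t) *m P
    & forall i j, (forall t, w t 0 (iter i sg j) = w t 0 j) -> iter i sg j = j].
Proof.
move=> P0u AF P0A; pose la j : {ffun 'I_m -> K} := [ffun t => w t 0 j].
pose phi (l : {ffun 'I_m -> K}) : {ffun 'I_m -> K} := [ffun t => Fr (l t)].
have phiI : injective phi.
  by move=> l l' /ffunP e; apply/ffunP => t; have := e t; rewrite !ffunE => /fmorph_inj.
pose b l : 'rV[K]_N := \row_j (la j == l)%:R.
pose pr l := invmx P0 *m diag_mx (b l) *m P0.
have prE l : P0 *m pr l = diag_mx (b l) *m P0 by rewrite /pr !mulmxA mulmxV // mul1mx.
have prM l l' : pr l *m pr l' = (l == l')%:R *: pr l.
  apply: (can_inj (mulKmx P0u)); rewrite mulmxA prE -mulmxA prE mulmxA -scalemxAr prE scalemxAl.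
  congr (_ *m _); apply/matrixP => i j; rewrite mul_diag_mx !mxE.
  have [->|_] := eqVneq i j; last by rewrite !mulr0n !mulr0.
  rewrite !mulr1n; have [->|] := eqVneq (la j) l; rewrite ?mul0r ?mulr0 ?mul1r ?mulr1 //.
have prA l t : pr l *m A t = l t *: pr l.
  apply: (can_inj (mulKmx P0u)); rewrite mulmxA prE -mulmxA P0A mulmxA -scalemxAr prE scalemxAl.
  congr (_ *m _); apply/matrixP => i j; rewrite mul_diag_mx !mxE.
  have [->|_] := eqVneq i j; last by rewrite !mulr0n !mulr0.
  rewrite !mulr1n; have [<-|] := eqVneq (la j) l; rewrite ?mul0r ?mulr0 ?mul1r ?mulr1 //.
  by rewrite ffunE.
clearbody pr.
pose G := map_mx Fr P0; have Gu : G \in unitmx by rewrite map_unitmx.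
pose W := G *m invmx P0; have WP : W *m P0 = G by rewrite /W mulmxKV.
have Wu : W \in unitmx by rewrite unitmx_mul Gu unitmx_inv.
clearbody W.
have GA t : G *m A t = diag_mx (map_mx Fr (w t)) *m G.
  by rewrite -[in LHS]AF -map_mxM P0A map_mxM map_diag_mx.
have Wla i j : W i j != 0 -> la j = phi (la i).
  move=> Wij; apply/ffunP => t; rewrite !ffunE.
  have E : W *m diag_mx (w t) = diag_mx (map_mx Fr (w t)) *m W.
    by apply: (can_inj (mulmxK P0u)); rewrite -mulmxA -P0A mulmxA WP GA -WP mulmxA.
  by rewrite (diag_mx_intertwine E Wij) mxE.
have prF l : map_mx Fr (pr l) = pr (phi l).
  apply: (can_inj (mulKmx Gu)); rewrite -map_mxM prE map_mxM map_diag_mx -/G -WP.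
  rewrite -(mulmxA W) prE !mulmxA; congr (_ *m _); apply/matrixP => i j.
  rewrite mul_mx_diag mul_diag_mx !mxE rmorph_nat.
  have [->|Wij] := eqVneq (W i j) 0; first by rewrite mul0r mulr0.
  by rewrite (Wla _ _ Wij) (inj_eq phiI) mulrC.
(* This permutation only serves to show that the labels l and [phi l] have the same multiplicity. *)
have [p0 p0E] : exists p : 'S_N, forall i, la (p i) = phi (la i).
  by have [p ne] := unitmx_perm_neq0 Wu; exists p => i; apply/Wla/ne.
pose cl l := enum [pred j | la j == l].
have mem_cl j l : (j \in cl l) = (la j == l) by rewrite mem_enum.
have sz_cl l : size (cl (phi l)) = size (cl l).
  rewrite -!cardE -[RHS](card_image (@perm_inj _ p0)); apply: eq_card => j; rewrite inE.
  apply/idP/idP => [jl|/fintype.imageP[i]]; last by rewrite !inE => /eqP <- ->; rewrite p0E.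
  apply/fintype.imageP; exists (p0^-1 j)%g; rewrite ?permKV // inE -(inj_eq phiI).
  by rewrite -p0E permKV.
(* [ind j] is the rank of j among the indices with its label, and [sf j] the index of the same rank
   with the label [phi (la j)]. An iterate of [sf] that restores the label of j hence restores j. *)
pose ind j := index j (cl (la j)).
have ind_lt j : (ind j < size (cl (la j)))%N by rewrite index_mem mem_cl.
have indI i j : la i = la j -> ind i = ind j -> i = j.
  move=> e; rewrite /ind e => h.
  by rewrite -(nth_index i (_ : i \in cl (la j))) ?mem_cl ?e // h nth_index ?mem_cl.
pose sf j := nth j (cl (phi (la j))) (ind j).
have ind_lt' j : (ind j < size (cl (phi (la j))))%N by rewrite sz_cl.
have sf_la j : la (sf j) = phi (la j).
  by apply/eqP; rewrite -mem_cl mem_nth.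
have sf_ind j : ind (sf j) = ind j.
  by rewrite {1}/ind sf_la index_uniq ?enum_uniq.
have sfI : injective sf.
  move=> i j e; apply: indI; last by rewrite -sf_ind e sf_ind.
  by apply: phiI; rewrite -!sf_la e.
have sz_N l : (size (cl l) <= N)%N by rewrite -cardE -[X in (_ <= X)%N]card_ord max_card.
have ind_N j : (ind j < N)%N := leq_trans (ind_lt j) (sz_N _).
(* [row_ebase] commutes with field morphisms, so the Frobenius carries the basis for l to the basis
   for [phi l]. Its first rows, as many as the rank, span the row space of [pr l]. *)
pose B l := row_ebase (pr l).
have Bpr l (i : 'I_N) : (i < size (cl l))%N -> row i (B l) *m pr l = row i (B l).
  move=> il; have sr : (size (cl l) <= \rank (pr l))%N.
    pose f (a : 'I_(size (cl l))) : 'I_N := tnth (in_tuple (cl l)) a.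
    have fI : injective f by apply/tuple_uniqP; apply: enum_uniq.
    pose D : 'M[K]_(size (cl l), N) := rowsub f P0.
    have Dpr : D *m pr l = D.
      apply/row_matrixP => a; rewrite row_mul /D row_rowsub -row_mul prE row_diag_mx_mul.
      rewrite mxE (_ : la (f a) == l) ?scale1r // -mem_cl; exact: mem_tnth.
    have Dfree : row_free D.
      apply: inj_row_free => c; rewrite /D rowsubE mulmxA => /eqP.
      rewrite mulmx_free_eq0 ?row_free_unit // => /eqP /rowP c0; apply/rowP => a; have := c0 (f a).
      rewrite !mxE (bigD1 a) //= !mxE eqxx mulr1 big1 ?addr0 // => a' ne.
      by rewrite !mxE (inj_eq fI) (negPf ne) mulr0.
    by rewrite -(eqP Dfree) -Dpr mxrankM_maxr.
  have piE : pid_mx (\rank (pr l)) *m B l = invmx (col_ebase (pr l)) *m pr l.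
    by rewrite -{3}(mulmx_ebase (pr l)) -mulmxA mulKmx ?col_ebase_unit.
  have -> : row i (B l) = row i (invmx (col_ebase (pr l)) *m pr l).
    by rewrite -piE row_pid_mx_mul // (leq_trans il).
  by rewrite -row_mul -mulmxA prM eqxx scale1r.
pose P : 'M[K]_N := \matrix_j row (Ordinal (ind_N j)) (B (la j)).
have rowP_ j : row j P = row (Ordinal (ind_N j)) (B (la j)) by rewrite rowK.
have Pj j : row j P *m pr (la j) = row j P by rewrite rowP_ Bpr ?ind_lt.
have Ppr j l : row j P *m pr l = (la j == l)%:R *: row j P.
  by rewrite -{1}Pj -mulmxA prM -scalemxAr Pj.
exists P, (perm sfI); split.
- rewrite -row_free_unit; apply: inj_row_free => c cP; apply/rowP => j; rewrite [RHS]mxE.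
  pose l := la j; pose c' : 'rV[K]_N := \row_i
    (if (i < size (cl l))%N then c 0 (nth j (cl l) i) else 0).
  have c'0 : c' *m B l = 0.
    have := congr1 (mulmx^~ (pr l)) cP; rewrite mul0mx => e0; rewrite -[RHS]e0.
    rewrite mulmx_sum_row [c *m P]mulmx_sum_row mulmx_suml.
    rewrite (bigID (fun i : 'I_N => (i < size (cl l))%N)) /= [X in _ + X]big1 ?addr0; last first.
      by move=> i /negPf il; rewrite mxE il scale0r.
    rewrite [RHS](bigID (fun j => la j == l)) /= [X in _ = _ + X]big1 ?addr0; last first.
      by move=> i /negPf il; rewrite -scalemxAl Ppr il scale0r scaler0.
    rewrite (reindex_onto (fun j => Ordinal (ind_N j)) (fun i : 'I_N => nth ord0 (cl l) i)) /=.
      rewrite (eq_bigl (fun i => la i == l)) => [|i]; last first.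
        apply/andP/eqP => [[il /eqP <-]|<-]; first by apply/eqP; rewrite -mem_cl mem_nth.
        by rewrite ind_lt nth_index ?mem_cl.
      apply: eq_bigr => i /eqP il; rewrite -scalemxAl Ppr rowP_ il eqxx scale1r mxE -il ind_lt.
      by rewrite nth_index ?mem_cl.
    move=> i il; apply: val_inj => /=; rewrite /ind.
    have -> : la (nth ord0 (cl l) i) = l by apply/eqP; rewrite -mem_cl mem_nth.
    by rewrite index_uniq ?enum_uniq.
  have /rowP/(_ (Ordinal (ind_N j))) : c' = 0.
    have Bf : row_free (B l) by rewrite row_free_unit row_ebase_unit.
    by apply/eqP; rewrite -(mulmx_free_eq0 _ Bf) c'0.
  by rewrite !mxE ind_lt nth_index // mem_cl.
- apply/row_matrixP => j; rewrite -map_row rowP_ map_row /B map_row_ebase prF.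
  have -> : row j (perm_mx (perm sfI) *m P) = row (sf j) P.
    by apply/rowP => i; rewrite -row_permE [LHS]mxE [LHS]mxE permE [RHS]mxE.
  rewrite rowP_ sf_la; congr (row _ _); apply: val_inj => /=.
  by rewrite sf_ind.
- move=> t; apply/row_matrixP => j; rewrite row_mul row_diag_mx_mul.
  by rewrite -{1}Pj -mulmxA prA -scalemxAr Pj ffunE.
move=> i j h; have indi : ind (iter i (perm sfI) j) = ind j.
  by elim: i {h} => //= i <-; rewrite permE sf_ind.
apply: indI indi; apply/ffunP => t; rewrite !ffunE h //.
Qed.


Hypothesis K_alg : integralRange iota.

(* The idempotents D l cut out the isotypic components of the split torus B. *)
Lemma adapted_frame (s : 'M[K]_N) (B : set 'M[K]_N) : map_mx Fr s = s ->
  (exists2 V, V \in unitmx & similar_diag V s) ->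
  split_torus iota B -> (forall b, B b -> b *m s = s *m b) ->
  exists (P : 'M[K]_N) (sg : 'S_N) (mu : 'rV[K]_N),
  [/\ P \in unitmx, map_mx Fr P = perm_mx sg *m P, P *m s = diag_mx mu *m P,
      forall i j, mu 0 (iter i sg j) = mu 0 j -> iter i sg j = j
    & forall b, B b -> exists x, b = conj_diag P x].
Proof.
move=> sF sD Bsplit Bs; have [_ _ [R0 R0u Bd]] := Bsplit.
pose R := map_mx iota R0; have Ru : R \in unitmx by rewrite map_unitmx.
have RF : map_mx Fr R = R by apply: frob_map_iota.
have [y yE] : exists y : 'M[K]_N -> 'rV[K]_N, forall b, B b -> R *m b = diag_mx (y b) *m R.
  have ex b : exists y : 'rV[K]_N, B b -> R *m b = diag_mx y *m R.
    have [Bb|nBb] := pselect (B b); last by exists 0.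
    by have /diag_mxP[y yE] := Bd _ Bb; exists y => _; rewrite -yE mulmxKV.
  by have [y yE] := choice ex; exists y.
(* The rows i and l of R carry the same weight of B; [D l] is the projector on the weight space of
   the row l. It is fixed by the Frobenius because R is. *)
pose eqv i l := `[< forall b, B b -> y b 0 i = y b 0 l >].
pose dl l : 'rV[K]_N := \row_i (eqv i l)%:R.
pose D l := invmx R *m diag_mx (dl l) *m R.
have DE l : R *m D l = diag_mx (dl l) *m R by rewrite /D !mulmxA mulmxV // mul1mx.
have Dsim l : similar_diag R (D l) := rows_similar_diag Ru (DE l).
clearbody D.
have DF l : map_mx Fr (D l) = D l.
  apply: (can_inj (mulKmx Ru)); rewrite DE -{1}RF -map_mxM DE map_mxM map_diag_mx RF.
  by congr (diag_mx _ *m _); apply/rowP => i; rewrite !mxE rmorph_nat.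
have DD l l' : D l *m D l' = D l' *m D l.
  apply: (can_inj (mulKmx Ru)); rewrite !(mulmxA R) !DE -!(mulmxA _ R) !DE !mulmxA.
  by rewrite diag_mxC.
have Ds l : D l *m s = s *m D l.
  pose S := R *m s *m invmx R; have SR : S *m R = R *m s by rewrite /S mulmxKV.
  clearbody S.
  apply: (can_inj (mulKmx Ru)); rewrite !(mulmxA R) DE -SR -!(mulmxA _ R) -SR DE !mulmxA.
  congr (_ *m _); apply/matrixP => i j.
  rewrite mul_diag_mx mul_mx_diag [LHS]mxE [RHS]mxE mulrC.
  have [->|Sij] := eqVneq (S i j) 0; first by rewrite !mul0r.
  congr (_ * _); rewrite !mxE; congr (nat_of_bool _)%:R.
  have yij b : B b -> y b 0 i = y b 0 j.
    move=> Bb; have E : diag_mx (y b) *m S = S *m diag_mx (y b).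
      apply: (can_inj (mulmxK Ru)); rewrite -!mulmxA SR -yE // !mulmxA -yE // SR.
      by rewrite -!mulmxA Bs.
    exact/esym/(diag_mx_intertwine (esym E)).
  by apply/asboolP/asboolP => h b Bb; rewrite -h // yij.
pose A (t : 'I_N.+1) := if unlift ord0 t is Some l then D l else s.
have AF t : map_mx Fr (A t) = A t by rewrite /A; case: unliftP.
have [P0 P0u P0A] : exists2 V, V \in unitmx & all [pred M | similar_diag V M] [seq A t | t : 'I_N.+1].
  apply/codiagonalizableP; split.
    move=> M M' /mapP[t _ ->] /mapP[t' _ ->]; rewrite /A /comm_mx.
    by case: unliftP => [l _|_]; case: unliftP => [l' _|_].
  move=> M /mapP[t _ ->]; rewrite /A; case: unliftP => [l _|_] //.
  by exists R.
have ex t : exists d : 'rV_N, P0 *m A t = diag_mx d *m P0.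
  by apply: similar_diag_rows => //; have /allP/(_ (A t)) := P0A; apply; apply: map_f; rewrite mem_enum.
have [w wE] := choice ex.
have [P [sg [Pu PF PA orb]]] := codiagonal_frame P0u AF wE.
have Ps : P *m s = diag_mx (w ord0) *m P by have := PA ord0; rewrite /A unlift_none.
have PD l : P *m D l = diag_mx (w (lift ord0 l)) *m P by have := PA (lift ord0 l); rewrite /A liftK.
pose W := P *m invmx R; have WR : W *m R = P by rewrite /W mulmxKV.
have Wu : W \in unitmx by rewrite unitmx_mul Pu unitmx_inv.
clearbody W.
have entE (M : 'M_N) (d d' : 'rV_N) : R *m M = diag_mx d *m R -> P *m M = diag_mx d' *m P ->
    forall i j, W i j != 0 -> d 0 j = d' 0 i.
  move=> RM PM i j; apply: diag_mx_intertwine.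
  by apply: (can_inj (mulmxK Ru)); rewrite -!mulmxA -RM (mulmxA W) WR PM.
have [f fE] := choice (fun j => unitmx_row_neq0 j Wu).
have Wsg j : W (sg j) (f j) != 0.
  have WF : map_mx Fr W = perm_mx sg *m W.
    by apply: (can_inj (mulmxK Ru)); rewrite -mulmxA WR -PF -WR map_mxM RF.
  have /matrixP/(_ j (f j)) := WF; rewrite -row_permE [X in X = _ -> _]mxE [X in _ = X -> _]mxE.
  by move=> <-; rewrite fmorph_eq0.
(* The entries of W at (j, f j) and (sg j, f j) are both nonzero, so the eigenvalues of the
   projectors are constant along the cycles of [sg]; only the eigenvalue of s remains to be
   compared. *)
exists P, sg, (w ord0); split => // [i j e|b Bb].
  apply: orb => t; case: (unliftP ord0 t) => [l ->|->//].
  elim: i {e} => //= i <-; set j' := iter _ _ _.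
  by rewrite -(entE _ _ _ (DE l) (PD l) _ _ (fE j')) -(entE _ _ _ (DE l) (PD l) _ _ (Wsg j')).
exists (\row_j y b 0 (f j)); apply: conj_diagP => //.
rewrite -WR -mulmxA yE // !mulmxA; congr (_ *m _); apply/matrixP => j i.
rewrite mul_diag_mx mul_mx_diag [LHS]mxE [RHS]mxE mulrC [X in _ = X * _]mxE.
have [->|Wji] := eqVneq (W j i) 0; first by rewrite !mulr0.
congr (_ * _); have : eqv i (f j).
  have := entE _ _ _ (DE (f j)) (PD (f j)) _ _ Wji.
  rewrite -(entE _ _ _ (DE (f j)) (PD (f j)) _ _ (fE j)) !mxE.
  have -> : eqv (f j) (f j) by apply/asboolP.
  by case: (eqv i (f j)) => // /eqP; rewrite eq_sym oner_eq0.
by move=> /asboolP; apply.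
Qed.

End CodiagonalFrame.

(** * Maximal split tori of the centralizer of s, and its motive *)

Section EigenFrames.

Variables (k : finFieldType) (K : closedFieldType) (iota : {rmorphism k -> K}).
Hypothesis K_alg : integralRange iota.
Variable n : nat.
Local Notation N := n.+1.
Local Notation Fr := (frob iota).

(** When s is fixed by the Frobenius, the last condition says that the cycle of j is no longer than
    the degree of mu_j. Shorter cycles mean a larger split torus. *)
Definition eigenframe (s P : 'M[K]_N) (sg : 'S_N) (mu : 'rV[K]_N) : Prop :=
  [/\ P \in unitmx, map_mx Fr P = perm_mx sg *m P, P *m s = diag_mx mu *m P
    & forall i j, mu 0 (iter i sg j) = mu 0 j -> iter i sg j = j].

Variable s : 'M[K]_N.
Local Notation H := (centralizer (@SLbar K N) [set s]%classic : set 'M[K]_N).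
Hypothesis sF : map_mx Fr s = s.
Hypothesis s_diag : exists2 V, V \in unitmx & similar_diag V s.

Lemma split_torus1 : split_torus iota [set 1%:M : 'M[K]_N]%classic.
Proof.
split; last by exists 1%:M; rewrite ?unitmx1 // => _ ->; rewrite map_mx1 mulmx1 mulmxV ?unitmx1 // -diag_const_mx diag_mx_is_diag.
- split=> [||_ _ -> ->|_ ->] //; last first.
  + by apply: (can_inj (mulmxK (unitmx1 K N))); rewrite mulVmx ?unitmx1 ?mulmx1.
  + by rewrite mulmx1.
  suff -> : [set 1%:M : 'M[K]_N]%classic = [set t | t \in unitmx /\
      forall ij : 'I_N * 'I_N, t ij.1 ij.2 - (ij.1 == ij.2)%:R = 0]%classic.
    apply: zariski_closed_polyfuns => ij.
    by apply: polyfunB; [exact: polyfun_entry | exact: polyfun_cst].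
  apply/seteqP; split => [_ ->|t [_ h]] /=.
    by split; rewrite ?unitmx1 // => ij; rewrite mxE subrr.
  apply/matrixP => i j; apply/eqP; rewrite -subr_eq0 [X in _ - X]mxE.
  exact/eqP/(h (i, j)).
move=> B1 B2 _ _ BE disj; have [B11|nB11] := pselect (B1 1%:M); [right|left].
  apply/seteqP; split => // t B2t; have : [set 1%:M : 'M[K]_N]%classic t by rewrite BE; right.
  by move=> t1; rewrite -disj; split => //; rewrite t1.
apply/seteqP; split => // t B1t; have : [set 1%:M : 'M[K]_N]%classic t by rewrite BE; left.
by move=> t1; apply: nB11; rewrite -t1.
Qed.

Lemma eigenframe_exists : exists P sg mu, eigenframe s P sg mu.
Proof.
have [|P [sg [mu [Pu PF Ps orb _]]]] := adapted_frame sF s_diag split_torus1.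
  by move=> _ ->; rewrite mul1mx mulmx1.
by exists P, sg, mu.
Qed.

Lemma maximal_split_torus_exists P sg mu : eigenframe s P sg mu ->
  exists2 A, maximal_split_torus iota H A & centralizer H A = diag_torus P.
Proof.
move=> [Pu PF Ps orb]; have [nr [rep [c [g [e [repI repS cE g0 eE]]]]]] := orbit_data_exists sg.
exists (orbit_torus sg rep c P).
  exact: (orbit_torus_maximal K_alg repI repS cE g0 eE Pu Ps PF orb).
exact: (centralizer_orbit_torus repI repS cE g0 Pu Ps orb).
Qed.

(** In a frame adapted to A, the torus A lies in the orbit torus, hence equals it by maximality, and
    the centralizer of the orbit torus is known. *)
Lemma maximal_split_torus_frame A : maximal_split_torus iota H A ->
  exists P sg mu, eigenframe s P sg mu /\ centralizer H A = diag_torus P.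
Proof.
move=> [As AH Amax]; have AHs a : A a -> a *m s = s *m a.
  by move=> Aa; have [_ h] := AH _ Aa; apply: h.
have [P [sg [mu [Pu PF Ps orb Ax]]]] := adapted_frame sF s_diag As AHs.
exists P, sg, mu; split => //.
have [nr [rep [c [g [e [repI repS cE g0 eE]]]]]] := orbit_data_exists sg.
have <- : orbit_torus sg rep c P = A.
  have [Os OH _] := orbit_torus_maximal K_alg repI repS cE g0 eE Pu Ps PF orb.
  apply: Amax => // a Aa; apply: (connected_sub_orbit_torus repI repS cE g0 Pu As) => // b Ab.
  have [x bE] := Ax b Ab; exists x; split => //.
    by apply: (split_torus_weights Pu PF As); rewrite -bE.
  by rewrite -(det_conj_diag Pu) -bE; have [b1 _] := AH _ Ab; apply: b1.
exact: (centralizer_orbit_torus repI repS cE g0 Pu Ps orb).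
Qed.

Lemma eigenframe_labels P sg mu : eigenframe s P sg mu ->
  forall i j, mu 0 (sg i) = mu 0 (sg j) <-> mu 0 i = mu 0 j.
Proof.
move=> [Pu PF Ps _] i j; rewrite !(frob_mu Pu Ps PF sF).
by split => [/fmorph_inj //|->].
Qed.

Lemma motive_dets_exists : exists V, is_motive_dets iota H V.
Proof.
have [P [sg [mu fr]]] := eigenframe_exists; have [Pu PF Ps orb] := fr.
have [A Amax AT] := maximal_split_torus_exists fr.
have [chi chiB] : exists chi : 'I_n -> 'M[K]_N -> K, character_basis (diag_torus P) chi.
  by exists (fun i t => coordinate P t (lift ord_max i)); apply: character_basis_exists.
have [u uE] := basis_exponents Pu chiB; have [v vE] := basis_coordinates Pu chiB.
have ex d : exists p : {poly rat}, (0 < d)%N ->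
    V_frobenius_det H (diag_torus P) chi (perm_matrix_action u v sg) d p.
  have [->|d0] := posnP d; first by exists 0.
  have [p pE] := V_det_exists (basis_uv Pu chiB uE vE) (basis_v_sum Pu chiB vE) (basis_vu uE vE)
    (weyl_invariants_perm Pu Ps chiB uE vE) (eigenframe_labels fr) ord0 d0.
  by exists p.
have [V VE] := choice ex; exists V, A, n, chi.
exists (perm_matrix_action u v sg); rewrite /= AT; split => //.
by have h := frobenius_matrix_perm Pu PF chiB uE vE.
Qed.

(** Whatever torus and characters lie behind the choice made in [motive_dets], this supplies the
    data required by the block combinatorics. *)
Lemma motive_dets_frame : exists P sg mu, eigenframe s P sg mu /\
  exists (r : nat) (chi : 'I_r -> 'M[K]_N -> K) (u : 'M[int]_(r, N)) (v : 'M[int]_(N, r))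
    (c0 : 'I_N -> int),
  [/\ [/\ u *m v = 1%:M, forall i, \sum_j v j i = 0
      & forall j l, (v *m u) j l = (j == l)%:R + c0 j],
      forall f, weyl_invariants H (diag_torus P) chi f <->
        forall p, label_preserving (fun j => mu 0 j) p ->
          sym_act (perm_matrix_action u v p) f = f
    & forall d, (0 < d)%N -> V_frobenius_det H (diag_torus P) chi
        (perm_matrix_action u v sg) d (motive_dets iota H d)].
Proof.
have : is_motive_dets iota H (motive_dets iota H).
  by have [V VE] := motive_dets_exists; apply: (xgetPex (fun=> 1)); exists V.
move=> [A [r [chi [MF [Amax]]]]].
have [P [sg [mu [fr ->]]]] := maximal_split_torus_frame Amax.
have [Pu PF Ps orb] := fr => chiB MFE VE; exists P, sg, mu; split => //.
have [u uE] := basis_exponents Pu chiB; have [v vE] := basis_coordinates Pu chiB.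
exists r, chi, u, v, (fun j => (v *m u) j j - 1); split.
- split; [exact: basis_uv uE vE | exact: basis_v_sum vE | exact: basis_vu uE vE].
- exact: weyl_invariants_perm.
by move=> d d0; rewrite -(frobenius_matrix_unique K_alg Pu PF chiB uE vE MFE); apply: VE.
Qed.

End EigenFrames.

(** * Values of the L-function *)

Section RatrChar0.

Variable C : fieldType.
Hypothesis C0 : [pchar C] =i pred0.

Lemma intr_eq0_pchar0 (z : int) : (z%:~R == 0 :> C) = (z == 0).
Proof.
by case: z => m; rewrite ?NegzE ?mulrNz ?oppr_eq0 -pmulrn (proj1 (pcharf0P C) C0).
Qed.

Lemma map_poly_ratr_intr (p : {poly int}) :
  map_poly ratr (map_poly intr p : {poly rat}) = map_poly intr p :> {poly C}.
Proof.
apply/polyP => i; rewrite coef_map_id0; last by rewrite -[0]/(0%:~R) ratr_int.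
by rewrite !coef_map /= ratr_int.
Qed.

(** C is any field of characteristic 0, so additivity is verified on numerators and denominators. *)
Lemma ratr_addC (x y : rat) : ratr (x + y) = ratr x + ratr y :> C.
Proof.
have dn (z : rat) : (denq z)%:~R != 0 :> C by rewrite intr_eq0_pchar0 denq_neq0.
have E (z : rat) : ratr z * (denq z)%:~R = (numq z)%:~R :> C by rewrite /ratr mulfVK.
apply: (mulIf (dn (x + y))); apply: (mulIf (dn x)); apply: (mulIf (dn y)).
rewrite E mulrDl; apply/eqP; rewrite -subr_eq0; apply/eqP.
have := E x; have := E y; move: (ratr x) (ratr y) => a b ay ax.
transitivity ((numq (x + y) * denq x * denq y
   - (numq x * denq y + numq y * denq x) * denq (x + y))%:~R : C).
  by rewrite rmorphB /= !(rmorphM, rmorphD) /= -ax -ay; ring.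
rewrite (_ : _ - _ = 0) //; apply/eqP; rewrite subr_eq0 -(eqr_int rat).
rewrite !(rmorphM, rmorphD) /= !numqE.
by apply/eqP; ring.
Qed.

Lemma horner_map_ratr1 (p : {poly rat}) : (map_poly ratr p).[1] = ratr p.[1] :> C.
Proof.
have r0 : ratr 0 = 0 :> C by rewrite -[0 in LHS]/(0%:~R) ratr_int.
rewrite horner_poly [p.[1]]horner_coef (big_morph _ ratr_addC r0).
by apply: eq_bigr => i _; rewrite !expr1n !mulr1.
Qed.

End RatrChar0.

(** * The L-value of the centralizer of one semisimple element *)

Section LValues.

Variables (k : finFieldType) (K : closedFieldType) (iota : {rmorphism k -> K}).
Hypothesis K_alg : integralRange iota.
Variable n : nat.
Local Notation N := n.+1.
Local Notation Fr := (frob iota).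
Variable s : 'M[K]_N.
Local Notation H := (centralizer (@SLbar K N) [set s]%classic : set 'M[K]_N).
Hypothesis sF : map_mx Fr s = s.
Hypothesis s_diag : exists2 V, V \in unitmx & similar_diag V s.
Variable C : fieldType.
Hypothesis C0 : [pchar C] =i pred0.
Local Notation Q := (#|k|%:R : C).
Local Notation V := (motive_dets iota H).

(** No block has more than N elements, so N is a valid bound and [xget] does not return its
    default. *)
Lemma motive_boundP : forall d, (motive_bound iota H < d)%N -> V d = 1.
Proof.
have [P [sg [mu [fr [r [chi [u [v [c0 [[uv vsum vu] weylE VE]]]]]]]]]] :=
  motive_dets_frame K_alg sF s_diag.
apply: (@xgetPex _ 0%N [set D | forall d, (D < d)%N -> V d = 1]%classic); exists N => d Nd.
have d0 : (0 < d)%N by apply: leq_trans Nd.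
apply: (V_det_above uv vsum vu weylE (eigenframe_labels sF fr) (a := N)) (VE d d0) => // j.
by rewrite -[X in (_ <= X)%N](card_ord N) max_card.
Qed.

Lemma det_motiveE D (t : C) : (forall d, (D < d)%N -> V d = 1) ->
  det_motive iota H t = \prod_(1 <= d < D.+1) (map_poly ratr (V d)).[t * Q ^+ (d - 1)].
Proof.
pose F d := (map_poly ratr (V d) : {poly C}).[t * Q ^+ (d - 1)].
have widen D1 D2 : (forall d, (D1 < d)%N -> V d = 1) -> (D1 <= D2)%N ->
    \prod_(1 <= d < D2.+1) F d = \prod_(1 <= d < D1.+1) F d.
  move=> h le; rewrite (@big_cat_nat _ _ _ D1.+1) //= [X in _ * X]big_nat_cond [X in _ * X]big1 ?mulr1 // => d.
  case/andP=> /andP[Dd _] _; rewrite /F h // (_ : map_poly _ _ = 1) ?hornerC //.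
  by have := map_poly_ratr_intr C 1; rewrite !rmorph1.
move=> h; rewrite /det_motive -/(F _); have [le|/ltnW le] := leqP (motive_bound iota H) D.
  by rewrite -(widen _ _ motive_boundP le).
by rewrite (widen _ _ h le).
Qed.

(* The factor of degree 1 vanishes at 1: a non-transitive action of the Frobenius
   on the eigenvalues gives the centralizer a non-trivial split central torus. *)
Lemma L_motive_multi (J : seq C) m :
  (forall P sg mu, eigenframe iota s P sg mu ->
     exists j1 j2, forall i, mu 0 j2 <> iter i Fr (mu 0 j1)) ->
  L_motive iota J m H = 0.
Proof.
have [P [sg [mu [fr [r [chi [u [v [c0 [[uv vsum vu] weylE VE]]]]]]]]]] :=
  motive_dets_frame K_alg sF s_diag.
move=> /(_ _ _ _ fr)[j1 [j2 h]].
have [Pu PF Ps _] := fr; have muF := frob_mu Pu Ps PF sF.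
pose Z := [set l | `[< exists i, mu 0 l = iter i Fr (mu 0 j1) >]].
have V1 : (V 1).[1] = 0.
  apply: (V_det_multi uv vsum vu weylE (eigenframe_labels sF fr) (Z := Z) (j1 := j1) (j2 := j2)) (VE 1%N isT).
  - by rewrite inE; apply/asboolP; exists 0%N.
  - by rewrite inE; apply/asboolP => -[i]; apply: h.
  - by move=> i j e; rewrite !inE e.
  move=> i; rewrite !inE; apply/asboolP/asboolP => -[l]; rewrite muF; last first.
    by move=> ->; exists l.+1.
  have [p p0 pE] := frob_periodic K_alg (mu 0 j1).
  case: l => [|l] /= e; last by exists l; apply: fmorph_inj e.
  have e' : Fr (mu 0 i) = Fr (iter p.-1 Fr (mu 0 j1)) by rewrite e -iterS prednK.
  by exists p.-1; apply: fmorph_inj e'.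
(* The factor of degree 1 does occur in the product: a bound 0 would give V 1 = 1, against its
   vanishing at 1. *)
have b0 : (0 < motive_bound iota H)%N.
  rewrite lt0n; apply/eqP => b0; have := motive_boundP (d := 1); rewrite b0 => /(_ isT) e.
  by move: V1; rewrite e hornerC => /eqP; rewrite oner_eq0.
rewrite /L_motive (_ : det_motive iota H (1 : C) = 0) ?mul0r // /det_motive.
rewrite big_ltn // subnn expr0 mulr1 horner_map_ratr1 // V1.
by rewrite -[0 in LHS]/(0%:~R) ratr_int mul0r.
Qed.

Variables (x : K) (d : nat).
Hypothesis x_deg : is_degree iota x d.
Hypothesis x_frame : forall P sg mu, eigenframe iota s P sg mu ->
  forall j, exists i, mu 0 j = iter i Fr x.

(** The permutation [sg] is transitive on the d blocks of equal eigenvalues, so they all have the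
    same size a. *)
Lemma motive_dets_single : exists a, [/\ N = (d * a)%N, V 1 = \sum_(i < d) 'X^i,
  forall e, (1 < e <= a)%N -> V e = 1 - 'X^d & forall e, (a < e)%N -> V e = 1].
Proof.
have [P [sg [mu [fr [r [chi [u [v [c0 [[uv vsum vu] weylE VE]]]]]]]]]] :=
  motive_dets_frame K_alg sF s_diag.
have [Pu PF Ps _] := fr; have muF := frob_mu Pu Ps PF sF.
have labels := eigenframe_labels sF fr.
have muI i j : mu 0 (iter i sg j) = iter i Fr (mu 0 j).
  by elim: i => //= i <-; rewrite muF.
have [i0 i0E] := x_frame fr ord0; have [d0 _] := x_deg.
have muE i i' : (mu 0 (iter i sg ord0) == mu 0 (iter i' sg ord0)) = (i == i' %[mod d]).
  by rewrite !muI i0E -!iterD (iter_frob_eq _ _ x_deg) eqn_modDr.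
have rp_inj i i' : (i < d)%N -> (i' < d)%N ->
    mu 0 (iter i sg ord0) = mu 0 (iter i' sg ord0) -> i = i'.
  by move=> id i'd /eqP; rewrite muE !modn_small // => /eqP.
have rp_period : mu 0 (iter d sg ord0) = mu 0 ord0.
  by apply/eqP; rewrite (muE d 0%N) modnn mod0n.
have rp_cover j : exists2 i, (i < d)%N & mu 0 j = mu 0 (iter i sg ord0).
  (* The base index [ord0] has eigenvalue Fr^i0 x, and i0 (d - 1) is -i0 modulo d. *)
  have [l lE] := x_frame fr j; exists ((l + i0 * d.-1) %% d)%N; first by rewrite ltn_mod.
  apply/eqP; rewrite lE muI i0E -iterD (iter_frob_eq _ _ x_deg) eq_sym modnDml -addnA.
  by rewrite -{2}[i0]muln1 -mulnDr addn1 prednK // -modnDmr modnMl addn0.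
pose blk j := #|[set l | mu 0 l == mu 0 j]|.
have blk_sg j : blk (sg j) = blk j.
  rewrite /blk -[RHS](card_imset _ (@perm_inj _ sg)); apply: eq_card => l; rewrite inE.
  rewrite -[l](permKV sg) mem_imset ?inE; last exact: perm_inj.
  by apply/eqP/eqP => /labels.
have blk_mu i j : mu 0 i = mu 0 j -> blk i = blk j by rewrite /blk => ->.
have blkE j : blk j = blk ord0.
  have [i _ /blk_mu ->] := rp_cover j; elim: i => //= i <-; exact: blk_sg.
exists (blk ord0); split; last first.
- move=> e ae; have b0 : (0 < blk ord0)%N by apply/card_gt0P; exists ord0; rewrite inE.
  apply: (V_det_above uv vsum vu weylE labels (a := blk ord0)) (VE e _); last exact: leq_trans ae.
    by rewrite b0.
  by move=> j; rewrite -/(blk j) blkE.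
- move=> e ea; apply: (V_det_single uv vsum vu weylE labels d0 rp_inj rp_period rp_cover ea _ (VE e _)).
    exact: blkE.
  by case/andP: ea => /ltnW.
- exact: (V_det_single_one uv vsum vu weylE labels d0 rp_inj rp_cover (VE 1%N isT)).
transitivity (\sum_(i < d) blk (iter i sg ord0)).
  transitivity (\sum_(l < N) \sum_(i < d | mu 0%R l == mu 0%R (iter i sg ord0)) 1)%N; last first.
    rewrite (exchange_big_dep predT) //=; apply: eq_bigr => i _.
    by rewrite sum1dep_card.
  rewrite -[LHS](card_ord N) -sum1_card; apply: eq_bigr => l _.
  have [i id lE] := rp_cover l; rewrite (big_pred1 (Ordinal id)) // => i' /=.
  apply/eqP/eqP => [e|-> //]; apply: val_inj => /=; apply: rp_inj => //.
  by rewrite -e -lE.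
by rewrite (eq_bigr (fun=> blk ord0)) => [|i _]; rewrite ?sum_nat_const ?card_ord // blkE.
Qed.

Lemma det_motive_single (t : C) : det_motive iota H t = orbit_factor N d t Q.
Proof.
have [a [NE V1 Ve Va]] := motive_dets_single; have [d0 _] := x_deg.
have a0 : (0 < a)%N by move: NE; case: (a) => //; rewrite muln0.
have Nd : (N %/ d = a)%N by rewrite NE mulKn.
rewrite (det_motiveE t Va) /orbit_factor Nd big_ltn // V1 subnn expr0 mulr1.
congr (_ * _).
  rewrite (_ : \sum_(i < d) 'X^i = map_poly intr (\sum_(i < d) 'X^i)); last first.
    by rewrite rmorph_sum; apply: eq_bigr => i _; rewrite /= map_polyXn.
  rewrite map_poly_ratr_intr rmorph_sum horner_sum; apply: eq_bigr => i _.
  by rewrite /= map_polyXn hornerXn.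
rewrite big_add1 /= -{1}(prednK a0) big_add1 /= big_mkord; apply: eq_bigr => j _.
rewrite Ve; last by have := ltn_ord j; rewrite -ltnS (prednK a0).
rewrite (_ : 1 - 'X^d = map_poly intr (1 - 'X^d)); last by rewrite rmorphB rmorph1 /= map_polyXn.
by rewrite map_poly_ratr_intr rmorphB rmorph1 /= map_polyXn hornerD hornerN hornerXn hornerC subSS subn0.
Qed.

(** D_d(1) / D_d(Q) telescopes. With F_j = 1 - Q^((j+1)d), its numerator is d F_0 ... F_(a-2) and
    its denominator [d]_Q F_1 ... F_(a-1), while F_0 = [d]_Q (1 - Q) and F_(a-1) = [N]_Q (1 - Q). *)
Lemma L_motive_single (J : seq C) m :
  (\sum_(i < N) Q ^+ i) * L_motive iota J m H =
  d%:R * \prod_(a <- J) orbit_factor N d (a ^+ m) Q.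
Proof.
have [a [NE _ _ _]] := motive_dets_single; have [d0 _] := x_deg.
have a0 : (0 < a)%N by move: NE; case: (a) => //; rewrite muln0.
rewrite /L_motive !det_motive_single mulrA; under eq_bigr do rewrite det_motive_single.
congr (_ * _); rewrite /orbit_factor NE mulKn //.
have Qn1 i : (0 < i)%N -> 1 - Q ^+ i != 0.
  have -> : 1 - Q ^+ i = - (#|k| ^ i - 1)%N%:R.
    by rewrite natrB ?expn_gt0 ?card_field_gt0 // natrX opprB.
  move=> i0; rewrite oppr_eq0 (proj1 (pcharf0P C) C0) subn_eq0 -ltnNge -{1}(expn0 #|k|) ltn_exp2l ?card_field_gt1 //.
have geo i (y : C) : (\sum_(j < i) y ^+ j) * (1 - y) = 1 - y ^+ i.
  by rewrite -opprB mulrN mulrC -subrX1 opprB.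
have Q1 : 1 - Q != 0 := Qn1 1%N isT.
have nz : (\sum_(i < d) Q ^+ i) * \prod_(j < a.-1) (1 - (Q * Q ^+ j.+1) ^+ d) != 0.
  rewrite mulf_neq0 //.
    by have := Qn1 d d0; rewrite -geo mulf_eq0 negb_or => /andP[].
  by apply/prodf_neq0 => j _; rewrite -exprS -exprM Qn1 // muln_gt0.
apply: (mulIf nz); rewrite mulrA mulfVK //; apply: (mulIf Q1).
have -> : \sum_(i < d) 1 ^+ i = d%:R :> C.
  by rewrite (eq_bigr (fun=> 1)) ?sumr_const ?card_ord // => i _; rewrite expr1n.
pose F j := 1 - Q ^+ (j.+1 * d).
have -> : \prod_(j < a.-1) (1 - (1 * Q ^+ j.+1) ^+ d) = \prod_(j < a.-1) F j.
  by apply: eq_bigr => j _; rewrite mul1r -exprM.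
have -> : \prod_(j < a.-1) (1 - (Q * Q ^+ j.+1) ^+ d) = \prod_(j < a.-1) F j.+1.
  by apply: eq_bigr => j _; rewrite -exprS -exprM.
have tele : (\prod_(j < a.-1) F j) * F a.-1 = F 0%N * \prod_(j < a.-1) F j.+1.
  by transitivity (\prod_(j < a.-1.+1) F j); [rewrite big_ord_recr | rewrite big_ord_recl].
have Fa : F a.-1 = (\sum_(i < d * a) Q ^+ i) * (1 - Q).
  by rewrite geo /F prednK // mulnC.
have F0 : F 0%N = (\sum_(i < d) Q ^+ i) * (1 - Q) by rewrite geo /F mul1n.
transitivity (d%:R * ((\prod_(j < a.-1) F j) * F a.-1)); first by rewrite Fa; ring.
by rewrite tele F0; ring.
Qed.

End LValues.

(** * Conjugacy classes with conjugate eigenvalues *)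

Section StandardForm.

Variables (k : finFieldType) (K : closedFieldType) (iota : {rmorphism k -> K}).
Hypothesis K_alg : integralRange iota.
Variable n : nat.
Local Notation N := n.+1.
Local Notation Fr := (frob iota).
Local Notation deg := (frob_degree iota).

(** The cyclic shift within each block of d consecutive indices. Fixing the permutation explicitly
    lets frames of different elements be compared by [perm_frob_quotient]. *)
Definition block_cycle d (sg : 'S_N) : Prop :=
  forall j, sg j = (j %/ d * d + (j %% d).+1 %% d)%N :> nat.

Definition orbit_row d (x : K) : 'rV[K]_N := \row_j iter (j %% d) Fr x.

Definition standard_form (x : K) (s : 'M[K]_N) : Prop :=
  exists (P : 'M[K]_N) (sg : 'S_N), [/\ block_cycle (deg x) sg, P \in unitmx,
    map_mx Fr P = perm_mx sg *m P & P *m s = diag_mx (orbit_row (deg x) x) *m P].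

Lemma block_cycle_exists d : (0 < d)%N -> (d %| N)%N -> exists sg, block_cycle d sg.
Proof.
move=> d0 dN; pose f (j : nat) := (j %/ d * d + (j %% d).+1 %% d)%N.
have f_div j : (f j %/ d)%N = (j %/ d)%N.
  by rewrite /f divnMDl // [X in (_ + X)%N]divn_small ?addn0 // ltn_mod.
have f_mod j : (f j %% d)%N = ((j %% d).+1 %% d)%N by rewrite /f modnMDl modn_mod.
have fN j : (j < N -> f j < N)%N.
  by move=> jN; rewrite -(divnK dN) -ltn_divLR // f_div ltn_divLR // divnK.
pose g (j : 'I_N) : 'I_N := Ordinal (fN j (ltn_ord j)).
have gI : injective g.
  move=> i j /(congr1 val) /= e; apply: val_inj => /=.
  rewrite (divn_eq i d) (divn_eq j d) -f_div e f_div; congr (_ + _)%N.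
  have : ((i %% d).+1 == (j %% d).+1 %[mod d])%N by rewrite -!f_mod e.
  by rewrite -(addn1 (i %% d)) -(addn1 (j %% d)) eqn_modDr !modn_mod => /eqP.
by exists (perm gI) => j; rewrite permE.
Qed.

Lemma block_cycle_unique d sg sg' : block_cycle d sg -> block_cycle d sg' -> sg = sg'.
Proof. by move=> h h'; apply/permP => j; apply: val_inj; rewrite /= (h j) (h' j). Qed.

Lemma orbit_row_cycle d x sg : is_degree iota x d -> block_cycle d sg ->
  forall j, orbit_row d x 0 (sg j) = Fr (orbit_row d x 0 j).
Proof.
move=> xd h j; rewrite !mxE h modnMDl modn_mod -iterS.
by rewrite -(iter_frob_mod _ xd).
Qed.

Lemma standard_form_eigenvalue x s W b : standard_form x s -> W \in unitmx ->
  W *m s = diag_mx b *m W -> forall j, exists i, b 0 j = iter i Fr x.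
Proof.
move=> [P [sg [_ Pu _ Ps]]] Wu Ws j.
by have [i ->] := diag_rows_eigenvalue Pu Ps Wu Ws j; exists (i %% deg x)%N; rewrite mxE.
Qed.

Lemma deg_iter i x : deg (iter i Fr x) = deg x.
Proof.
apply: (is_degree_unique K_alg); have [d0 h] := frob_degreeP K_alg x; split => // j.
by rewrite -iterD addnC iterD (inj_eq (@iter_frob_inj _ _ _ _)) h.
Qed.

Lemma standard_form_frob i x s : map_mx Fr s = s -> standard_form x s ->
  standard_form (iter i Fr x) s.
Proof.
move=> sF h; elim: i => [//|i [P [sg [hs Pu PF Ps]]]].
exists (map_mx Fr P), sg; rewrite iterS; split.
- by have := deg_iter 1 (iter i Fr x) => /= ->.
- by rewrite map_unitmx.
- by rewrite {1}PF map_mxM map_perm_mx.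
have := deg_iter 1 (iter i Fr x) => /= ->.
rewrite -{1}sF -map_mxM Ps map_mxM map_diag_mx; congr (diag_mx _ *m _).
by apply/rowP => j; rewrite [LHS]mxE !mxE; apply: (iterSr _ Fr).
Qed.

(** The determinant is the product of the x^(Q^j) over j < N: reducing j modulo the degree of x does
    not change these powers. *)
Lemma standard_form_norm x s : (deg x %| N)%N -> standard_form x s -> \det s = 1 ->
  norm_one k N x.
Proof.
move=> dN [P [sg [_ Pu _ Ps]]] s1; have xd := frob_degreeP K_alg x.
have := congr1 determinant Ps; rewrite !det_mulmx s1 mulr1 det_diag -{1}[\det P]mul1r.
move: Pu; rewrite unitmxE unitfE => Pd /(mulIf Pd) e.
rewrite /norm_one [X in _ == X]e (big_morph _ (exprD x) (expr0 x)); apply/eqP.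
by apply: eq_bigr => i _; rewrite mxE -(iter_frob_mod _ xd) iter_frobE.
Qed.

Lemma standard_form_eigenframe x s P sg mu : map_mx Fr s = s -> (deg x %| N)%N ->
  eigenframe iota s P sg mu ->
  (forall j, exists i, mu 0 j = iter i Fr x) -> standard_form x s.
Proof.
move=> sF dN [Pu PF Ps orb] mux; have muF := frob_mu Pu Ps PF sF.
have xd := frob_degreeP K_alg x; set d := deg x in dN xd *; have [d0 _] := xd.
have muI i j : mu 0 (iter i sg j) = iter i Fr (mu 0 j).
  by elim: i => //= i <-; rewrite muF.
pose R := enum [pred j | mu 0 j == x].
have memR j : (j \in R) = (mu 0 j == x) by rewrite mem_enum.
have cover j : exists i r, [/\ (i < d)%N, (r < size R)%N & j = iter i sg (nth ord0 R r)].
  have [i iE] := mux j; exists (i %% d)%N.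
  pose r := iter (i %% d)%N (sg^-1)%g j.
  have rj : iter (i %% d)%N sg r = j.
    by rewrite /r; elim: (i %% d)%N j {iE r} => // a IH j; rewrite iterSr /= permKV IH.
  have rR : r \in R.
    rewrite memR; apply/eqP/(@iter_frob_inj _ _ iota (i %% d)%N).
    by rewrite -muI rj iE (iter_frob_mod _ xd).
  by exists (index r R); rewrite ltn_mod d0 index_mem rR nth_index.
have sizeR : (N <= size R * d)%N.
  pose f (p : 'I_(size R) * 'I_d) := iter p.2 sg (nth ord0 R p.1).
  have : (#|'I_N| <= #|[set f p | p in [set: 'I_(size R) * 'I_d]]|)%N.
    apply/subset_leq_card/fintype.subsetP => j _; apply/imsetP.
    have [i [r [id rR jE]]] := cover j.
    by exists (Ordinal rR, Ordinal id); rewrite ?inE.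
  rewrite card_ord => /leq_trans; apply; apply: leq_trans (leq_imset_card _ _) _.
  by rewrite cardsT card_prod !card_ord.
have divR (j : 'I_N) : (j %/ d < size R)%N.
  by rewrite ltn_divLR // (leq_trans (ltn_ord j)).
(* The new order of the frame: position b d + r receives the r-th iterate under [sg] of the b-th
   index with eigenvalue x. The bound on the size of [R] ensures that this index exists. *)
pose t (j : 'I_N) := iter (j %% d) sg (nth ord0 R (j %/ d)).
have mut j : mu 0 (t j) = iter (j %% d) Fr x.
  by rewrite /t muI; congr iter; apply/eqP; rewrite -memR mem_nth.
have tI : injective t.
  move=> i j e; have : iter (i %% d) Fr x == iter (j %% d) Fr x by rewrite -!mut e.
  rewrite (iter_frob_eq _ _ xd) !modn_mod => /eqP ij; move: e; rewrite /t ij.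
  rewrite -!permX => /perm_inj/eqP; rewrite nth_uniq ?enum_uniq // => /eqP e.
  by apply: val_inj => /=; rewrite (divn_eq i d) e ij -divn_eq.
have [cy cyE] := block_cycle_exists d0 dN.
have tcy j : t (cy j) = sg (t j).
  rewrite /t cyE divnMDl // (divn_small (ltn_pmod _ d0)) addn0 modnMDl modn_mod.
  set r := nth _ _ _; rewrite -iterS; have := ltn_mod j d; rewrite d0 leq_eqVlt => /orP[/eqP e|lt].
    have rx : mu 0 r = x by apply/eqP; rewrite -memR mem_nth.
    rewrite e modnn /=; apply/esym/orb; rewrite muI rx; apply/eqP.
    by rewrite (iter_frob_eq d 0%N xd) modnn mod0n.
  by rewrite modn_small.
exists (row_perm (perm tI) P), cy; split => //.
- by rewrite row_permE unitmx_mul unitmx_perm.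
- apply/matrixP => i j; rewrite -row_permE !mxE !permE tcy.
  by have /matrixP/(_ (t i) j) := PF; rewrite -row_permE !mxE.
rewrite row_permE -mulmxA Ps !mulmxA; congr (_ *m _); apply: perm_mx_diag => j.
by rewrite permE mut mxE.
Qed.

(** In a frame permuted by the block cycle, the matrix with eigenvalues [orbit_row] is fixed by the
    Frobenius, hence comes from k; its determinant is the norm of x. *)
Lemma standard_form_exists x : norm_one k N x ->
  exists2 s0 : 'M[k]_N, \det s0 = 1 & standard_form x (map_mx iota s0).
Proof.
move=> x1; have xd := frob_degreeP K_alg x; have [d0 _] := xd.
have dN := degree_dvdn K_alg (ltn0Sn n) x1.
have [sg cy] := block_cycle_exists d0 dN.
have [V [Vu VF _]] := vandermonde_perm K_alg sg.
pose y := orbit_row (deg x) x.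
have [s0 s0E] : exists s0 : 'M[k]_N, map_mx iota s0 = conj_diag V y.
  apply: frob_fixed_mx; rewrite (frob_conj_diag Vu VF); congr conj_diag.
  by apply/rowP => j; rewrite [LHS]mxE -(orbit_row_cycle xd cy) permKV.
exists s0; last first.
  by exists V, sg; split => //; rewrite s0E conj_diagK.
apply: (fmorph_inj iota); rewrite rmorph1 -det_map_mx s0E det_conj_diag //.
rewrite -[RHS](eqP x1) (big_morph _ (exprD x) (expr0 x)).
by apply: eq_bigr => i _; rewrite mxE -(iter_frob_mod _ xd) iter_frobE.
Qed.

(* The determinant of the conjugating matrix is corrected on one cycle, by a
   solution z of z^(1 + Q + ... + Q^(d-1)) = c. *)
Lemma standard_form_conj x (s s' : 'M[K]_N) : (deg x %| N)%N ->
  standard_form x s -> standard_form x s' ->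
  exists2 h : 'M[k]_N, \det h = 1 & s *m map_mx iota h = map_mx iota h *m s'.
Proof.
move=> dN [P [sg [cy Pu PF Ps]]] [P' [sg' [cy' P'u P'F P's]]].
move: P'F; rewrite (block_cycle_unique cy' cy) => P'F {sg' cy'}.
have xd := frob_degreeP K_alg x; set d := deg x in dN xd cy Ps P's *; have [d0 _] := xd.
have [u0 u0E] := frob_fixed_mx (perm_frob_quotient Pu PF P'F).
have u0u : \det u0 != 0.
  by rewrite -(fmorph_eq0 iota) -det_map_mx u0E -unitfE -unitmxE unitmx_mul unitmx_inv Pu.
pose qd := (\sum_(i < d) #|k| ^ i)%N.
have qd0 : (0 < qd)%N by rewrite /qd -(prednK d0) big_ord_recl addn_gt0 expn0.
pose l := iota (\det u0)^-1; have l0 : l != 0 by rewrite fmorph_eq0 invr_eq0.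
have [z zE] : exists z, z ^+ qd = l.
  have [|z] := @closed_rootP K ('X^qd - l%:P) _; last first.
    by rewrite /root !hornerE subr_eq0 => /eqP; exists z.
  by rewrite size_XnsubC //; case: (qd) qd0.
have z0 : z != 0 by apply: contraNneq l0 => z0; rewrite -zE z0 expr0n gtn_eqF.
have zd : iter d Fr z = z.
  apply/eqP; rewrite frob_period_exp // predn_exp mulnC exprM zE; apply/eqP/(mulfI l0).
  by rewrite -exprS prednK ?card_field_gt0 // mulr1; apply: frob_iota.
(* Rescaling the rows of the first cycle by the conjugates of z respects the Frobenius rule because
   Fr^d z = z, which follows from z^(Q^d - 1) = [l]^(Q - 1) = 1. It multiplies the determinant by
   [l]. *)
pose y : 'rV[K]_N := \row_j if (j < d)%N then iter j Fr z else 1.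
have yF j : y 0 (sg j) = Fr (y 0 j).
  rewrite !mxE cy; have [jd|jd] := ltnP j d.
    rewrite divn_small // mul0n add0n ltn_mod d0 (modn_small jd) -iterS.
    move: jd; rewrite leq_eqVlt => /orP[/eqP ->|lt]; first by rewrite modnn zd.
    by rewrite modn_small.
  rewrite ltnNge (leq_trans _ (leq_addr _ _)) ?rmorph1 //.
  by rewrite -{1}[d]mul1n leq_mul2r divn_gt0 // jd orbT.
pose P2 := diag_mx y *m P'.
have P2F : map_mx Fr P2 = perm_mx sg *m P2.
  rewrite map_mxM map_diag_mx P'F mulmxA [RHS]mulmxA; congr (_ *m _).
  by apply/esym/perm_mx_diag => j; rewrite yF [RHS]mxE.
have [h hE] := frob_fixed_mx (perm_frob_quotient Pu PF P2F).
exists h.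
  apply: (fmorph_inj iota); rewrite rmorph1 -det_map_mx hE /P2 !det_mulmx det_diag.
  rewrite mulrCA -det_mulmx -u0E det_map_mx.
  rewrite (_ : \prod_i _ = l) ?/l -?rmorphM ?mulVf ?rmorph1 //.
  rewrite -/l -zE /qd (big_morph _ (exprD z) (expr0 z)).
  have dle : (d <= N)%N by apply: dvdn_leq.
  rewrite (big_ord_widen _ (fun i => z ^+ (#|k| ^ i)) dle) [RHS]big_mkcond.
  by apply: eq_bigr => i _; rewrite mxE iter_frobE.
rewrite hE; apply: (can_inj (mulKmx Pu)); rewrite !(mulmxA P) mulmxV // mul1mx.
rewrite Ps -(mulmxA _ P) mulKVmx // /P2 !mulmxA -(mulmxA _ P') P's !mulmxA diag_mxC.
by [].
Qed.

End StandardForm.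

(** * The sum over conjugacy classes *)

Lemma SL_group_set n (k : finFieldType) : group_set (SL n k).
Proof.
apply/group_setP; split=> [|g h]; rewrite !inE; first by rewrite GL_1E det1.
by rewrite GL_ME det_mulmx => /eqP -> /eqP ->; rewrite mulr1.
Qed.

Canonical SL_group n (k : finFieldType) := Group (SL_group_set n k).

Lemma SL_of_det1 n (k : finFieldType) (h : 'M[k]_(n.-1.+1)) : \det h = 1 ->
  exists2 g, g \in SL n k & GLval g = h.
Proof.
move=> h1; have hu : h \is a GRing.unit by rewrite -[_ \is a _]/(h \in unitmx) unitmxE h1 unitr1.
by exists (FinRing.unit _ hu) => //; rewrite inE /= h1.
Qed.

Section ClassSum.

Variables (k : finFieldType) (K : closedFieldType) (iota : {rmorphism k -> K}).
Hypothesis K_alg : integralRange iota.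
Variable n : nat.
Local Notation N := n.+1.
Local Notation Fr := (frob iota).
Local Notation deg := (frob_degree iota).
Local Notation pt g := (map_mx iota (GLval g) : 'M[K]_N).
Implicit Types (x : K) (g h : {'GL_N[k]}).

Lemma pt_frob g : map_mx Fr (pt g) = pt g.
Proof. exact: frob_map_iota. Qed.

Lemma det_pt g : g \in SL N k -> \det (pt g) = 1.
Proof. by rewrite inE det_map_mx => /eqP ->; rewrite rmorph1. Qed.

Lemma standard_formJ x g h : standard_form iota x (pt g) -> standard_form iota x (pt (g ^ h)%g).
Proof.
move=> [P [sg [cy Pu PF Ps]]]; exists (P *m pt h), sg; split => //.
- by rewrite unitmx_mul Pu map_unitmx; have := GL_unit h.
- by rewrite map_mxM PF pt_frob mulmxA.
rewrite (_ : pt (g ^ h)%g = invmx (pt h) *m (pt g *m pt h)).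
  rewrite -mulmxA mulKVmx ?mulmxA ?Ps //.
  by rewrite map_unitmx; have := GL_unit h.
by rewrite /conjg !GL_MxE GL_VxE !map_mxM map_invmx.
Qed.

Lemma standard_form_class x : norm_one k N x ->
  exists2 c, c \in classes (SL N k) & standard_form iota x (pt (repr c)).
Proof.
move=> x1; have [s0 s1 sx] := standard_form_exists K_alg x1.
have [g gSL gE] := SL_of_det1 (n := N) s1.
exists (g ^: SL N k)%g; first exact: mem_classes.
have [h _ ->] := repr_class (SL_group N k) g.
by apply: standard_formJ; rewrite gE.
Qed.

Lemma standard_form_class_unique x c c' : norm_one k N x ->
  c \in classes (SL N k) -> c' \in classes (SL N k) ->
  standard_form iota x (pt (repr c)) -> standard_form iota x (pt (repr c')) -> c = c'.
Proof.
move=> x1 /repr_classesP[g1 cE] /repr_classesP[g1' c'E] f f'.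
have dN := degree_dvdn K_alg (ltn0Sn n) x1.
have [h0 h1 hE] := standard_form_conj K_alg dN f f'.
have [h hSL hv] := SL_of_det1 (n := N) h1.
rewrite cE c'E; apply/esym/class_eqP/imsetP; exists h => //.
suff E : GLval (repr c') = GLval (repr c ^ h)%g by apply: val_inj E.
rewrite conjgE !GL_MxE GL_VxE hv.
have h0u : h0 \in unitmx by rewrite unitmxE h1 unitr1.
apply: (can_inj (mulKmx h0u)); rewrite mulKVmx //; apply: (map_mx_inj (f := iota)).
by rewrite !map_mxM -hE.
Qed.

Lemma standard_form_semisimple x g : standard_form iota x (pt g) -> semisimple iota g.
Proof. by move=> [P [sg [_ Pu _ Ps]]]; exists P => //; apply: rows_similar_diag Ps. Qed.

Variable C : fieldType.
Hypothesis C0 : [pchar C] =i pred0.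
Variables (J : seq C) (m : nat).
Local Notation Q := (#|k|%:R : C).
Local Notation weight x := (\prod_(a <- J) orbit_factor N (deg x) (a ^+ m) Q).

Lemma L_motive_standard x g : standard_form iota x (pt g) ->
  (\sum_(i < N) Q ^+ i) * L_motive iota J m (SL_centralizer iota g) = (deg x)%:R * weight x.
Proof.
move=> f; have ss := standard_form_semisimple f.
apply: (L_motive_single K_alg (pt_frob g) ss C0 (frob_degreeP K_alg x)).
by move=> P sg mu [Pu _ Ps _]; apply: (standard_form_eigenvalue f Pu Ps).
Qed.

(** If all eigenvalues were conjugate to one x, reordering a frame would give a standard form for x,
    and determinant one would make x of norm one. So the Frobenius has several orbits on the
    eigenvalues. *)
Lemma L_motive_nonstandard g : g \in SL N k -> semisimple iota g ->
  (forall x, norm_one k N x -> ~ standard_form iota x (pt g)) ->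
  L_motive iota J m (SL_centralizer iota g) = 0.
Proof.
move=> gSL ss nf; apply: (L_motive_multi K_alg (pt_frob g) ss C0) => P sg mu fr.
apply: contrapT => h; have [Pu _ Ps _] := fr; pose x := mu 0 ord0.
have mux j : exists i, mu 0 j = iter i Fr x.
  by apply: contrapT => h'; apply: h; exists ord0, j => i e; apply: h'; exists i.
have x_frame P' sg' mu' : eigenframe iota (pt g) P' sg' mu' ->
    forall j, exists i, mu' 0 j = iter i Fr x.
  by move=> [P'u _ P's _] j; have [l ->] := diag_rows_eigenvalue Pu Ps P'u P's j.
have [a [NE _ _ _]] := motive_dets_single K_alg (pt_frob g) ss (frob_degreeP K_alg x) x_frame.
have dN : (deg x %| N)%N by rewrite NE dvdn_mulr.
have f := standard_form_eigenframe K_alg (pt_frob g) dN fr mux.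
by apply: (nf x _ f); apply: (standard_form_norm K_alg dN f (det_pt gSL)).
Qed.

(** The y for which g has a standard form are the [deg x] conjugates of x, and they all have the
    same weight. *)
Lemma sum_standard x g : g \in SL N k -> norm_one k N x -> standard_form iota x (pt g) ->
  \sum_(y <- norm_one_seq k K N | `[< standard_form iota y (pt g) >]) weight y =
  (deg x)%:R * weight x.
Proof.
move=> gSL x1 f; have [su _ smem] := norm_one_seqP iota (ltn0Sn n).
have xd := frob_degreeP K_alg x; have [d0 _] := xd.
have dN := degree_dvdn K_alg (ltn0Sn n) x1.
have degI i : deg (iter i Fr x) = deg x by apply: deg_iter.
rewrite -[LHS]big_filter (perm_big [seq iter i Fr x | i <- seq.iota 0 (deg x)]).
  transitivity (\sum_(i <- seq.iota 0 (deg x)) weight x).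
    by rewrite [LHS]big_map; apply: eq_bigr => i _; rewrite degI.
  by rewrite [LHS]big_const_seq count_predT size_iota iter_addr_0 mulr_natl.
apply: uniq_perm; first exact: filter_uniq.
  rewrite map_inj_in_uniq ?iota_uniq // => i j; rewrite !mem_iota /= !add0n => id jd /eqP.
  by rewrite (iter_frob_eq _ _ xd) !modn_small // => /eqP.
move=> y; rewrite mem_filter smem; apply/andP/mapP => [[/asboolP[P [sg [_ Pu _ Ps]]] _]|[i _ ->]].
  have [i] := standard_form_eigenvalue f Pu Ps ord0; rewrite mxE mod0n /= => yE.
  exists (i %% deg x)%N; first by rewrite mem_iota add0n ltn_mod.
  by rewrite yE (iter_frob_mod _ xd).
have fi : standard_form iota (iter i Fr x) (pt g) by apply: standard_form_frob; rewrite ?pt_frob.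
by split; [apply/asboolP | apply: (standard_form_norm K_alg _ fi (det_pt gSL)); rewrite degI].
Qed.

(** Double counting of the pairs of a norm-one x and a class in standard form for x: each x has
    exactly one class, and a class that occurs has [deg x] elements x, which is the factor in
    [L_motive_standard]. *)
Lemma L_SL_norm_one :
  (\sum_(i < N) Q ^+ i) * L_SL iota N J m = \sum_(x <- norm_one_seq k K N) weight x.
Proof.
have [su _ smem] := norm_one_seqP iota (ltn0Sn n).
pose R x (c : {set {'GL_N[k]}}) := `[< standard_form iota x (pt (repr c)) >].
transitivity (\sum_(x <- norm_one_seq k K N) \sum_(c in classes (SL N k) | R x c) weight x);
  last first.
  rewrite !big_seq; apply: eq_bigr => x; rewrite smem => x1.
  have [c0 c0c f] := standard_form_class x1; rewrite (big_pred1 c0) // => c /=.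
  apply/andP/eqP => [[cc /asboolP f']|->]; last by split => //; apply/asboolP.
  exact: standard_form_class_unique f' f.
rewrite (exchange_big_dep (mem (classes (SL N k)))) /=; last by move=> x c _ /andP[].
rewrite /L_SL mulr_sumr big_mkcondr; apply: eq_bigr => c cc.
have [gSL _] := @repr_classesP _ (SL_group N k) _ cc.
under [RHS]eq_bigl do rewrite cc.
have [[x x1 f]|nf] := pselect (exists2 x, norm_one k N x & standard_form iota x (pt (repr c))).
  rewrite (asboolT (standard_form_semisimple f)) (L_motive_standard f).
  by rewrite -(sum_standard gSL x1 f).
rewrite [RHS]big_seq_cond [RHS]big1 => [|x /andP[]]; last first.
  by rewrite smem => x1 /asboolP f; case: nf; exists x.
case: asboolP => // ss; rewrite L_motive_nonstandard ?mulr0 // => x x1 f.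
by apply: nf; exists x.
Qed.

End ClassSum.

Theorem theorem5p5 (p e q : nat) (p_prime : prime p) (e_gt0 : (0 < e)%N)
    (q_def : q = (p ^ e)%N)
    (Omega : closedFieldType) (X : set Omega) (X_curve : curve p q X)
    (S : seq (set Omega)) (S_uniq : uniq S)
    (S_points : forall v, v \in S -> closed_point q X v)
    (S_card : (2 <= size S)%N)
    (l : nat) (l_prime : prime l) (l_neq_p : l != p)
    (C : closedFieldType) (C_char0 : [pchar C] =i pred0)
    (Zl : set C) (Zl_ladic : ladic_integers l Zl)
    (JX : seq C) (JX_def : H1_frobenius_eigenvalues p q l Zl X JX)
    (n : nat) (n_gt0 : (0 < n)%N) :
  let J := J_multiset q JX S in
  exists P : {mpoly int[(size J).+1]},
    forall (m : nat), (0 < m)%N -> gcdn n (q ^ m - 1) = 1%N ->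
    forall (k : finFieldType) (K : closedFieldType) (iota : {rmorphism k -> K}),
      #|k| = (q ^ m)%N -> integralRange iota ->
      L_SL iota n J m =
        mmap intr (fun i => ((q ^ m)%:R :: [seq a ^+ m | a <- J])`_i) P.
Proof.
(* With n written as a successor, the matrix size [n.-1.+1] computes to n. *)
move=> J; case: n n_gt0 => // n _.
have [z zE] := divisor_sum_inversion (fun e => \sum_(i < e) 'X^i : {poly int}).
have [P PE] := orbit_polynomial (size J) (ltn0Sn n) zE.
exists P => m _ cop k K iota kq K_alg.
have nz : \sum_(i < n.+1) #|k|%:R ^+ i != 0 :> C.
  rewrite (_ : \sum_(i < n.+1) _ = (\sum_(i < n.+1) #|k| ^ i)%N%:R).
    by rewrite (proj1 (pcharf0P C) C_char0) big_ord_recl expn0.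
  by rewrite natr_sum; apply: eq_bigr => i _; rewrite natrX.
apply: (mulfI nz); rewrite L_SL_norm_one //.
(* Variable 0 carries q^m, the cardinality of k, and variable j + 1 the m-th power of the j-th
   element of J. *)
have -> : (fun i : 'I_(size J).+1 => ((q ^ m)%:R :: [seq a ^+ m | a <- J])`_i) =
    fun i => if unlift ord0 i is Some j then J`_j ^+ m else #|k|%:R.
  apply/funext => i; case: unliftP => [j ->|->] /=; last by rewrite kq.
  by rewrite add0n (nth_map 0) //; apply: (ltn_ord j).
rewrite PE (sum_norm_one K_alg (fun d => \prod_(a <- J) orbit_factor n.+1 d (a ^+ m) #|k|%:R) _ _ zE) //.
  by apply: eq_bigr => d _; congr (_ * _); rewrite (big_nth 0) big_mkord.
by rewrite /coprime -subn1 kq cop.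
Qed.
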